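(* Let $t>0$, $\omega,\lambda>0$, $\gamma\ge 0$, $0<\rho\le 1$, $0<\mu\le 1$. The solution of the Cauchy problem $${}^{C}\mathbf{D}_{\rho,-\omega,0^+}^{\gamma,\mu}G(v,t)=-\lambda(1-v)G(v,t),\qquad |v|\le 1,$$ $$G(v,0)=1,$$ where the derivative acts in the variable $t$, is $$G(v,t)=\sum_{n=0}^{\infty}(-\lambda)^{n}(1-v)^{n}t^{n\mu}E_{\rho,n\mu+1}^{n\gamma}(-\omega t^{\rho}).$$
   Context: Three-parameter Mittag-Leffler (Prabhakar) function: $E_{\alpha,\beta}^{\gamma}(z)=\sum_{k=0}^\infty \frac{\Gamma(\gamma+k)}{\Gamma(\gamma)\Gamma(\alpha k+\beta)}\frac{z^k}{k!}$ for $\alpha,\beta,\gamma\in\mathbb{C}$, $\mathrm{Re}(\alpha)>0$, where $\Gamma(\gamma+k)/\Gamma(\gamma)$ is read as $\gamma(\gamma+1)\cdots(\gamma+k-1)$ (equal to $1$ for $k=0$). Prabhakar integral: for $f\in L^1[0,b]$, $0<t<b<\infty$, $\mathrm{Re}(\rho),\mathrm{Re}(\mu)>0$, $\mathbf{E}_{\rho,\mu,\omega,0^+}^{\gamma}f(t)=\int_0^t (t-y)^{\mu-1}E_{\rho,\mu}^{\gamma}[\omega(t-y)^\rho]f(y)\,dy$, with the convention $\mathbf{E}_{\rho,0,\omega,0^+}^{0}f=f$. Regularized version of the Hilfer-Prabhakar fractional derivative of order $\mu$ (defined in the source for $\mu\in(0,1)$, $\nu\in[0,1]$, $\gamma,\omega\in\mathbb{R}$,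 $\rho>0$), for $f$ absolutely continuous on $[0,b]$, $0<t<b<\infty$: $${}^{C}\mathbf{D}_{\rho,\omega,0^+}^{\gamma,\mu}f(t)=\Big(\mathbf{E}_{\rho,\nu(1-\mu),\omega,0^+}^{-\gamma\nu}\mathbf{E}_{\rho,(1-\nu)(1-\mu),\omega,0^+}^{-\gamma(1-\nu)}\frac{d}{dt}f\Big)(t)=\Big(\mathbf{E}_{\rho,1-\mu,\omega,0^+}^{-\gamma}\frac{d}{dt}f\Big)(t).$$ In the Cauchy problem it is used with $-\omega$ in place of $\omega$.
   Formalization: For μ=1, γ>0 the derivative involves a Prabhakar integral of order 0, which the source leaves undefined; it is read as its limit as the order tends to 0+, namely f(t) plus the integral with 1/Γ(0)=0, agreeing with the stated convention at γ=0. *)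

(* Defs.v *)
From HB Require Import structures.
From mathcomp Require Import all_boot all_order all_algebra.
From mathcomp Require Import all_classical all_reals all_analysis.
From mathcomp Require Import complex.

Set Implicit Arguments.
Unset Strict Implicit.
Unset Printing Implicit Defensive.

Import Order.TTheory GRing.Theory Num.Theory.
Import numFieldNormedType.Exports.

Local Open Scope classical_set_scope.
Local Open Scope ring_scope.
Local Open Scope complex_scope.

Definition euler_gamma (R : realType) (x : R) : R :=
  \int[lebesgue_measure]_(s in `]0, +oo[) (s `^ (x - 1) * expR (- s)).

(* The entire function 1 / Gamma. For x <= 0 it is obtained from Euler's
   integral by 1 / Gamma x = x (x + 1) ... (x + n - 1) / Gamma (x + n), with
   x + n > 0; it vanishes at 0, -1, -2, ... *)
Definition rgamma (R : realType) (x : R) : R :=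
  let n := if 0 < x then 0%N else `|Num.floor x|%N.+1 in
  (\prod_(i < n) (x + i%:R)) / euler_gamma (x + n%:R).

(* \prod_(i < k) (c + i) is the Pochhammer symbol Gamma (c + k) / Gamma c. *)
Definition prabhakar_term (R : realType) (a b c z : R) (k : nat) : R :=
  (\prod_(i < k) (c + i%:R)) * rgamma (a * k%:R + b) * (z ^+ k / k`!%:R).

Definition prabhakar_ML (R : realType) (a b c z : R) : R :=
  limn (series (prabhakar_term a b c z)).

Definition prabhakar_kernel (R : realType) (rho m w c s : R) : R :=
  s `^ (m - 1) * prabhakar_ML rho m c (w * s `^ rho).

(* For m = 0 the term k = 0 of the kernel, s^(m-1) / Gamma m, degenerates to a
   Dirac mass at 0 (its limit as m -> 0+), while 1 / Gamma 0 = 0 deletes it from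
   prabhakar_ML: its contribution is the first summand. For c = 0 the kernel
   is then 0, and the operator is the identity. *)
Definition prabhakar_int (R : realType) (rho m w c : R) (f : R -> R) (t : R)
    : R :=
  (if m == 0 then f t else 0) +
  \int[lebesgue_measure]_(y in `[0, t]) (prabhakar_kernel rho m w c (t - y) * f y).

Definition absolutely_continuous (R : realType) (a b : R) (f : R -> R) : Prop :=
  forall e : R, 0 < e -> exists2 d : R, 0 < d &
    forall (n : nat) (x y : 'I_n -> R),
      (forall i, a <= x i /\ x i <= y i /\ y i <= b) ->
      trivIset setT (fun i => `]x i, y i[%classic) ->
      \sum_(i < n) (y i - x i) < d ->
      \sum_(i < n) `|f (y i) - f (x i)| < e.

(* Regularized Hilfer-Prabhakar derivative of order mu. *)
Definition hp_derive (R : realType) (rho w c mu : R) (f : R -> R) (t : R) : R :=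
  prabhakar_int rho (1 - mu) w (- c) (derive1 f) t.

(* hp_derive is total; this says that the expression defining it makes sense
   at t (for mu = 1 it involves the derivative of f at t). *)
Definition hp_derivable (R : realType) (rho w c mu : R) (f : R -> R) (t : R)
    : Prop :=
  (mu = 1 -> derivable f t 1) /\
  lebesgue_measure.-integrable `[0, t]
    (EFin \o (fun y => prabhakar_kernel rho (1 - mu) w (- c) (t - y) * derive1 f y)).

(* Complex-valued functions are differentiated and integrated componentwise. *)
Definition cauchy_solution (R : realType) (omega lambda gamma rho mu : R)
    (v : R[i]) (b : R) (u : R -> R[i]) : Prop :=
  let u1 t := complex.Re (u t) in
  let u2 t := complex.Im (u t) in
  [/\ absolutely_continuous 0 b u1 /\ absolutely_continuous 0 b u2,
      forall t, 0 < t < b ->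
        [/\ hp_derivable rho (- omega) gamma mu u1 t,
            hp_derivable rho (- omega) gamma mu u2 t &
            hp_derive rho (- omega) gamma mu u1 t
              +i* hp_derive rho (- omega) gamma mu u2 t
            = - lambda%:C * (1 - v) * u t] &
      u 0 = 1].

Definition G_term (R : realType) (omega lambda gamma rho mu : R) (v : R[i])
    (t : R) (n : nat) : R[i]^o :=
  (- lambda%:C) ^+ n * (1 - v) ^+ n *
  (t `^ (n%:R * mu) *
   prabhakar_ML rho (n%:R * mu + 1) (n%:R * gamma) (- omega * t `^ rho))%:C.

Definition G (R : realType) (omega lambda gamma rho mu : R) (v : R[i]) (t : R)
    : R[i] :=
  limn (series (G_term omega lambda gamma rho mu v t)).

(* Main.v *)
From HB Require Import structures.
Require Import Defs.
From mathcomp Require Import all_boot all_order all_algebra.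
From mathcomp Require Import all_classical all_reals all_analysis.
From mathcomp Require Import complex.
From mathcomp Require Import measurable_realfun ring lra.

Import Order.TTheory GRing.Theory Num.Theory.
Import numFieldNormedType.Exports.

Local Open Scope classical_set_scope.
Local Open Scope ring_scope.

Set Implicit Arguments.
Unset Strict Implicit.
Unset Printing Implicit Defensive.

(* Write K(m, c) for the kernel of the Prabhakar integral, expanded in
   Riemann-Liouville kernels s^(p-1) / Gamma p. Euler's beta integral and the
   Vandermonde identity for rising factorials give
   K(m, c) * K(m', c') = K(m + m', c + c'), where K(0, 0) is a Dirac mass.

   Existence: the n-th term of G is a^n K(n mu + 1, n gamma), with
   a = - lambda (1 - v). Its derivative is a^n K(n mu, n gamma), and convolution
   with K(1 - mu, - gamma) lowers the index n by one, which turns the series into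
   a times itself. Both components of G are primitives of integrable functions.

   Uniqueness: an absolutely continuous u is the integral of its derivative, so
   convolving the equation with K(mu, gamma) gives the Volterra equation
   u = u(0) + a K(mu, gamma) * u. The difference e of two solutions satisfies
   e = a K(mu, gamma) * e, and iterating this shows that e = 0. *)

(** * Absolutely continuous functions *)

(** The kernels are singular at 0, and the coefficients of the series in k and in n grow
    geometrically: [w]^k, a^n and the rising factorials of n gamma. Restricting Euler's integral to
    [M, M + 1] gives 1 / Gamma p <= C_M M^(-p) for every M > 0, so that a large M forces any
    prescribed ratio: 2^-1 for a single series, 4^-1 for one that enters a Cauchy product. One
    singular factor s^(q-1) then dominates all the terms, and sums and integrals are exchanged by
    dominated convergence. For mu = 1 the kernel K(0, - gamma) contains a Dirac mass, of which the
    code keeps only the function part. The convolution identities therefore carry a correction with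
    the factor [(m == 0)%R%:R], which compensates the local summand of [prabhakar_int]. The
    derivative of an absolutely continuous function is controlled only almost everywhere; it is
    identified with the density of a Stieltjes measure. As the equation holds on ]0, b[ only,
    solutions are cut off there and the endpoint b is reached by continuity. The complex equation is
    treated as a real system for the two components. *)

Section AbsolutelyContinuous.
Context {R : realType}.
Implicit Types (a b c d e : R) (f : R -> R) (s : seq (R * R)).
Notation TV := total_variation.

Definition itv_apart (p q : R * R) := (p.2 <= q.1) || (q.2 <= p.1).

Definition itv_within a b (p : R * R) := [&& a <= p.1, p.1 <= p.2 & p.2 <= b].

Definition increments f s := \sum_(p <- s) `|f p.2 - f p.1|.

Definition lengths s := \sum_(p <- s) (p.2 - p.1).

(** Lists replace indexed families so that intervals can be subdivided and concatenated. [itv_apart]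
    also keeps a degenerate interval out of the interior of the others, so it implies disjointness
    of the open intervals, and [absolutely_continuous] implies this form. *)
Definition absolutely_continuous_seq a b f := forall e, 0 < e ->
  exists2 d, 0 < d & forall s, all (itv_within a b) s ->
    pairwise itv_apart s -> lengths s < d -> increments f s < e.

Lemma absolutely_continuousW a b f :
  absolutely_continuous a b f -> absolutely_continuous_seq a b f.
Proof.
move=> acf e e0; have [d d0 acd] := acf e e0; exists d => // s.
move=> /(all_nthP (a, a)) sab /(pairwiseP (a, a)) sap sd.
pose x i := (nth (a, a) s i).1; pose y i := (nth (a, a) s i).2.
have := acd (size s) (fun i => x i) (fun i => y i).
rewrite /increments (big_nth (a, a)) big_mkord; apply.
- by move=> i; have /and3P[] := sab i (ltn_ord i).
- suff H (i j : 'I_(size s)) : (i < j)%N -> `]x i, y i[ `&` `]x j, y j[ = set0.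
    apply/trivIsetP => i j _ _; rewrite neq_ltn => /orP[/H//|/H].
    by rewrite setIC.
  move=> ij.
  apply/seteqP; split => // z [] /=; rewrite !in_itv/= => /andP[z1 z2] /andP[z3 z4].
  have := sap i j (ltn_ord i) (ltn_ord j) ij; rewrite /itv_apart.
  by case/orP => h; [have := lt_trans z3 (lt_le_trans z2 h)
    | have := lt_trans z1 (lt_le_trans z4 h)]; rewrite ltxx.
- by move: sd; rewrite /lengths (big_nth (a, a)) big_mkord.
Qed.

Lemma absolutely_continuous_seqB a b f g :
  absolutely_continuous_seq a b f -> absolutely_continuous_seq a b g ->
  absolutely_continuous_seq a b (f \- g).
Proof.
move=> acf acg e e0; have e2 : 0 < e / 2 by rewrite divr_gt0.
have [d d0 fd] := acf _ e2; have [d' d'0 gd] := acg _ e2.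
exists (Num.min d d'); first by rewrite lt_min d0.
move=> s sab sap; rewrite lt_min => /andP[sd sd'].
have := ltrD (fd s sab sap sd) (gd s sab sap sd').
rewrite -splitr; apply: le_lt_trans.
rewrite /increments -big_split/=; apply: ler_sum => p _.
apply: le_trans (ler_normB _ _).
by rewrite (_ : _ - (_ - _) = f p.2 - f p.1 - (g p.2 - g p.1))//; ring.
Qed.

Let pieces (x : R) (l : seq R) := zip (x :: l) l.

Let pieces_path (x y : R) l : itv_partition x y l ->
  [/\ all (itv_within x y) (pieces x l), pairwise itv_apart (pieces x l),
      lengths (pieces x l) = y - x & x <= y].
Proof.
elim: l x => [|z l ih] x [] /=.
  by move=> _ /eqP <-; rewrite /lengths/= big_nil subrr.
move=> /andP[xz zl] lly; have [h1 h2 h3 zy] := ih z (conj zl lly).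
have xz' := ltW xz.
rewrite /pieces/= -/(pieces z l); split.
- rewrite /itv_within/= lexx xz' zy/=; apply: sub_all h1 => p.
  by rewrite /itv_within => /and3P[zp -> ->]; rewrite (le_trans xz' zp).
- rewrite h2 andbT; apply: sub_all h1 => p /and3P[zp _ _].
  by rewrite /itv_apart/= zp.
- by rewrite /lengths big_cons/= -/(lengths _) h3 addrC addrA subrK.
- exact: le_trans zy.
Qed.

Let variation_pieces x y f l : itv_partition x y l ->
  variation x y f l = increments f (pieces x l).
Proof.
elim: l x => [|z l ih] x [] /=.
  by rewrite variation_nil /increments/= big_nil.
move=> /andP[xz zl] lly; rewrite /pieces/= -/(pieces z l) /increments big_cons/=.
rewrite -/(increments _ _) -ih// /variation/= big_nat_recl//=.
Qed.

(** Induction on [s1]: a partition of the head is moved into [s2] as a list of subintervals, and the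
    supremum over such partitions is the total variation of the head. [s2] holds what is already
    subdivided, so that one interval is treated at a time. *)
Let total_variation_seq a b f d e :
  (forall s, all (itv_within a b) s ->
    pairwise itv_apart s -> lengths s < d -> increments f s < e) ->
  forall s1 s2, all (itv_within a b) (s1 ++ s2) ->
    pairwise itv_apart (s1 ++ s2) -> lengths (s1 ++ s2) < d ->
  (\sum_(p <- s1) TV p.1 p.2 f + (increments f s2)%:E <= e%:E)%E.
Proof.
move=> H; elim => [|p s1 ih] s2.
  by rewrite /= big_nil add0e lee_fin => ? ? ?; apply: ltW; apply: H.
rewrite /= => /andP[pab sab] /andP[pap sap] sd; rewrite big_cons.
have Spos : (0 <= \sum_(p0 <- s1) TV p0.1 p0.2 f)%E.
  rewrite big_seq; apply: sume_ge0 => q qs1; apply: total_variation_ge0.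
  by move/allP: sab => /(_ q); rewrite mem_cat qs1 => /(_ isT) /and3P[].
have Ple : p.1 <= p.2 by case/and3P: pab.
have lenp : lengths (p :: s1 ++ s2) = (p.2 - p.1) + lengths (s1 ++ s2).
  by rewrite /lengths big_cons.
have ih2 : (\sum_(p0 <- s1) TV p0.1 p0.2 f + (increments f s2)%:E <= e%:E)%E.
  apply: ih => //; apply: le_lt_trans sd; rewrite lenp lerDr subr_ge0//.
have Sfin : (\sum_(p0 <- s1) TV p0.1 p0.2 f)%E \is a fin_num.
  rewrite ge0_fin_numE//; apply: le_lt_trans (ltry e).
  apply: le_trans ih2; rewrite leeDl// lee_fin; exact: sumr_ge0.
(* The finite summands go to the right, leaving a supremum to be bounded partition by partition. *)
rewrite -addeA addeC -leeBrDl; last by rewrite fin_numD Sfin.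
apply: ge_ereal_sup => _ [v [l lp <-] <-].
rewrite leeBrDl ?fin_numD ?Sfin//.

have [P1 P2 P3 _] := pieces_path lp.
have := ih (pieces p.1 l ++ s2); rewrite /increments big_cat/= EFinD.
move: Sfin; case: (\sum_(p0 <- s1) _)%E => // r _.
rewrite -!EFinD !lee_fin (_ : _ + _ + variation _ _ _ _ = r + (increments f (pieces p.1 l) + increments f s2)); last first.
  by rewrite variation_pieces// /increments; ring.
apply.
- move: sab; rewrite !all_cat => /andP[-> ->]; rewrite andbT/=.
  apply: sub_all P1 => q /and3P[q1 q2 q3]; case/and3P: pab => p1 p2 p3.
  by rewrite /itv_within (le_trans p1 q1) q2 (le_trans q3 p3).
- have sub t : all (itv_apart p) t -> allrel itv_apart (pieces p.1 l) t.
    move=> pt; apply/allrelP => q r0 /(allP P1) /and3P[q1 q2 q3] /(allP pt).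
    by rewrite /itv_apart => /orP[h|h]; rewrite ?(le_trans q3 h)// (le_trans h q1) orbT.
  move: pap; rewrite all_cat => /andP[ps1 ps2].
  move: sap; rewrite !pairwise_cat allrel_catr => /and3P[-> -> ->].
  rewrite P2/= sub// !andbT; apply/allrelP => q r0 qs1 rp.
  by have /allrelP/(_ r0 q rp qs1) := sub _ ps1; rewrite /itv_apart orbC.
- move: sd; rewrite lenp -P3 /lengths !big_cat/=; congr (_ < _).
  by rewrite !addrA; congr (_ + _); rewrite addrC.
Qed.

(** With the d given for e = 1, an interval shorter than d has variation at most 1, and finitely
    many steps of length d / 2 cover [a, b]. *)
Let total_variation_lty a b f : a <= b -> absolutely_continuous_seq a b f ->
  (TV a b f < +oo)%E.
Proof.
move=> ab acf; have [d d0 Hd] := acf 1 ltr01.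
have step x y : a <= x -> x <= y -> y <= b -> y - x < d -> (TV x y f < +oo)%E.
  move=> ax xy yb xyd; apply: le_lt_trans (ltry 1).
  have := total_variation_seq Hd (s1 := [:: (x, y)]) (s2 := [::]).
  rewrite /itv_within/= ax xy yb /lengths !big_seq1 /increments big_nil adde0.
  exact.
have dd : 0 < d / 2 by rewrite divr_gt0.
have aux n : forall y, a <= y -> y <= b -> y <= a + n%:R * (d / 2) ->
    (TV a y f < +oo)%E.
  elim: n => [|n ih] y ay yb.
    rewrite mul0r addr0 => ya; have -> : y = a by apply/eqP; rewrite eq_le ya ay.
    by rewrite total_variationxx ltry.
  move=> yn; have [yn'|/ltW yn'] := leP y (a + d / 2).
    apply: step => //; rewrite ltrBlDl; apply: le_lt_trans yn' _.
    by rewrite ltrD2l ltr_pdivrMr// ltr_pMr// ltr1n.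
  have ay' : a <= y - d / 2 by rewrite lerBrDr.
  rewrite (total_variationD f ay'); last by rewrite gerBl ltW.
  apply: lte_add_pinfty.
    apply: ih => //; first by rewrite lerBlDr (le_trans yb)// lerDl ltW.
    by rewrite lerBlDr (le_trans yn)// -natr1; lra.
  apply: step => //; first by rewrite gerBl ltW.
  by rewrite opprB addrC subrK ltr_pdivrMr// ltr_pMr// ltr1n.
apply: (aux (Num.bound ((b - a) / (d / 2)))) => //.
rewrite -lerBlDl -ler_pdivrMr//; apply/ltW/archi_boundP.
by apply: divr_ge0; [rewrite subr_ge0|exact: ltW].
Qed.

(* V is the total variation of f on [a, x]. *)
Lemma absolutely_continuous_nondecreasing_diff a b f : a <= b ->
    absolutely_continuous_seq a b f ->
  exists V W : R -> R, [/\ {in `[a, b] &, nondecreasing_fun V},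
    {in `[a, b] &, nondecreasing_fun W}, absolutely_continuous_seq a b V,
    absolutely_continuous_seq a b W & f = V \- W].
Proof.
move=> ab acf; pose V x := fine (TV a x f); exists V, (V \- f).
have TVfin x y : a <= x -> x <= y -> y <= b -> TV x y f \is a fin_num.
  move=> ax xy yb; rewrite ge0_fin_numE ?total_variation_ge0//.
  apply: le_lt_trans (total_variation_lty ab acf).
  rewrite (total_variationD f (le_trans ax xy) yb) (total_variationD f ax xy).
  by rewrite -addeA addeCA leeDl// adde_ge0// total_variation_ge0.
have Vxy x y : a <= x -> x <= y -> y <= b -> V y - V x = fine (TV x y f).
  move=> ax xy yb; rewrite /V (total_variationD f ax xy) fineD ?TVfin//.
    by rewrite addrC addKr.
  exact: le_trans yb.
have Vnd : {in `[a, b] &, nondecreasing_fun V}.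
  move=> x y; rewrite !in_itv/= => /andP[ax xb] /andP[ay yb] xy.
  by rewrite -subr_ge0 Vxy// fine_ge0// total_variation_ge0.
have Vac : absolutely_continuous_seq a b V.
  (* [total_variation_seq] gives a non-strict bound, hence e / 2. *)
  move=> e e0; have e2 : 0 < e / 2 by rewrite divr_gt0.
  have [d d0 Hd] := acf _ e2; exists d => // s sab sap sd.
  apply: (@le_lt_trans _ _ (e / 2)); last by rewrite ltr_pdivrMr// ltr_pMr// ltr1n.
  have := total_variation_seq Hd (s1 := s) (s2 := [::]); rewrite cats0 => /(_ sab sap sd).
  rewrite /increments big_nil adde0 -lee_fin; apply: le_trans.
  rewrite -sumEFin big_seq [leRHS]big_seq; apply: lee_sum => p ps.
  have /and3P[p1 p2 p3] := allP sab p ps.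
  by rewrite Vxy// ger0_norm ?fine_ge0 ?total_variation_ge0// fineK// TVfin.
split => //.
- move=> x y; rewrite !in_itv/= => /andP[ax xb] /andP[ay yb] xy.
  rewrite -subr_ge0; change (is_true (0 <= V y - f y - (V x - f x))).
  rewrite (_ : _ - (_ - _) = V y - V x - (f y - f x)); last by ring.
  rewrite Vxy// subr_ge0 -lee_fin fineK ?TVfin//.
  apply: le_trans (total_variation_ge f xy); rewrite lee_fin ler_norm//.
- exact: absolutely_continuous_seqB.
- by apply/funext => x /=; rewrite opprB addrC subrK.
Qed.

End AbsolutelyContinuous.

(** * Stieltjes measures of absolutely continuous nondecreasing functions *)

Section StieltjesAbsolutelyContinuous.
Context {R : realType}.
Variables (a b : R) (V : R -> R).
Hypotheses (ab : a <= b) (Vnd : {in `[a, b] &, nondecreasing_fun V})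
  (Vac : absolutely_continuous_seq a b V).
Notation mu := (@lebesgue_measure R).

(** The projection onto [a, b]. Composed with it, V becomes nondecreasing on the whole line and
    constant outside [a, b], as the construction of the Stieltjes measure requires. *)
Let clamp (x : R) := Num.max a (Num.min x b).

Let clamp_itv x : clamp x \in `[a, b].
Proof. by rewrite in_itv/= le_max lexx/= ge_max ab/= ge_min lexx orbT. Qed.

Let clamp_id x : x \in `[a, b] -> clamp x = x.
Proof.
by rewrite in_itv/= => /andP[ax xb]; rewrite /clamp min_l// max_r.
Qed.

Let clamp_nd x y : x <= y -> clamp x <= clamp y.
Proof.
move=> xy; rewrite /clamp ge_max le_max lexx/= le_max; apply/orP; right.
by rewrite le_min !ge_min xy lexx orbT.
Qed.

Let clamp_dist x y : x <= y -> clamp y - clamp x <= y - x.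
Proof. by move=> xy; rewrite /clamp /Num.max /Num.min; do !case: ifPn; lra. Qed.

Let F := V \o clamp.

Let F_nd : nondecreasing_fun F.
Proof. by move=> x y xy; apply: Vnd; rewrite ?clamp_itv// clamp_nd. Qed.

(** [clamp] preserves order and lengthens no interval, so the d that serves for V serves for F, with
    intervals anywhere on the line. *)
Let F_seq e : 0 < e -> exists2 d, 0 < d & forall s : seq (R * R),
  all (fun p => p.1 <= p.2) s -> pairwise itv_apart s -> lengths s < d ->
  \sum_(p <- s) (F p.2 - F p.1) < e.
Proof.
move=> e0; have [d d0 Hd] := Vac e0; exists d => // s s1 s2 s3.
have := Hd [seq (clamp p.1, clamp p.2) | p <- s].
rewrite all_map pairwise_map /lengths /increments !big_map/=.
have h1 : all (preim (fun p : R * R => (clamp p.1, clamp p.2)) (itv_within a b)) s.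
  apply: sub_all s1 => p p12; rewrite /itv_within/= clamp_nd//=.
  by have := clamp_itv p.1; have := clamp_itv p.2; rewrite !in_itv/= => /andP[_ ->] /andP[->].
have h2 : pairwise (relpre (fun p : R * R => (clamp p.1, clamp p.2)) itv_apart) s.
  apply: sub_pairwise s2 => p q; rewrite /itv_apart/=.
  by case/orP => /clamp_nd ->//; rewrite orbT.
move=> /(_ h1 h2) H; apply: le_lt_trans (H _).
  by apply: ler_sum => p _; rewrite ler_norm.
apply: le_lt_trans s3; rewrite /lengths big_seq [leRHS]big_seq.
by apply: ler_sum => p ps; apply: clamp_dist; exact: (allP s1).
Qed.

Let F_rc : right_continuous F.
Proof.
move=> x; apply/cvgrPdist_lt => e e0; have [d d0 Hd] := F_seq e0.
near=> y; have xy : x <= y by near: y; exact: nbhs_right_ge.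
have yx : y < x + d by near: y; apply: nbhs_right_lt; rewrite ltrDl.
rewrite distrC ger0_norm ?subr_ge0 ?F_nd//.
have := Hd [:: (x, y)]; rewrite /lengths !big_seq1 /= xy; apply => //.
by rewrite ltrBlDl.
Unshelve. all: by end_near. Qed.

HB.instance Definition _ := isCumulative.Build R _ R F F_nd F_rc.

Let nu := lebesgue_stieltjes_measure F.

Let nu_oc x y : x <= y -> nu `]x, y] = (F y - F x)%:E.
Proof.
move=> xy; rewrite /nu /lebesgue_stieltjes_measure/= /measure_extension.
rewrite measurable_mu_extE/=; last exact: is_ocitv.
by rewrite wlength_itv_bnd.
Qed.

Let nu_set1 (x : R) : nu [set x] = 0%E.
Proof.
apply/eqP; rewrite eq_le measure_ge0 andbT; apply/lee_addgt0Pr => e e0.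
rewrite add0e; have [d d0 Hd] := F_seq e0.
have dx : x - d / 2 <= x by rewrite gerBl ltW// divr_gt0.
apply: (@le_trans _ _ (nu `](x - d / 2), x])).
  apply: le_measure; rewrite ?inE.
  - exact: measurable_set1.
  - exact: measurable_itv.
  by move=> _ /= ->; rewrite in_itv/= lexx andbT ltrBlDr ltrDl divr_gt0.
rewrite nu_oc// lee_fin; apply: ltW.
have := Hd [:: (x - d / 2, x)]; rewrite /lengths !big_seq1/= dx; apply => //.
by rewrite opprB addrC subrK ltr_pdivrMr// ltr_pMr// ltr1n.
Qed.

(* An interval is approximated by its hull, as nu has no atom. *)
Let nu_interval (I : set R) : is_interval I -> I !=set0 -> (mu I < +oo)%E ->
  exists p : R * R, [/\ p.1 <= p.2, `]p.1, p.2[ `<=` I, I `<=` `[p.1, p.2], mu I = (p.2 - p.1)%:E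
    & (nu I <= (F p.2 - F p.1)%:E)%E].
Proof.
move=> itI [z Iz]; have <- : [set` Rhull I] = I by apply: RhullK; rewrite inE.
have : [set` Rhull I] z by rewrite RhullK ?inE.
case: (Rhull I) => -[l x|l] [r y|r] /=; rewrite ?in_itv/= => zI; last first.
- move: zI; rewrite lebesgue_measure_itv/=; case: l; case: r; rewrite ?bnd_simp/= ?ltxx ?andbF //=.
- by move: zI; rewrite lebesgue_measure_itv/=; case: l => //=; rewrite ltNyr/= ltxx.
- by move: zI; rewrite lebesgue_measure_itv/=; case: r; rewrite ?andbF//= ltry/= ltxx.
move=> _; have xy : x <= y.
  by move: zI => /andP[]; case: l; case: r => /= h1 h2; lra.
exists (x, y); split => //=.
- by apply: subset_itv; rewrite ?bnd_simp; case: l r {zI} => [] [].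
- by apply: subset_itv; rewrite ?bnd_simp; case: l r {zI} => [] [].
- rewrite lebesgue_measure_itv/= lte_fin; case: ifPn => // ; rewrite -leNgt => yx.
  by rewrite (_ : y = x) ?subrr//; apply/eqP; rewrite eq_le yx xy.
apply: (@le_trans _ _ (nu ([set x] `|` `]x, y]))).
  apply: le_measure; rewrite ?inE.
  - exact: measurable_itv.
  - exact: (measurableU _ _ (measurable_set1 x) (measurable_itv `]x, y])).
  move=> t /=; rewrite !in_itv/=; have [->|tx] := eqVneq t x; first by left.
  move=> tI; right; move: tI; case: l {zI} => /=; case: r => /=; rewrite ?[x < t]lt_neqAle [x == _]eq_sym tx/= => /andP[h1 h2]; lra.
apply: le_trans (measureU2 nu (measurable_set1 x) (measurable_itv `]x, y])) _.
have h1 : (nu [set x] <= 0)%E by rewrite nu_set1.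
have h2 : (nu `]x, y] <= (F y - F x)%:E)%E by rewrite nu_oc.
by have := leeD h1 h2; rewrite add0e; apply.
Qed.

(** Cover the null set by an open U of Lebesgue measure below d. U is a countable disjoint union of
    open intervals, and by [F_seq] the increments of F over finitely many of them sum to less than
    e. *)
Let nu_null (A : set R) : measurable A -> mu A = 0%E -> nu A = 0%E.
Proof.
move=> mA muA.
apply/eqP; rewrite eq_le measure_ge0 andbT; apply/lee_addgt0Pr => e e0.
rewrite add0e; have [d d0 Hd] := F_seq e0.
have muA0 : (mu A <= 0)%E by rewrite muA.
have [|U [oU AU UAd]] := @lebesgue_regularity_outer R A d mA _ d0.
  exact: le_lt_trans muA0 (ltry 0).
have mU : measurable U by exact: open_measurable.
have muU : (mu U < d%:E)%E.
  have := measureU2 mu mA (measurableD mU mA); rewrite setDUK// => UA.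
  apply: le_lt_trans UA _; apply: le_lt_trans (leeD muA0 (lexx _)) _.
  by rewrite add0e.
apply: (@le_trans _ _ (nu U)).
  by apply: le_measure; rewrite ?inE; [exact: mA|exact: mU|].
pose I := open_disjoint_itv oU.
have mI i : measurable (I i) by apply: open_measurable; exact: open_disjoint_itv_open.
have UE : U = \bigcup_i I i by exact: open_disjoint_itv_bigcup.
have IU : \bigcup_i I i `<=` U by rewrite -UE.
have tI : trivIset setT I by exact: open_disjoint_itv_trivIset.
have muI i : (mu (I i) < +oo)%E.
  apply: le_lt_trans (lt_trans muU (ltry d)); apply: le_measure; rewrite ?inE.
  - exact: mI.
  - exact: mU.
  - by move=> x Iix; apply: IU; exists i.
have [p Hp] : {p : nat -> R * R & forall i, I i !=set0 ->
    [/\ (p i).1 <= (p i).2, `](p i).1, (p i).2[ `<=` I i, I i `<=` `[(p i).1, (p i).2],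
       mu (I i) = ((p i).2 - (p i).1)%:E
      & (nu (I i) <= (F (p i).2 - F (p i).1)%:E)%E]}.
  have : forall i, exists q : R * R, I i !=set0 -> 
    [/\ q.1 <= q.2, `]q.1, q.2[ `<=` I i, I i `<=` `[q.1, q.2], mu (I i) = (q.2 - q.1)%:E
      & (nu (I i) <= (F q.2 - F q.1)%:E)%E].
    move=> i; have [I0|I0] := pselect (I i !=set0); last by exists (0, 0).
    have [q Hq] := nu_interval (@open_disjoint_itv_is_interval R U oU i) I0 (muI i).
    by exists q.
  by move=> /(@choice _ _ _) [p Hp]; exists p.
have sumU n : (\sum_(0 <= i < n) mu (I i) <= mu U)%E.
  rewrite big_mkord -measure_bigsetU//.
  apply: le_measure; rewrite ?inE.
  - by apply: bigsetU_measurable => k _; exact: mI.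
  - exact: mU.
  by apply: subset_trans IU => x; rewrite -bigcup_mkord => -[i _ Iix]; exists i.
have -> : nu U = (\sum_(0 <= i <oo) nu (I i))%E.
  rewrite (_ : U = \bigcup_i I i); last exact: UE.
  apply/esym/cvg_lim => //.
  exact: measure_sigma_additive.
apply: lime_le; first exact: is_cvg_nneseries.
apply: nearW => n.
(* [p] gives endpoints for the non-empty components only; the empty ones contribute nothing. *)
pose s := [seq p i | i <- iota 0 n & `[< I i !=set0 >]].
have H (m : set R -> \bar R) : m set0 = 0%E ->
    (\sum_(0 <= i < n) m (I i) =
     \sum_(i <- [seq i <- iota 0 n | `[< I i !=set0 >]]) m (I i))%E.
  move=> m0; rewrite big_filter [RHS]big_mkcond/= /index_iota subn0; apply: eq_bigr => i _.
  by case: asboolP => // /nonemptyPn ->.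
apply: (@le_trans _ _ ((\sum_(q <- s) (F q.2 - F q.1))%:E)).
  rewrite (H nu (measure0 nu)) /s big_map -sumEFin big_seq [leRHS]big_seq; apply: lee_sum => i.
  by rewrite mem_filter => /andP[/asboolP /Hp[]].
rewrite lee_fin; apply: ltW; apply: Hd.
- by apply/allP => _ /mapP[i + ->]; rewrite mem_filter => /andP[/asboolP /Hp[]].
- rewrite /s pairwise_map.
  apply: (@sub_in_pairwise _ [in [seq i <- iota 0 n | `[< I i !=set0 >]]] (fun i j => i != j)).
  + move=> i j; rewrite !mem_filter => /andP[/asboolP nei _].
    have [pi1 piI Ipi _ _] := Hp _ nei.
    move=> /andP[/asboolP nej _] ij /=; have [pj1 pjI Ipj _ _] := Hp _ nej.
    apply: contraT.
    rewrite /itv_apart negb_or -!ltNge => /andP[h1 h2].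
    have I0 t : I i t -> I j t -> False.
      move=> Ii Ij; move: tI => /trivIsetP /(_ i j Logic.I Logic.I ij).
      by move=> /seteqP[/(_ t (conj Ii Ij))].
    (* A common point of the two components contradicts disjointness. If one hull is a single point,
       that point is the component and lies inside the other interval; otherwise the midpoint of the
       overlap will do. *)
    have [pi2|pi2] := eqVneq (p i).1 (p i).2.
      apply/negP => _; apply: (I0 (p i).1); last first.
        by apply: pjI; rewrite /= in_itv/= {1}pi2 h1 h2.
      have [t It] := nei; have := Ipi _ It; rewrite /= in_itv/= -pi2 -eq_le.
      by move/eqP => ->.
    have [pj2|pj2] := eqVneq (p j).1 (p j).2.
      apply/negP => _; apply: (I0 (p j).1).
        by apply: piI; rewrite /= in_itv/= {1}pj2 h1 h2.
      have [t It] := nej; have := Ipj _ It; rewrite /= in_itv/= -pj2 -eq_le.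
      by move/eqP => ->.
    have pi3 : (p i).1 < (p i).2 by rewrite lt_neqAle pi2.
    have pj3 : (p j).1 < (p j).2 by rewrite lt_neqAle pj2.
    apply/negP => _; pose t := (Num.max (p i).1 (p j).1 + Num.min (p i).2 (p j).2) / 2.
    have mM : Num.max (p i).1 (p j).1 < Num.min (p i).2 (p j).2.
      by rewrite lt_min !gt_max pi3 pj3 h1 h2.
    have t1 : Num.max (p i).1 (p j).1 < t by rewrite (midf_lt mM).
    have t2 : t < Num.min (p i).2 (p j).2 by rewrite (midf_lt mM).
    move: t1 t2; rewrite gt_max lt_min => /andP[t1 t2] /andP[t3 t4].
    by apply: (I0 t); [apply: piI|apply: pjI]; rewrite /= in_itv/= ?t1 ?t2.
  + exact/allP.
  + by rewrite -uniq_pairwise filter_uniq// iota_uniq.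
- rewrite -lte_fin; apply: le_lt_trans muU; have := sumU n; apply: le_trans.
  rewrite (H mu (measure0 mu)) /lengths /s big_map -sumEFin big_seq [leRHS]big_seq.
  by apply: lee_sum => i; rewrite mem_filter => /andP[/asboolP /Hp[_ _ _ -> _]].
Qed.

(** g is the Radon-Nikodym density of the Stieltjes measure restricted to ]a, b], which is dominated
    by Lebesgue measure because of [nu_null]. *)
Lemma nondecreasing_absolutely_continuous_density : exists g : R -> R,
  mu.-integrable setT (EFin \o g) /\
  forall x, a <= x <= b -> V x - V a = \int[mu]_(y in `[a, x]) g y.
Proof.
pose T := g_sigma_algebraType (R.-ocitv.-measurable).
have mab : measurable (`]a, b] : set T) by exact: measurable_itv.
have nuab : (nu `]a, b] < +oo)%E by rewrite nu_oc// ltry.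
have [|g [g0 gfin gint gE]] :=
  @radon_nikodym_sigma_finite _ T R (@lebesgue_measure R) (mfrestr mab nuab).
  move=> N N0 A mA AN; apply: nu_null; first exact: measurableI.
  by apply: N0; [exact: measurableI|move=> x [/AN]].
have gint' : mu.-integrable setT (EFin \o (fine \o g)).
  by apply: eq_integrable gint => // x _ /=; rewrite fineK.
exists (fine \o g); split => //.
move=> x /andP[ax xb]; rewrite -(Rintegral_itv_obnd_cbnd); last first.
  by apply: integrableS gint' => //; exact: (measurable_itv `]a, x]).
rewrite /Rintegral; under eq_integral do rewrite /= fineK//.
rewrite -gE//= /mfrestr /mrestr/= (_ : _ `&` _ = `]a, x]%classic); last first.
  apply/seteqP; split => y /=; rewrite ?in_itv/=; first by case.
  by move=> /andP[h1 h2]; split=> //; rewrite h1 (le_trans h2).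
transitivity (fine (nu `]a, x]%classic)); last by [].
by rewrite nu_oc//= /F [in RHS]/comp !clamp_id// ?in_itv/= ?ax ?xb ?lexx ?ab.
Qed.

End StieltjesAbsolutelyContinuous.

(** Both monotone parts of f have a density, and Lebesgue's differentiation theorem, [FTC1],
    identifies the derivative of the integral of g with g almost everywhere. *)
Theorem absolutely_continuous_FTC {R : realType} (a b : R) (f : R -> R) :
  a <= b -> absolutely_continuous a b f ->
  exists g : R -> R, [/\ lebesgue_measure.-integrable setT (EFin \o g),
    (forall x, a <= x <= b ->
       f x - f a = \int[lebesgue_measure]_(y in `[a, x]) g y)
    & {ae lebesgue_measure, forall x, a < x < b -> derive1 f x = g x}].
Proof.
move=> ab /absolutely_continuousW acf.
have [V [W [Vnd Wnd acV acW ->]]] := absolutely_continuous_nondecreasing_diff ab acf.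
have [gV [iV eV]] := nondecreasing_absolutely_continuous_density ab Vnd acV.
have [gW [iW eW]] := nondecreasing_absolutely_continuous_density ab Wnd acW.
pose g := gV \- gW.
have ig : lebesgue_measure.-integrable setT (EFin \o g).
  by have := integrableB measurableT iV iW; apply: eq_integrable.
have sub x (h : R -> R) : lebesgue_measure.-integrable setT (EFin \o h) ->
  lebesgue_measure.-integrable `[a, x] (EFin \o h).
  by apply: integrableS => //; exact: measurable_itv.
have eg x : a <= x <= b ->
    (V \- W) x - (V \- W) a = \int[lebesgue_measure]_(y in `[a, x]) g y.
  move=> axb; rewrite RintegralB//; last 2 first.
  - exact: sub.
  - exact: sub.
  by rewrite -eV// -eW// /=; ring.
exists g; split => //.
have := @FTC1 R g (BLeft a) (fun y => sub y _ ig).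
have lg : locally_integrable setT g by exact: open_integrable_locally openT ig.
move=> /(_ lg); apply: filterS.
  exact: (ae_filter_ringOfSetsType (@lebesgue_measure R)).
move=> x /= H /andP[ax xb].
have [] := H; first by rewrite lte_fin.
move=> dg <-; rewrite !derive1E.
(* At an interior point the integral formula holds on a whole neighbourhood, so the derivatives
   agree. *)
transitivity ('D_1 (fun y => (V \- W) a + \int[lebesgue_measure]_(t in `[a, y]) g t) x).
  apply: near_eq_derive; near=> y; rewrite -eg; first by rewrite addrC subrK.
  apply/andP; split; near: y; [exact: lt_le_nbhsr|exact: lt_le_nbhsl].
by rewrite deriveD// derive_cst add0r.
Unshelve. all: by end_near. Qed.

(** * Convolutions *)

Section AffineChange.
Context {R : realType}.
Notation mu := (@lebesgue_measure R).
Implicit Types (t : R) (f : R -> \bar R).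

Let mreflect t : measurable_fun [set: measurableTypeR R]
  ((fun x : R => t - x) : _ -> measurableTypeR R).
Proof. exact: measurable_funB. Qed.

Let mdilate t : measurable_fun [set: measurableTypeR R]
  ((fun x : R => t * x) : _ -> measurableTypeR R).
Proof. exact: measurable_funM. Qed.

(** By uniqueness of Lebesgue measure it suffices to look at ]a, b], whose preimage [t - b, t - a[
    has the same length. *)
Let lebesgue_measure_reflect t A : measurable A ->
  pushforward mu ((fun x => t - x) : _ -> measurableTypeR R) A = mu A.
Proof.
pose nu : {measure set (measurableTypeR R) -> \bar R} :=
  pushforward mu ((fun x : R => t - x) : _ -> measurableTypeR R).
move=> mA; apply/esym/(@lebesgue_measure_unique R (nu (mreflect t))) => //=.
move=> _ [[a b]] _ <-; rewrite /nu /pushforward/=.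
rewrite (_ : _ @^-1` _ = `[t - b, t - a[%classic); last first.
  by apply/seteqP; split => x /=; rewrite !in_itv/= => /andP[x1 x2]; apply/andP; split; lra.
rewrite !lebesgue_measure_itv/= !lte_fin (_ : (t - b < t - a) = (a < b)).
  by case: ifP => // _; rewrite -!EFinB; congr EFin; ring.
by rewrite ltrD2l ltrN2.
Qed.

Lemma ge0_integral_reflect t f : measurable_fun setT f -> (forall x, 0 <= f x)%E ->
  (\int[mu]_x f (t - x)%R = \int[mu]_x f x)%E.
Proof.
move=> mf f0.
pose nu : {measure set (measurableTypeR R) -> \bar R} :=
  pushforward mu ((fun x : R => t - x) : _ -> measurableTypeR R).
transitivity (\int[nu (mreflect t)]_x f x)%E.
  by rewrite ge0_integral_pushforward.
apply: eq_measure_integral => A mA _; exact: lebesgue_measure_reflect.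
Qed.

Lemma integral_reflect t f : measurable_fun setT f ->
  (\int[mu]_x f (t - x)%R = \int[mu]_x f x)%E.
Proof.
move=> mf; rewrite [LHS]integralE [RHS]integralE; congr (_ - _)%E.
- rewrite -[RHS](ge0_integral_reflect t)//; last exact: measurable_funepos.
  by apply: eq_integral => x _; rewrite !funeposE.
- rewrite -[RHS](ge0_integral_reflect t)//; last exact: measurable_funeneg.
  by apply: eq_integral => x _; rewrite !funenegE.
Qed.

(** The push-forward of Lebesgue measure under x -> t x, scaled by t, gives ]a, b] its length, hence
    is Lebesgue measure. *)
Lemma ge0_integral_dilate t f : 0 < t ->
  measurable_fun setT f -> (forall x, 0 <= f x)%E ->
  (\int[mu]_x f x = t%:E * \int[mu]_x f (t * x)%R)%E.
Proof.
move=> t0 mf f0.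
pose nu : {measure set (measurableTypeR R) -> \bar R} :=
  mscale (NngNum (ltW t0)) (pushforward mu ((fun x => t * x) : _ -> measurableTypeR R)).
transitivity (\int[nu (mdilate t)]_x f x)%E; last first.
  by rewrite ge0_integral_mscale//= ge0_integral_pushforward.
apply: eq_measure_integral => A mA _; apply: lebesgue_measure_unique => //=.
move=> _ [[a b]] _ <-; rewrite /nu/= /mscale/= /pushforward/=.
rewrite (_ : _ @^-1` _ = `]a / t, b / t]%classic); last first.
  by apply/seteqP; split => x /=; rewrite !in_itv/= ltr_pdivrMr// ler_pdivlMr// [t * _]mulrC.
rewrite !lebesgue_measure_itv/= !lte_fin ltr_pM2r ?invr_gt0//.
case: ifP => // _; last by rewrite mule0.
by rewrite -!EFinB -EFinM -mulrBl mulrC divfK// gt_eqF.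
Qed.

End AffineChange.

Section Convolution.
Context {R : realType}.
Notation mu := (@lebesgue_measure R).
Implicit Types (f g h : R -> R) (t : R).

(** The functions convolved below vanish on ]-oo, 0], which makes this the convolution over [0, t]
    while all integrals run over the line. *)
Definition conv f g t : R := \int[mu]_y (f (t - y) * g y).

Lemma measurable_reflect f t : measurable_fun setT f ->
  measurable_fun setT (fun y : R => f (t - y)).
Proof. by move=> mf; apply: measurableT_comp => //; exact: measurable_funB. Qed.

Lemma convC f g t : measurable_fun setT f -> measurable_fun setT g ->
  conv f g t = conv g f t.
Proof.
move=> mf mg; rewrite /conv /Rintegral; congr fine.
rewrite -(integral_reflect t).
  by apply: eq_integral => y _; rewrite subKr mulrC.
by apply/measurable_EFinP/measurable_funM => //; exact: measurable_reflect.
Qed.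

Lemma integrable_convC f g t : measurable_fun setT f -> measurable_fun setT g ->
  mu.-integrable setT (fun y => (f (t - y) * g y)%:E) ->
  mu.-integrable setT (fun y => (g (t - y) * f y)%:E).
Proof.
move=> mf mg /integrableP[m1 h]; apply/integrableP; split.
  by apply/measurable_EFinP/measurable_funM => //; exact: measurable_reflect.
apply: le_lt_trans h; rewrite -(integral_reflect t).
  by rewrite le_eqVlt; apply/orP; left; apply/eqP/eq_integral => y _; rewrite subKr mulrC.
apply: measurableT_comp => //.
by apply/measurable_EFinP/measurable_funM => //; exact: measurable_reflect.
Qed.

(* conv g h need not be known to be measurable, hence phi. *)
Lemma conv_assoc f g h phi t :
  measurable_fun setT f -> measurable_fun setT g -> measurable_fun setT h ->
  measurable_fun setT phi ->
  {ae mu, forall s, f (t - s) != 0 -> phi s = conv g h s} ->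
  (forall s, f (t - s) != 0 -> mu.-integrable setT (fun y => (g (s - y) * h y)%:E)) ->
  (forall y, h y != 0 -> mu.-integrable setT (fun r => (f (t - y - r) * g r)%:E)) ->
  (\int[mu]_y (`|h y|%:E * \int[mu]_r `|f (t - y - r) * g r|%:E) < +oo)%E ->
  conv f phi t = conv (conv f g) h t.
Proof.
move=> mf mg mh mphi phiE igh ifg fin; rewrite /conv /Rintegral; congr fine.
pose F (p : R * R) : R := f (t - p.1) * (g (p.1 - p.2) * h p.2).
have mF : measurable_fun setT F.
  apply: measurable_funM; first by apply: measurableT_comp => //; exact: measurable_funB.
  apply: measurable_funM; last exact: measurableT_comp.
  by apply: measurableT_comp => //; exact: measurable_funB.
(* Translation invariance, obtained from two reflections. *)
have shiftF (k : R -> \bar R) y : measurable_fun setT k ->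
  (\int[mu]_s k (s - y)%R = \int[mu]_s k s)%E.
  move=> mk; rewrite -[LHS](integral_reflect 0); last first.
    by apply: measurableT_comp => //; exact: measurable_funB.
  rewrite -[RHS](integral_reflect (- y))//.
  by apply: eq_integral => s _; congr k; ring.
(* In the variable s = y + r the hypothesis [fin] is Tonelli's condition for F. *)
have iF : (mu \x mu)%E.-integrable setT (EFin \o F).
  apply/integrable21ltyP; first exact/measurable_EFinP.
  apply: le_lt_trans fin; rewrite le_eqVlt; apply/orP; left; apply/eqP.
  apply: eq_integral => y _.
  have mk : measurable_fun setT (fun r : R => `|f (t - y - r) * g r|%:E).
    apply/measurable_EFinP; apply: measurableT_comp => //.
    by apply: measurable_funM => //; exact: measurable_reflect.
  rewrite -ge0_integralZl//.
  rewrite -[RHS](shiftF _ y); last first.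
    exact: emeasurable_funM.
  apply: eq_integral => s _; rewrite /F/= -EFinM -normrM; congr (EFin `|_|).
  by rewrite (_ : t - y - (s - y) = t - s); ring.
(* For almost every s the inner integral is f (t - s) times phi s; both vanish where f (t - s)
   does. *)
transitivity (\int[mu]_s \int[mu]_y (F (s, y))%:E)%E.
  apply: ae_eq_integral => //.
  - by apply/measurable_EFinP; apply: measurable_funM => //; exact: measurable_reflect.
  - exact: (measurable_fubini_F iF).
  move: phiE; apply: filterS; first exact: (ae_filter_ringOfSetsType mu).
  move=> s phis _; have [f0|f0] := eqVneq (f (t - s)) 0.
    rewrite f0 mul0r; under eq_integral do rewrite /F/= f0 mul0r.
    by rewrite integral0.
  under [RHS]eq_integral do rewrite /F/= EFinM.
  rewrite integralZl//; last exact: igh.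
  rewrite EFinM phis// /conv /Rintegral fineK//.
  by apply: integrable_fin_num => //; exact: igh.
transitivity (\int[mu]_y \int[mu]_s (F (s, y))%:E)%E; first exact: (Fubini iF).
apply: eq_integral => y _; have [h0|h0] := eqVneq (h y) 0.
  rewrite h0 mulr0; under eq_integral do rewrite /F/= h0 !mulr0.
  by rewrite integral0.
rewrite mulrC EFinM fineK; last by apply: integrable_fin_num => //; exact: ifg.
rewrite -integralZl//; last exact: ifg.
rewrite -[RHS](shiftF _ y); last first.
  apply: emeasurable_funM => //; apply/measurable_EFinP.
  by apply: measurable_funM => //; exact: measurable_reflect.
apply: eq_integral => s _; rewrite /F/= -EFinM; congr EFin.
by rewrite (_ : t - y - (s - y) = t - s); ring.
Qed.

End Convolution.

(** * The beta integral *)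

Section EulerGamma.
Context {R : realType}.
Notation mu := (@lebesgue_measure R).
Implicit Types (p q s t : R).

(** The test replaces the default values of [powR] at s <= 0 by 0. *)
Definition power_kernel p s : R := if 0 < s then s `^ (p - 1) else 0.

Lemma power_kernel_ge0 p s : 0 <= power_kernel p s.
Proof. by rewrite /power_kernel; case: ifP => // _; exact: powR_ge0. Qed.

Lemma measurable_power_kernel p : measurable_fun setT (power_kernel p).
Proof.
apply: measurable_fun_ifT => //; exact: measurable_fun_ltr.
Qed.

Let gamma_integral p := (\int[mu]_x (power_kernel p x * expR (- x))%:E)%E.

Let measurable_gamma p :
  measurable_fun setT (fun x => power_kernel p x * expR (- x)).
Proof.
apply: measurable_funM; first exact: measurable_power_kernel.
by apply: measurableT_comp => //; exact: measurable_expR.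
Qed.

Let euler_gammaE p : euler_gamma p = fine (gamma_integral p).
Proof.
rewrite /euler_gamma /Rintegral integral_mkcond; congr fine.
apply: eq_integral => x _; rewrite /patch/= mem_setE in_itv/= andbT /power_kernel.
by case: ifP => //; rewrite mul0r.
Qed.

(** On [a, 1] with a > 0 the primitive s^p / p gives at most 1 / p; monotone convergence then lets a
    tend to 0. *)
Let power_integral01 p : 0 < p ->
  (\int[mu]_(x in `]0%R, 1%R]) (x `^ (p - 1))%:E <= (p^-1)%:E)%E.
Proof.
move=> p0.
have FTC a : 0 < a < 1 -> (\int[mu]_(x in `[a, 1%R]) (x `^ (p - 1))%:E <= (p^-1)%:E)%E.
  move=> /andP[a0 a1].
  have D (x : R) : 0 < x -> is_derive x 1 (fun y : R => p^-1 * y `^ p) (x `^ (p - 1)).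
    move=> x0; have dp := is_derive1_powR p x0.
    have dZ : is_derive x 1 (p^-1 *: (fun y : R => y `^ p)) (p^-1 *: (p * x `^ (p - 1))).
      exact: is_deriveZ.
    by move: dZ; rewrite /GRing.scale/= mulrA mulVf ?gt_eqF// mul1r.
  have cF (x : R) : 0 < x -> {for x, continuous (fun y : R => p^-1 * y `^ p)}.
    by move=> x0; apply: differentiable_continuous; apply/derivable1_diffP; case: (D x x0).
  rewrite (@continuous_FTC2 _ _ (fun y : R => p^-1 * y `^ p))//.
  - rewrite powR1 mulr1 -EFinB lee_fin gerBl mulr_ge0 ?powR_ge0// invr_ge0 ltW//.
  - apply: derivable_within_continuous => x; rewrite in_itv/= => /andP[ax _].
    by case: (is_derive1_powR (p - 1) (lt_le_trans a0 ax)).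
  - split.
    + by move=> x; rewrite in_itv/= => /andP[ax _]; have := D x (lt_trans a0 ax) => -[].
    + apply: cvg_at_right_filter; exact: (cF a a0).
    + apply: cvg_at_left_filter; exact: (cF 1 ltr01).
  - move=> x; rewrite in_itv/= => /andP[ax _].
    by rewrite derive1E; have := D x (lt_trans a0 ax) => -[_ ->].
(* n + 2 keeps every left endpoint strictly between 0 and 1. *)
pose I n : set R := `](n.+2%:R^-1), 1]%classic.
have -> : `]0, 1]%classic = \bigcup_n I n.
  apply/seteqP; split => x /=; rewrite in_itv/=.
    move=> /andP[x0 x1]; have [n nx] := ltr_add_invr x0.
    exists n => //; rewrite /I/= in_itv/= x1 andbT; apply: le_lt_trans nx.
    by rewrite add0r lef_pV2 ?posrE// ler_nat.
  by move=> [n _]; rewrite /I/= in_itv/= => /andP[nx ->]; rewrite andbT (lt_trans _ nx)// invr_gt0.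
have mI n : measurable (I n) by exact: measurable_itv.
have mf : measurable_fun setT (fun x : R => (x `^ (p - 1))%:E).
  by apply/measurable_EFinP; exact: measurable_powR.
have ndI : nondecreasing_seq I.
  move=> m n mn; apply/subsetPset; apply: subset_itvr; rewrite bnd_simp.
  by rewrite lef_pV2 ?posrE// ler_nat.
have H : (\int[mu]_(x in I i) (x `^ (p - 1))%:E)%E @[i --> \oo] -->
    (\int[mu]_(x in \bigcup_i I i) (x `^ (p - 1))%:E)%E.
  apply: ge0_nondecreasing_set_cvg_integral => //.
  - by move=> i; exact: measurable_funTS.
  - by move=> i x _; rewrite lee_fin powR_ge0.
rewrite -(cvg_lim _ H)//; apply: lime_le; first by apply/cvg_ex; eexists; exact: H.
apply: nearW => n; apply: le_trans (FTC n.+2%:R^-1 _); last first.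
  by rewrite invr_gt0 ltr0n invf_lt1// ltr1n.
apply: ge0_subset_integral => //=.
- exact: measurable_itv.
- exact: measurable_funTS.
- by move=> x _; rewrite lee_fin powR_ge0.
- by apply: subset_itv; rewrite bnd_simp.
Qed.

(** The singularity at 0 and the tail are separated: for x <= 1 the exponential is at most 1, and
    for x > 1 the power is absorbed by exp (x / 2), leaving an exponential density. *)
Let gamma_bound p : 0 < p -> exists C : R, 0 <= C /\ forall x,
  power_kernel p x * expR (- x) <=
    (if (0 < x) && (x <= 1) then x `^ (p - 1) else 0) + C * exponential_pdf (2^-1) x.
Proof.
(* For x > 1, x^(p-1) <= x^n <= n! 2^n exp (x / 2); the leading 2 cancels the rate 2^-1 in the
   density. *)
move=> p0; pose n := Num.bound p; pose C : R := 2 * (n`!%:R * 2 ^+ n).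
have C0 : 0 <= C by rewrite !mulr_ge0// exprn_ge0.
exists C; split => // x; rewrite /power_kernel; case: ifPn => [x0|]; last first.
  rewrite -leNgt => x0; rewrite mul0r add0r mulr_ge0// exponential_pdf_ge0// invr_ge0//.
have e0 : 0 <= C * exponential_pdf 2^-1 x by rewrite mulr_ge0// exponential_pdf_ge0// invr_ge0.
rewrite /=; case: ifPn => [x1|].
  rewrite -[leLHS]addr0 lerD// ler_piMr ?powR_ge0// -expR0 ler_expR oppr_le0 ltW//.
rewrite -ltNge add0r => x1.
rewrite /exponential_pdf patchE mem_set/=; last by rewrite in_itv/= ltW.
have h1 : x `^ (p - 1) <= x ^+ n.
  rewrite -(powR_mulrn _ (ltW x0)); apply: (ler_powR (ltW x1)).
  apply: (@le_trans _ _ p); first by rewrite gerBl.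
  by apply/ltW/archi_boundP/ltW.
have h2 : x ^+ n <= n`!%:R * 2 ^+ n * expR (x / 2).
  have [->|n0] := posnP n.
    by rewrite expr0 fact0 mulr1 mul1r -expR0 ler_expR divr_ge0// ltW.
  have x2 : 0 <= x / 2 by rewrite divr_ge0// ltW.
  have := expR_ge1Dxn n.-1 x2; rewrite prednK// => /(le_trans _) H.
  rewrite -ler_pdivrMl; last by rewrite mulr_gt0 ?exprn_gt0// ltr0n fact_gt0.
  have -> : (n`!%:R * 2 ^+ n)^-1 * x ^+ n = (x / 2) ^+ n / n`!%:R.
    by rewrite expr_div_n invfM mulrC mulrA mulrAC.
  by apply: H; rewrite lerDr.
rewrite (_ : expR (- x) = (expR (x / 2))^-1 * expR (- 2^-1 * x)); last first.
  by rewrite -expRN -expRD; congr expR; lra.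
rewrite (_ : C * _ = (n`!%:R * 2 ^+ n) * expR (- 2^-1 * x)); last first.
  by rewrite /C; field.
rewrite mulrA ler_wpM2r ?expR_ge0// ler_pdivrMr ?expR_gt0//.
exact: le_trans h2.
Qed.

Let gamma_fin p : 0 < p -> gamma_integral p \is a fin_num.
Proof.
move=> p0; rewrite ge0_fin_numE; last first.
  by apply: integral_ge0 => x _; rewrite lee_fin mulr_ge0 ?power_kernel_ge0 ?expR_ge0.
have [C [C0 HC]] := gamma_bound p0.
pose h x : R := if (0 < x) && (x <= 1) then x `^ (p - 1) else 0.
have mh : measurable_fun setT h.
  apply: measurable_fun_ifT => //; apply: measurable_and.
    exact: measurable_fun_ltr.
  exact: measurable_fun_ler.
have h0 x : 0 <= h x by rewrite /h; case: ifP => // _; exact: powR_ge0.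
apply: (@le_lt_trans _ _ (\int[mu]_x ((h x)%:E + C%:E * (exponential_pdf 2^-1 x)%:E)%E)%E).
  apply: ge0_le_integral => //=.
  - by move=> x _; rewrite lee_fin mulr_ge0 ?power_kernel_ge0 ?expR_ge0.
  - by apply/measurable_EFinP; exact: measurable_gamma.
  - apply/measurable_EFinP; apply: measurable_funD => //; apply: measurable_funM => //.
    exact: measurable_exponential_pdf.
  - by move=> x _; rewrite -EFinM -EFinD lee_fin; exact: HC.
rewrite ge0_integralD//=; last 4 first.
- by move=> x _; rewrite lee_fin.
- by apply/measurable_EFinP; first [exact: mh|exact: mr|exact: mc|exact: mF].
- by move=> x _; rewrite lee_fin mulr_ge0// exponential_pdf_ge0// invr_ge0.
- apply/measurable_EFinP; apply: measurable_funM => //; exact: measurable_exponential_pdf.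
rewrite ge0_integralZl//; last 2 first.
- by apply/measurable_EFinP; exact: measurable_exponential_pdf.
- by move=> x _; rewrite lee_fin exponential_pdf_ge0// invr_ge0.
rewrite integral_exponential_pdf ?invr_gt0// mule1 lte_add_pinfty ?ltry//.
apply: le_lt_trans (ltry p^-1); apply: le_trans (power_integral01 p0).
rewrite [leRHS]integral_mkcond le_eqVlt; apply/orP; left; apply/eqP.
apply: eq_integral => x _; rewrite patchE mem_setE in_itv/= /h.
by case: ifP.
Qed.

(** Euler's integral is restricted to [M, M + 1]. As M is free, Gamma p outgrows every geometric
    sequence, which is the source of all convergence below. *)
Lemma euler_gamma_ge p (M : R) : 0 < p -> 0 < M ->
  M `^ p / (M + 1) * expR (- (M + 1)) <= euler_gamma p.
Proof.
move=> p0 M0; rewrite euler_gammaE -lee_fin fineK ?gamma_fin//.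
pose c := M `^ p / (M + 1) * expR (- (M + 1)).
have c0 : 0 <= c by rewrite !mulr_ge0 ?powR_ge0 ?expR_ge0// invr_ge0 addr_ge0// ltW.
apply: (@le_trans _ _ (\int[mu]_(x in `[M, (M + 1)%R]) c%:E)%E).
  rewrite integral_cst//=.
  rewrite lebesgue_measure_itv/= lte_fin ltrDl ltr01 -EFinB addrAC subrr add0r mule1//.
rewrite [leLHS]integral_mkcond; apply: ge0_le_integral => //=.
- by move=> x _; rewrite patchE; case: ifP => // _; rewrite lee_fin.
- apply/(measurable_restrictT _ _).1 => //; exact: measurable_itv.
- by apply/measurable_EFinP; exact: measurable_gamma.
move=> x _; rewrite patchE mem_setE in_itv/=; case: ifPn => [/andP[Mx xM]|_]; last first.
  by rewrite lee_fin mulr_ge0 ?power_kernel_ge0 ?expR_ge0.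
have x0 : 0 < x by apply: lt_le_trans Mx.
rewrite lee_fin /power_kernel x0; apply: ler_pM; rewrite ?expR_ge0 ?ler_expR ?lerN2//.
  by rewrite mulr_ge0 ?powR_ge0// invr_ge0 addr_ge0// ltW.
rewrite powRD; last by apply/implyP => _; rewrite gt_eqF.
rewrite (powR_inv1 (ltW x0)); apply: ler_pM; rewrite ?powR_ge0//.
- by rewrite invr_ge0 addr_ge0// ltW.
- by apply: ge0_ler_powR => //; rewrite ?nnegrE; exact: ltW.
- by rewrite lef_pV2 ?posrE// addr_gt0.
Qed.

Lemma euler_gamma_gt0 p : 0 < p -> 0 < euler_gamma p.
Proof.
move=> p0; apply: lt_le_trans (euler_gamma_ge p0 ltr01).
by rewrite powR1 mul1r mulr_gt0 ?expR_gt0// invr_gt0 addr_gt0.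
Qed.

Lemma euler_gamma1 : euler_gamma (1 : R) = 1.
Proof.
rewrite euler_gammaE /gamma_integral -[RHS]/(fine 1%E) -(@integral_exponential_pdf R 1)//.
congr fine.
have H (x : R) : x != 0 -> power_kernel 1 x * expR (- x) = exponential_pdf 1 x.
  move=> x0; rewrite /power_kernel /exponential_pdf patchE mem_setE in_itv/= andbT le_eqVlt eq_sym (negPf x0)/=.
  by case: ifP => // _; rewrite ?mul0r// subrr powRr0 mulN1r.
apply: ae_eq_integral => //.
- by apply/measurable_EFinP; exact: measurable_gamma.
- by apply/measurable_EFinP; exact: measurable_exponential_pdf.
exists [set 0]; split; [exact: measurable_set1|exact: lebesgue_measure_set1|].
by move=> x /= Hx; apply: contrapT => /eqP x0; apply: Hx => _; rewrite H.
Qed.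

Lemma rgammaE p : 0 < p -> rgamma p = (euler_gamma p)^-1.
Proof. by move=> p0; rewrite /rgamma p0 big_ord0 addr0 mul1r. Qed.

Lemma rgamma_gt0 p : 0 < p -> 0 < rgamma p.
Proof. by move=> p0; rewrite rgammaE// invr_gt0 euler_gamma_gt0. Qed.

Lemma rgamma0 : rgamma (0 : R) = 0.
Proof. by rewrite /rgamma ltxx floor0 /= big_ord1 addr0 mul0r. Qed.

Lemma rgamma1 : rgamma (1 : R) = 1.
Proof. by rewrite rgammaE// euler_gamma1 invr1. Qed.

Lemma rgamma_ge0 p : 0 <= p -> 0 <= rgamma p.
Proof. by rewrite le_eqVlt => /predU1P[<-|/rgamma_gt0/ltW//]; rewrite rgamma0. Qed.

Lemma rgamma_upper_bound p (M : R) : 0 <= p -> 0 < M ->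
  rgamma p <= (M + 1) * expR (M + 1) * (M `^ p)^-1.
Proof.
rewrite le_eqVlt => /predU1P[<- M0|p0 M0].
  by rewrite rgamma0 !mulr_ge0 ?expR_ge0 ?invr_ge0 ?powR_ge0// addr_ge0// ltW.
have M1 : 0 < M + 1 by rewrite addr_gt0.
have := euler_gamma_ge p0 M0; rewrite -lef_pV2 ?posrE ?euler_gamma_gt0//; last first.
  by rewrite !mulr_gt0 ?powR_gt0 ?expR_gt0// invr_gt0.
rewrite -rgammaE// => /le_trans; apply.
rewrite le_eqVlt; apply/orP; left; apply/eqP; rewrite expRN.
have e1 : expR (M + 1) != 0 by rewrite gt_eqF ?expR_gt0.
have e2 : M `^ p != 0 by rewrite gt_eqF ?powR_gt0.
by field; rewrite e1 e2 gt_eqF.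
Qed.

(** The dilation y -> t y takes out t^(p + q - 1) and leaves the beta integral. *)
Lemma beta_conv p q t : 0 < p -> 0 < q -> 0 < t ->
  (\int[mu]_y (power_kernel p (t - y) * power_kernel q y)%:E =
   (power_kernel (p + q) t)%:E *
   \int[mu]_y (power_kernel p (1 - y)%R * power_kernel q y)%:E)%E.
Proof.
move=> p0 q0 t0.
have mc s : measurable_fun setT (fun y : R => power_kernel p (s - y) * power_kernel q y).
  apply: measurable_funM; last exact: measurable_power_kernel.
  by apply: measurable_reflect; exact: measurable_power_kernel.
rewrite (ge0_integral_dilate t0); last 2 first.
- by apply/measurable_EFinP; first [exact: mh|exact: mr|exact: mc|exact: mF].
- by move=> y; rewrite lee_fin mulr_ge0 ?power_kernel_ge0.
have pk r x : power_kernel r (t * x) = t `^ (r - 1) * power_kernel r x.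
  rewrite /power_kernel pmulr_rgt0//; case: ifP => x0; last by rewrite mulr0.
  by rewrite powRM// ltW.
transitivity (t%:E * \int[mu]_y ((t `^ (p - 1) * t `^ (q - 1))%:E * (power_kernel p (1 - y)%R * power_kernel q y)%:E))%E.
  congr (_ * _)%E; apply: eq_integral => y _; rewrite -EFinM; congr EFin.
  by rewrite -{1}[t]mulr1 -mulrBr !pk mulrACA.
rewrite ge0_integralZl//; last 3 first.
- by apply/measurable_EFinP; first [exact: mh|exact: mr|exact: mc|exact: mF].
- by move=> y _; rewrite lee_fin mulr_ge0 ?power_kernel_ge0.
- by rewrite lee_fin mulr_ge0 ?powR_ge0.
rewrite muleA -EFinM /power_kernel t0; congr (_%:E * _)%E.
have tn : t != 0 by rewrite gt_eqF.
rewrite -{1}[t]powRr1 ?ltW// -!powRD ?tn ?implybT//; congr powR; ring.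
Qed.

(** The product of the two Euler integrals is a double integral in x and y. With s = x + y and
    Tonelli, the inner integral becomes a convolution of powers, known from [beta_conv]. *)
Lemma gamma_beta p q : 0 < p -> 0 < q ->
  ((euler_gamma p * euler_gamma q)%:E = (euler_gamma (p + q))%:E *
    \int[mu]_y (power_kernel p (1 - y)%R * power_kernel q y)%:E)%E.
Proof.
move=> p0 q0; have pq0 : 0 < p + q by rewrite addr_gt0.
have eg r (r0 : 0 < r) : (euler_gamma r)%:E = gamma_integral r.
  by rewrite euler_gammaE (fineK (gamma_fin r0)).
rewrite (EFinM (euler_gamma p)) (eg _ p0) (eg _ q0) (eg _ pq0).
set B := (\int[mu]_y (power_kernel p (1 - y)%R * power_kernel q y)%:E)%E.
have B0 : (0 <= B)%E by apply: integral_ge0 => y _; rewrite lee_fin mulr_ge0 ?power_kernel_ge0.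
have mr r : measurable_fun setT (fun x => power_kernel r x * expR (- x)) by exact: measurable_gamma.
have pe0 r x : 0 <= power_kernel r x * expR (- x) by rewrite mulr_ge0 ?power_kernel_ge0 ?expR_ge0.
pose F (z : R * R) := power_kernel p (z.1 - z.2) * power_kernel q z.2 * expR (- z.1).
have mF : measurable_fun setT F.
  apply: measurable_funM; last first.
    by apply: measurableT_comp => //; exact: measurableT_comp.
  apply: measurable_funM; last by apply: measurableT_comp => //; exact: measurable_power_kernel.
  by apply: measurableT_comp; [exact: measurable_power_kernel|exact: measurable_funB].
have F0 z : 0 <= F z by rewrite !mulr_ge0 ?power_kernel_ge0 ?expR_ge0.
transitivity (\int[mu]_y \int[mu]_s (F (s, y))%:E)%E.
  rewrite muleC -ge0_integralZr//; last 3 first.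
  - by apply/measurable_EFinP; first [exact: mh|exact: mr|exact: mc|exact: mF].
  - by move=> y _; rewrite lee_fin.
  - by apply: integral_ge0 => y _; rewrite lee_fin.
  apply: eq_integral => y _.
  (* The substitution s = x + y, made by one reflection on each side. *)
  rewrite /gamma_integral -(ge0_integral_reflect (- y)); last 2 first.
  - by apply/measurable_EFinP; first [exact: mh|exact: mr|exact: mc|exact: mF].
  - by move=> x; rewrite lee_fin.
  rewrite -[RHS](ge0_integral_reflect 0); last 2 first.
  - by apply/measurable_EFinP; exact: (measurableT_comp mF (pair2_measurable y)).
  - by move=> x; rewrite lee_fin.
  rewrite -ge0_integralZl//; last 3 first.
  - by apply/measurable_EFinP; exact: measurable_reflect (mr p).
  - by move=> x _; rewrite lee_fin.
  - by rewrite lee_fin.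
  apply: eq_integral => s _; rewrite -EFinM /F/=; congr EFin.
  rewrite (_ : 0 - s - y = - y - s); last by ring.
  rewrite (_ : expR (- (0 - s)) = expR (- (- y - s)) * expR (- y)); first by ring.
  by rewrite -expRD; congr expR; ring.
transitivity (\int[mu]_s \int[mu]_y (F (s, y))%:E)%E.
  apply/esym; apply: (@fubini_tonelli _ _ _ _ R mu mu (EFin \o F)).
  - by apply/measurable_EFinP; first [exact: mh|exact: mr|exact: mc|exact: mF].
  - by move=> z; rewrite /= lee_fin.
rewrite -ge0_integralZr//; last 2 first.
- by apply/measurable_EFinP; first [exact: mh|exact: mr|exact: mc|exact: mF].
- by move=> y _; rewrite lee_fin.
apply: eq_integral => s _.
transitivity ((expR (- s))%:E * \int[mu]_y (power_kernel p (s - y) * power_kernel q y)%:E)%E.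
  have mk : measurable_fun setT (fun y : R => (power_kernel p (s - y) * power_kernel q y)%:E).
    apply/measurable_EFinP; apply: measurable_funM; last exact: measurable_power_kernel.
    by apply: measurable_reflect; exact: measurable_power_kernel.
  have hk (y : R) : setT y -> (0 <= (power_kernel p (s - y) * power_kernel q y)%:E)%E.
    by move=> _; rewrite lee_fin mulr_ge0 ?power_kernel_ge0.
  have hk0 : (0 <= (expR (- s))%:E)%E by rewrite lee_fin expR_ge0.
  rewrite -ge0_integralZl//.
  by apply: eq_integral => y _; rewrite -EFinM /F/= mulrC.
have [s0|s0] := ltP 0 s.
  by rewrite beta_conv// muleA -EFinM mulrC.
have -> : power_kernel (p + q) s = 0 by rewrite /power_kernel ltNge s0.
rewrite mul0r mul0e.
under eq_integral => y _.
  rewrite (_ : power_kernel p (s - y) * power_kernel q y = 0); last first.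
    rewrite /power_kernel; have [y0|] := ltP 0 y; last by rewrite mulr0.
    by rewrite subr_gt0 ltNge (le_trans s0 (ltW y0))/= mul0r.
  over.
by rewrite integral0 mule0.
Qed.

End EulerGamma.

(** * Series dominated by a geometric series *)

Section GeometricSeries.
Context {R : realType}.
Implicit Types (u v : R ^nat) (C : R).

(** The right-hand side is the sum of C 2^-k for n <= k < n + m in closed form, so that the
    induction on m closes. *)
Lemma ler_series_half C u m n : (forall k, `|u k| <= C * 2^-1 ^+ k) ->
  `|series u (n + m)%N - series u n| <= C * 2 * 2^-1 ^+ n - C * 2 * 2^-1 ^+ (n + m).
Proof.
move=> Cu; elim: m => [|m ih]; first by rewrite addn0 !subrr normr0.
rewrite addnS; have -> : series u (n + m).+1 - series u n =
    (series u (n + m) - series u n) + u (n + m)%N.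
  by rewrite /series/= big_nat_recr//= addrAC.
apply: le_trans (ler_normD _ _) _; apply: le_trans (lerD ih (Cu _)) _.
by rewrite exprS; lra.
Qed.

Let seriesS u n : series u n.+1 = series u n + u n.
Proof. by rewrite /series/= big_nat_recr. Qed.

Lemma near_half_lt C (e : R) : 0 < e -> \forall n \near \oo, C * 2^-1 ^+ n < e.
Proof.
move=> e0; have c : (fun n => C * 2^-1 ^+ n) @ \oo --> (0 : R).
  rewrite -(mulr0 C); apply: cvgMr; apply: cvg_expr.
  by rewrite ger0_norm ?invr_ge0// invf_lt1// ltr1n.
exact: (cvgr_lt _ c).
Qed.

Let C_ge0 C u : (forall k, `|u k| <= C * 2^-1 ^+ k) -> 0 <= C.
Proof. by move=> /(_ 0); rewrite expr0 mulr1; exact: le_trans. Qed.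

Lemma is_cvg_series_half C u : (forall k, `|u k| <= C * 2^-1 ^+ k) ->
  cvgn (series u).
Proof.
move=> Cu; apply: normed_cvg.
apply: (series_le_cvg (v_ := fun k => C * 2^-1 ^+ k)) => //.
- by move=> k /=; exact: normr_ge0.
- by move=> k; rewrite mulr_ge0 ?exprn_ge0 ?invr_ge0// (C_ge0 Cu).
- by apply: is_cvg_geometric_series; rewrite ger0_norm ?invr_ge0// invf_lt1// ltr1n.
Qed.

Lemma limn_series_half C u n : (forall k, `|u k| <= C * 2^-1 ^+ k) ->
  `|limn (series u) - series u n| <= C * 2 * 2^-1 ^+ n.
Proof.
move=> Cu; have cu := is_cvg_series_half Cu.
have cn : (fun m => `|series u m - series u n|) @ \oo --> `|limn (series u) - series u n|.
  by apply: cvg_norm; apply: cvgB => //; exact: cvg_cst.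
rewrite -(cvg_lim _ cn)//; apply: limr_le; first by apply/cvg_ex; eexists; exact: cn.
near=> m; have nm : (n <= m)%N by near: m; exact: nbhs_infty_ge.
rewrite -(subnKC nm); apply: le_trans (ler_series_half _ _ Cu) _.
by rewrite gerBl !mulr_ge0 ?exprn_ge0 ?invr_ge0// (C_ge0 Cu).
Unshelve. all: by end_near. Qed.

Lemma normr_series_half C u n : (forall k, `|u k| <= C * 2^-1 ^+ k) ->
  `|series u n| <= C * 2.
Proof.
move=> Cu; have := ler_series_half n 0 Cu.
rewrite add0n [series u 0]/series/= big_geq// subr0 expr0 mulr1 => /le_trans; apply.
by rewrite gerBl !mulr_ge0 ?exprn_ge0 ?invr_ge0// (C_ge0 Cu).
Qed.

Lemma normr_limn_series_half C u : (forall k, `|u k| <= C * 2^-1 ^+ k) ->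
  `|limn (series u)| <= C * 2.
Proof.
by move=> /(limn_series_half 0); rewrite /series/= big_geq// subr0 expr0 mulr1.
Qed.

Lemma limn_series1 u : (forall k, (0 < k)%N -> u k = 0) -> limn (series u) = u 0%N.
Proof.
move=> u0; apply: cvg_lim => //; apply: cvg_near_cst; near=> n.
have n0 : (0 < n)%N by near: n; exact: nbhs_infty_gt.
rewrite /series/= big_ltn// big1_seq ?addr0// => k.
by rewrite mem_index_iota => /andP[_ /andP[k0 _]]; exact: u0.
Unshelve. all: by end_near. Qed.

Lemma limn_seriesZ (a : R) u : cvgn (series u) ->
  limn (series (fun k => a * u k)) = a * limn (series u).
Proof.
move=> cu; have -> : series (fun k => a * u k) = (fun n => a * series u n).
  by apply/funext => n; rewrite /series/= mulr_sumr.
by apply: cvg_lim => //; apply: cvgMr.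
Qed.

Lemma limn_seriesB u v : cvgn (series u) -> cvgn (series v) ->
  limn (series (fun k => u k - v k)) = limn (series u) - limn (series v).
Proof.
move=> cu cv; have -> : series (fun k => u k - v k) = (fun n => series u n - series v n).
  by apply/funext => n; rewrite /series/= sumrB.
by apply: cvg_lim => //; apply: cvgB.
Qed.

Lemma limn_series_recl u : cvgn (series u) ->
  limn (series u) = u 0%N + limn (series (fun k => u k.+1)).
Proof.
move=> cu; have cu' : (fun n => series u n.+1) @ \oo --> limn (series u).
  by have := cu; rewrite -(cvg_shiftS (series u)); apply.
apply/eqP; rewrite addrC -subr_eq; apply/eqP/esym/cvg_lim => //.
have -> : series (fun k => u k.+1) = (fun n => series u n.+1 - u 0%N).
  by apply/funext => n; rewrite /series/= big_nat_recl// addrC addKr.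
by apply: cvgB => //; exact: cvg_cst.
Qed.

(* The partial sums over squares and triangles differ by at most N terms, each a
   tail of size at most 2 C 4^-N. *)
Lemma cauchy_series C (F : nat -> nat -> R) :
  (forall k j, `|F k j| <= C * 4^-1 ^+ (k + j)) ->
  limn (series (fun k => limn (series (F k)))) =
  limn (series (fun n => \sum_(k < n.+1) F k (n - k)%N)).
Proof.
move=> CF; have C0 : 0 <= C.
  by have := CF 0%N 0%N; rewrite expr0 mulr1; exact: le_trans.
(* In 4^-k one factor 2^-k pays for lengthening the tail of row k to N - k, the other for the sum
   over k. *)
have q4 : (4^-1 : R) = 2^-1 * 2^-1 by lra.
have q2 n : (0 : R) <= 2^-1 ^+ n by rewrite exprn_ge0// invr_ge0.
have q4n n : (0 : R) <= 4^-1 ^+ n by rewrite exprn_ge0// invr_ge0.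
have q42 n : 4^-1 ^+ n <= 2^-1 ^+ n :> R.
  by rewrite q4 exprMn ler_piMr// exprn_ile1// ?invr_ge0// invf_le1// ler1n.
have CFk k j : `|F k j| <= C * 4^-1 ^+ k * 2^-1 ^+ j.
  apply: le_trans (CF k j) _; rewrite exprD mulrA ler_wpM2l// mulr_ge0//.
pose A k := limn (series (F k)).
have Ak k : `|A k| <= C * 2 * 2^-1 ^+ k.
  apply: le_trans (normr_limn_series_half (CFk k)) _.
  by rewrite mulrAC ler_wpM2l// mulr_ge0.
have cA : cvgn (series A) by exact: is_cvg_series_half Ak.
pose D n := \sum_(k < n.+1) F k (n - k)%N.
(* The triangle k + j < N, summed by rows. *)
have DN N : series D N = \sum_(0 <= k < N) series (F k) (N - k)%N.
  elim: N => [|N ih]; first by rewrite /series/= !big_geq.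
  have s1 : series (F N) 1 = F N 0%N by rewrite seriesS /series/= big_geq// add0r.
  rewrite seriesS ih big_nat_recr//= subSnn s1 /D big_ord_recr/= subnn addrA.
  congr (_ + _); rewrite -(big_mkord xpredT (fun k => F k (N - k)%N)) -big_split/=.
  apply: eq_big_nat => k /andP[_ kN].
  by rewrite subSn ?(ltnW kN)// seriesS.
have half_sum N : \sum_(0 <= k < N) 2^-1 ^+ k <= 2 :> R.
  suff -> : \sum_(0 <= k < N) 2^-1 ^+ k = 2 - 2 * 2^-1 ^+ N :> R.
    by rewrite gerBl mulr_ge0.
  elim: N => [|N ih]; first by rewrite big_geq// expr0 mulr1 subrr.
  by rewrite big_nat_recr//= ih exprS; lra.
(* Row k lacks its tail from N - k on, at most 2 C 2^-N 2^-k. *)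
have AD N : `|series A N - series D N| <= 4 * C * 2^-1 ^+ N.
  rewrite DN /series/= -sumrB; apply: le_trans (ler_norm_sum _ _ _) _.
  apply: (@le_trans _ _ (\sum_(0 <= k < N) 2 * C * 2^-1 ^+ N * 2^-1 ^+ k)).
    apply: ler_sum_nat => k /andP[_ kN].
    apply: le_trans (limn_series_half (N - k) (CFk k)) _.
    rewrite le_eqVlt; apply/orP; left; apply/eqP.
    rewrite -{2}(subnK (ltnW kN)) exprD q4 exprMn; ring.
  rewrite -mulr_sumr; apply: le_trans (ler_wpM2l _ (half_sum N)) _.
    by rewrite !mulr_ge0.
  by rewrite le_eqVlt; apply/orP; left; apply/eqP; ring.
symmetry; apply: cvg_lim => //.
have d0 : (fun N => series A N - series D N) @ \oo --> (0 : R).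
  apply/cvgr0Pnorm_lt => e e0; apply: filterS (near_half_lt (4 * C) e0) => N.
  exact: le_lt_trans (AD N).
have -> : series D = (fun N => series A N - (series A N - series D N)).
  by apply/funext => N; rewrite subKr.
by rewrite -[X in _ --> X]subr0; apply: cvgB.
Qed.

End GeometricSeries.

(** * Termwise integration and continuity of dominated series *)

Section DominatedSeries.
Context d (T : measurableType d) {R : realType} (mu : {measure set T -> \bar R}).
Variables (f : nat -> T -> R) (h : T -> R).
Hypotheses (mf : forall n, measurable_fun setT (f n))
  (fh : forall n x, `|f n x| <= h x * 2^-1 ^+ n).

Lemma measurable_dominated_series :
  measurable_fun setT (fun x => limn (series (f ^~ x))).
Proof.
apply: (measurable_fun_cvg (h := fun n x => series (f ^~ x) n)).
  by move=> n; rewrite /series/=; exact: measurable_sum.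
by move=> x _; exact: (is_cvg_series_half (fh ^~ x)).
Qed.

Hypothesis ih : mu.-integrable setT (EFin \o h).

Lemma integrable_dominated_term n : mu.-integrable setT (EFin \o f n).
Proof.
apply: le_integrable (integrableZl measurableT (2^-1 ^+ n) ih) => //.
  exact/measurable_EFinP.
move=> x _; rewrite /= lee_fin; apply: le_trans (fh n x) _.
by rewrite mulrC; exact: ler_norm.
Qed.

Lemma integrable_dominated_series :
  mu.-integrable setT (fun x => (limn (series (f ^~ x)))%:E).
Proof.
apply: le_integrable (integrableZl measurableT 2 ih) => //.
  exact/measurable_EFinP/measurable_dominated_series.
move=> x _; rewrite /= lee_fin; apply: le_trans (normr_limn_series_half (fh ^~ x)) _.
by rewrite mulrC; exact: ler_norm.
Qed.

(** Dominated convergence for the partial sums, all bounded by 2 h. *)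
Lemma Rintegral_dominated_series :
  \int[mu]_x limn (series (f ^~ x)) = limn (series (fun n => \int[mu]_x f n x)).
Proof.
have [] := @dominated_convergence _ T R mu setT measurableT
  (fun n x => (series (f ^~ x) n)%:E) (fun x => (limn (series (f ^~ x)))%:E)
  (fun x => (2%:E * (h x)%:E)%E).
- by move=> n; apply/measurable_EFinP; rewrite /series/=; exact: measurable_sum.
- exact/measurable_EFinP/measurable_dominated_series.
- apply: aeW => x _; apply/cvg_EFin; first by exact: nearW.
  exact: (is_cvg_series_half (fh ^~ x)).
- exact: integrableZl.
- apply: aeW => x n _; rewrite /= lee_fin.
  by rewrite mulrC; exact: (normr_series_half n (fh ^~ x)).
move=> iF _ H; apply/esym/cvg_lim => //.
have fF : (\int[mu]_x (limn (series (f ^~ x)))%:E)%E \is a fin_num.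
  exact: integrable_fin_num.
move: H; rewrite -(fineK fF) => /fine_cvg; apply: cvg_trans.
rewrite (_ : series _ = fine \o [sequence (\int[mu]_x (series (f ^~ x) n)%:E)%E]_n)//.
apply/funext => n /=; rewrite [in LHS]/series/=.
have -> : (\int[mu]_x (series (f ^~ x) n)%:E = \int[mu]_x \sum_(0 <= i < n) (f i x)%:E)%E.
  by apply: eq_integral => x _; rewrite sumEFin.
rewrite integral_sum//=; last by move=> i; exact: integrable_dominated_term.
have E i : (\int[mu]_x (f i x)%:E = (\int[mu]_x f i x)%:E)%E.
  by rewrite fineK//; apply: integrable_fin_num => //; exact: integrable_dominated_term.
by rewrite (eq_bigr _ (fun i _ => E i)) sumEFin.
Qed.

End DominatedSeries.

Lemma continuous_dominated_series {R : realType} (f : nat -> R -> R) (C : R) (s : R) :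
  (\forall x \near s, forall n, `|f n x| <= C * 2^-1 ^+ n) ->
  (forall n, {for s, continuous (f n)}) ->
  {for s, continuous (fun x => limn (series (f ^~ x)))}.
Proof.
move=> fC cf; apply/cvgrPdist_lt => e e0.
have C0 : 0 <= C.
  by have /(_ 0) := nbhs_singleton fC; rewrite expr0 mulr1; exact: le_trans.
have e3 : 0 < e / 3 by rewrite divr_gt0.
have [N _ /(_ N (leqnn N)) /= HN] := near_half_lt (C * 2) e3.
have cN n : {for s, continuous (fun x : R => series (f ^~ x) n)}.
  elim: n => [|n ih].
    rewrite (_ : (fun x => _) = cst 0); first exact: cvg_cst.
    by apply/funext => x; rewrite /series/= big_geq.
  rewrite (_ : (fun x => _) = (fun x => series (f ^~ x) n + f n x)).
    by apply: continuousD; [exact: ih|exact: cf].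
  by apply/funext => x; rewrite /series/= big_nat_recr.
have /cvgrPdist_lt/(_ _ e3) cNe := cN N.
near=> x.
have H1 : `|limn (series (f ^~ s)) - series (f ^~ s) N| < e / 3.
  by apply: le_lt_trans HN; apply: limn_series_half; exact: nbhs_singleton fC.
have H2 : `|limn (series (f ^~ x)) - series (f ^~ x) N| < e / 3.
  by apply: le_lt_trans HN; apply: limn_series_half; near: x.
have H3 : `|series (f ^~ s) N - series (f ^~ x) N| < e / 3 by near: x; exact: cNe.
move: H1 H2 H3; rewrite !ltr_norml => /andP[a1 a2] /andP[b1 b2] /andP[c1 c2].
by apply/andP; split; lra.
Unshelve. all: by end_near. Qed.

(** * Kernels of the Prabhakar integrals *)

Section RisingFactorial.
Context {R : realType}.
Implicit Types (c : R) (k n N : nat).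

(** The coefficient of x^k in (1 - x)^(-c). *)
Definition rising_coef c k : R := (\prod_(i < k) (c + i%:R)) / k`!%:R.

Lemma rising_coef0 c : rising_coef c 0 = 1.
Proof. by rewrite /rising_coef big_ord0 fact0 invr1 mulr1. Qed.

Lemma rising_coefS c k : k.+1%:R * rising_coef c k.+1 = (c + k%:R) * rising_coef c k.
Proof.
have fk : k`!%:R != 0 :> R by rewrite pnatr_eq0 -lt0n fact_gt0.
have k1 : k.+1%:R != 0 :> R by rewrite pnatr_eq0.
rewrite /rising_coef big_ord_recr/= factS natrM.
by move: (k.+1%:R) (k`!%:R) fk k1 => x y x0 y0; field; rewrite x0 y0.
Qed.

Lemma rising_coef_zero k : (0 < k)%N -> rising_coef 0 k = 0.
Proof.
by case: k => // k _; rewrite /rising_coef big_ord_recl/= addr0 !mul0r.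
Qed.

Let rising_coef_pascal N k :
  rising_coef N.+1%:R k.+1 = rising_coef N.+1%:R k + rising_coef N%:R k.+1.
Proof.
have fk : k`!%:R != 0 :> R by rewrite pnatr_eq0 -lt0n fact_gt0.
have k0 : k.+1%:R != 0 :> R by rewrite pnatr_eq0.
have E : N%:R * rising_coef N.+1%:R k = k.+1%:R * rising_coef N%:R k.+1.
  rewrite /rising_coef big_ord_recl/= addr0 factS natrM.
  have -> : \prod_(i < k) (N%:R + (bump 0 i)%:R) = \prod_(i < k) (N.+1%:R + i%:R) :> R.
    by apply: eq_bigr => i _; rewrite /bump/= -!natrD add1n addnS addSn.
  by move: (k.+1%:R) (k`!%:R) fk k0 => x y x0 y0; field; rewrite x0 y0.
apply: (mulfI k0); rewrite rising_coefS mulrDr -E -mulrDl; congr (_ * _).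
by rewrite -!natrD addnC addSnnS.
Qed.

(** For N > 0 this is the binomial coefficient of N + k - 1 over k, and Pascal's rule adds two terms
    of half the bound. *)
Let rising_coef_nat_le N k : rising_coef N%:R k <= 2 ^+ (N + k).
Proof.
elim: N k => [|N ihN] k.
  case: k => [|k]; first by rewrite rising_coef0 expr0.
  by rewrite rising_coef_zero// exprn_ge0.
elim: k => [|k ihk]; first by rewrite rising_coef0 exprn_ege1// ler1n.
rewrite rising_coef_pascal; apply: le_trans (lerD ihk (ihN _)) _.
have -> : 2 ^+ (N.+1 + k) = 2 * 2 ^+ (N + k) :> R by rewrite addSn exprS.
have -> : 2 ^+ (N + k.+1) = 2 * 2 ^+ (N + k) :> R by rewrite addnS exprS.
have -> : 2 ^+ (N.+1 + k.+1) = 4 * 2 ^+ (N + k) :> R.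
  by rewrite addnS addSn !exprS mulrA -natrM.
lra.
Qed.

(** Factor by factor, |c + i| <= N + i. The bound is geometric in N as well as in k, because the
    parameter n gamma of the series solution grows with n. *)
Lemma normr_rising_coef_le c N k : `|c| <= N%:R -> `|rising_coef c k| <= 2 ^+ (N + k).
Proof.
move=> cN; apply: le_trans (rising_coef_nat_le N k).
rewrite /rising_coef normrM normfV normr_nat ler_wpM2r ?invr_ge0// normr_prod.
apply: ler_prod => i _; rewrite normr_ge0/=; apply: le_trans (ler_normD _ _) _.
by rewrite normr_nat lerD2r.
Qed.

(** The coefficients of (1 - x)^(-c1) (1 - x)^(-c2). In the induction the sum is multiplied by n + 1
    = k + (n + 1 - k), and [rising_coefS] is applied to one factor in each part. *)
Lemma rising_coef_vandermonde c1 c2 n :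
  \sum_(k < n.+1) rising_coef c1 k * rising_coef c2 (n - k) = rising_coef (c1 + c2) n.
Proof.
elim: n => [|n ih]; first by rewrite big_ord1 !rising_coef0 mulr1.
have n0 : n.+1%:R != 0 :> R by rewrite pnatr_eq0.
apply: (mulfI n0); rewrite rising_coefS -ih mulr_sumr.
transitivity (\sum_(k < n.+2) k%:R * rising_coef c1 k * rising_coef c2 (n.+1 - k)
  + \sum_(k < n.+2) rising_coef c1 k * ((n.+1 - k)%:R * rising_coef c2 (n.+1 - k))).
  rewrite -big_split/=; apply: eq_bigr => k _.
  rewrite -{1}(subnKC (ltn_ord k : (k <= n.+1)%N)) natrD; ring.
rewrite big_ord_recl/= !mul0r add0r [X in _ + X]big_ord_recr/= subnn mul0r mulr0 addr0.
rewrite -big_split/= mulr_sumr; apply: eq_bigr => k _.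
have kn : (k <= n)%N by rewrite -ltnS.
rewrite /bump/= add1n subSS subSn// !rising_coefS natrB//; ring.
Qed.

End RisingFactorial.

(** * Riemann-Liouville kernels and their semigroup law *)

Section RlKernel.
Context {R : realType}.
Notation mu := (@lebesgue_measure R).
Implicit Types (p q s t b M : R).

(* The kernel s^(p-1) / Gamma p of the Riemann-Liouville integral of order p,
   extended by 0 to s <= 0. *)
Definition rl_kernel p s := rgamma p * power_kernel p s.

Lemma measurable_rl_kernel p : measurable_fun setT (rl_kernel p).
Proof. by apply: measurable_funM => //; exact: measurable_power_kernel. Qed.

Lemma rl_kernel_ge0 p s : 0 <= p -> 0 <= rl_kernel p s.
Proof. by move=> p0; rewrite mulr_ge0 ?rgamma_ge0 ?power_kernel_ge0. Qed.

Lemma rl_kernel0 s : rl_kernel 0 s = 0.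
Proof. by rewrite /rl_kernel rgamma0 mul0r. Qed.

Lemma rl_kernel1 s : rl_kernel 1 s = (0 < s)%R%:R.
Proof.
by rewrite /rl_kernel rgamma1 mul1r /power_kernel subrr powRr0; case: ifP.
Qed.

Lemma power_kernel_eq0 p s : s <= 0 -> power_kernel p s = 0.
Proof. by rewrite /power_kernel ltNge => ->. Qed.

Lemma rl_kernel_eq0 p s : s <= 0 -> rl_kernel p s = 0.
Proof. by move=> s0; rewrite /rl_kernel power_kernel_eq0// mulr0. Qed.

Lemma power_kernel_le p q s b : q <= p -> 0 < b -> s <= b ->
  power_kernel p s <= b `^ (p - q) * power_kernel q s.
Proof.
move=> qp b0 sb; rewrite /power_kernel; case: ifP => s0; last by rewrite mulr0.
rewrite (_ : p - 1 = (p - q) + (q - 1)); last by ring.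
rewrite powRD; last by rewrite (gt_eqF s0) implybT.
by rewrite ler_wpM2r ?powR_ge0// ge0_ler_powR ?nnegrE ?subr_ge0// ltW.
Qed.

Lemma integral_power_kernel_conv p q t : 0 < p -> 0 < q ->
  (\int[mu]_y (power_kernel p (t - y)%R * power_kernel q y)%:E =
   (euler_gamma p * euler_gamma q * rl_kernel (p + q) t)%:E)%E.
Proof.
move=> p0 q0; have pq0 : 0 < p + q by rewrite addr_gt0.
have [t0|t0] := ltP 0 t; last first.
  rewrite rl_kernel_eq0// mulr0.
  under eq_integral => y _.
    rewrite (_ : power_kernel p (t - y) * power_kernel q y = 0); last first.
      have [y0|y0] := ltP 0 y; last by rewrite (power_kernel_eq0 q y0) mulr0.
      by rewrite power_kernel_eq0 ?mul0r// subr_le0 (le_trans t0)// ltW.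
    over.
  by rewrite integral0.
rewrite beta_conv// /rl_kernel rgammaE//.
have g0 : euler_gamma (p + q) != 0 by rewrite gt_eqF ?euler_gamma_gt0.
have g1 := euler_gamma_gt0 pq0.
(* An infinite beta integral would make the finite product of the two Gamma values infinite. *)
move: (gamma_beta p0 q0); set B := (\int[mu]_y _)%E; case: B => [r| |].
- by rewrite -!EFinM => -[->]; congr EFin; field.
- by rewrite gt0_muley// lte_fin.
- by rewrite gt0_muleNy// lte_fin.
Qed.

Lemma measurable_power_kernel_conv p q t :
  measurable_fun setT (fun y : R => power_kernel p (t - y) * power_kernel q y).
Proof.
apply: measurable_funM; last exact: measurable_power_kernel.
by apply: measurable_reflect; exact: measurable_power_kernel.
Qed.

Lemma integrable_power_kernel_conv p q t : 0 < p -> 0 < q ->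
  mu.-integrable setT (fun y : R => (power_kernel p (t - y) * power_kernel q y)%:E).
Proof.
move=> p0 q0; apply/integrableP; split.
  by apply/measurable_EFinP; exact: measurable_power_kernel_conv.
have -> : (\int[mu]_x `|(power_kernel p (t - x)%R * power_kernel q x)%:E| =
    \int[mu]_x (power_kernel p (t - x)%R * power_kernel q x)%:E)%E.
  by apply: eq_integral => y _; rewrite gee0_abs// lee_fin mulr_ge0 ?power_kernel_ge0.
by rewrite integral_power_kernel_conv// ltry.
Qed.

Lemma rl_kernel_conv p q t : 0 < p -> 0 < q ->
  conv (rl_kernel p) (rl_kernel q) t = rl_kernel (p + q) t.
Proof.
move=> p0 q0; rewrite /conv.
transitivity (\int[mu]_y ((rgamma p * rgamma q) * (power_kernel p (t - y) * power_kernel q y))).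
  by apply: eq_Rintegral => y _; rewrite /rl_kernel mulrACA.
rewrite RintegralZl//; last exact: integrable_power_kernel_conv.
rewrite /Rintegral integral_power_kernel_conv//= !rgammaE//.
have gp : euler_gamma p != 0 by rewrite gt_eqF ?euler_gamma_gt0.
have gq : euler_gamma q != 0 by rewrite gt_eqF ?euler_gamma_gt0.
by move: (euler_gamma p) (euler_gamma q) gp gq => x y x0 y0; field; rewrite x0 y0.
Qed.

(** On ]-oo, b] a single singular factor of order q dominates the kernels of all orders p >= q. The
    dependence on p is (b / M)^p, with a ratio as small as desired for large M. *)
Lemma rgamma_power_kernel_bound p q s b M : 0 < q -> q <= p -> 0 < b -> 0 < M -> s <= b ->
  rl_kernel p s <=
    (M + 1) * expR (M + 1) * b `^ (- q) * (b / M) `^ p * power_kernel q s.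
Proof.
move=> q0 qp b0 M0 sb; have p0 : 0 <= p by rewrite (le_trans _ qp)// ltW.
rewrite /rl_kernel; apply: le_trans (ler_wpM2l (rgamma_ge0 p0) (power_kernel_le qp b0 sb)) _.
rewrite mulrA ler_wpM2r ?power_kernel_ge0//.
apply: le_trans (ler_wpM2r (powR_ge0 _ _) (rgamma_upper_bound p0 M0)) _.
rewrite le_eqVlt; apply/orP; left; apply/eqP.
rewrite powRM ?invr_ge0 ?ltW// powRD; last by rewrite (gt_eqF b0) implybT.
rewrite -(powR_inv1 (ltW M0)) -powRrM mulN1r (powRN M p); ring.
Qed.

End RlKernel.

(** * Convolution algebra of the Prabhakar kernels *)

Section PrabhakarKernel.
Context {R : realType}.
Notation mu := (@lebesgue_measure R).
Variables (rho w : R).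
Hypothesis rho0 : 0 < rho.
Implicit Types (m c q s t b M : R) (k N : nat).

Definition hp_term m c k s : R :=
  rising_coef c k * w ^+ k * rl_kernel (rho * k%:R + m) s.

(* prabhakar_kernel extended by 0 to s <= 0; see prabhakar_kernelE. *)
Definition hp_kernel m c s : R := limn (series (fun k => hp_term m c k s)).

(* For m = 0 the first term vanishes and the next one is of order rho. *)
Definition kernel_order m : R := if m == 0 then rho else m.

Lemma kernel_order_gt0 m : 0 <= m -> 0 < kernel_order m.
Proof. by rewrite /kernel_order le_eqVlt eq_sym; case: eqP. Qed.

(** The constant of [kernel_term_bound]. Its factors 2^N and (b / M)^m stay visible because N and m
    grow linearly with n in the series solution. *)
Definition hp_bound b M q m N : R :=
  2 ^+ N * ((M + 1) * expR (M + 1) * b `^ (- q) * (b / M) `^ m).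

Lemma hp_bound_ge0 b M q m N : 0 < M -> 0 <= hp_bound b M q m N.
Proof.
by move=> M0; rewrite /hp_bound !mulr_ge0 ?exprn_ge0 ?expR_ge0 ?powR_ge0// addr_ge0// ltW.
Qed.

Let order_le m q k : 0 <= m -> q <= kernel_order m -> (m != 0) || (0 < k)%N ->
  q <= rho * k%:R + m.
Proof.
move=> m0; rewrite /kernel_order; case: eqP => [->|_] qm /=.
  by move=> k0; rewrite addr0 (le_trans qm)// ler_peMr ?ler1n//; exact: ltW.
by move=> _; rewrite (le_trans qm)// lerDr mulr_ge0// ltW.
Qed.

(** From k to k + 1 the bound gains 2 |w| (b / M)^rho, which M makes at most 4^-1. The coefficient x
    is left general: it is one [rising_coef] in a kernel, and a product of two in a convolution of
    kernels. *)
Lemma kernel_term_bound x m k s b M q N : 0 < b -> 0 < M ->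
  2 * `|w| * (b / M) `^ rho <= 4^-1 -> 0 <= m -> 0 < q -> q <= kernel_order m ->
  `|x| <= 2 ^+ (N + k) -> s <= b ->
  `|x * w ^+ k * rl_kernel (rho * k%:R + m) s| <=
    hp_bound b M q m N * power_kernel q s * 4^-1 ^+ k.
Proof.
move=> b0 M0 wM m0 q0 qm xN sb.
have p0 : 0 <= rho * k%:R + m by rewrite addr_ge0// mulr_ge0// ltW.
have rhs0 : 0 <= hp_bound b M q m N * power_kernel q s * 4^-1 ^+ k.
  apply: mulr_ge0; last by rewrite exprn_ge0.
  by apply: mulr_ge0; [exact: hp_bound_ge0|exact: power_kernel_ge0].
(* Here the order is 0, below q, but the term vanishes since 1 / Gamma 0 = 0. *)
have [/andP[/eqP m00 /eqP k0]|] := boolP ((m == 0) && (k == 0%N)).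
  by move: rhs0; rewrite k0 mulr0 add0r m00 rl_kernel0 mulr0 normr0.
rewrite negb_and -lt0n => mk; have qp := order_le m0 qm mk.
rewrite 2!normrM normrX (ger0_norm (rl_kernel_ge0 _ p0)).
have H1 : `|x| * `|w| ^+ k <= 2 ^+ (N + k) * `|w| ^+ k by rewrite ler_wpM2r// exprn_ge0.
have H2 := rgamma_power_kernel_bound q0 qp b0 M0 sb.
apply: le_trans (ler_pM _ _ H1 H2) _; rewrite ?rl_kernel_ge0 ?mulr_ge0 ?exprn_ge0//.
have bM : 0 < b / M by rewrite divr_gt0.
rewrite powRD; last by rewrite (gt_eqF bM) implybT.
rewrite powRrM powR_mulrn ?powR_ge0// exprD.
have -> : 2 ^+ N * 2 ^+ k * `|w| ^+ k * ((M + 1) * expR (M + 1) * b `^ (- q) *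
    (((b / M) `^ rho) ^+ k * (b / M) `^ m) * power_kernel q s) =
    hp_bound b M q m N * power_kernel q s * (2 * `|w| * (b / M) `^ rho) ^+ k.
  by rewrite /hp_bound !exprMn; ring.
rewrite ler_wpM2l//; first by apply: mulr_ge0; [exact: hp_bound_ge0|exact: power_kernel_ge0].
by rewrite lerXn2r// ?nnegrE ?mulr_ge0 ?powR_ge0.
Qed.

(** M = b / x with x the smaller of e1^(1/rho) and e2^(1/nu). The first ratio governs the series in
    k, the second the series in n. *)
Lemma exists_scale (nu b e1 e2 : R) : 0 < nu -> 0 < b -> 0 < e1 -> 0 < e2 ->
  exists M, [/\ 0 < M, (b / M) `^ rho <= e1 & (b / M) `^ nu <= e2].
Proof.
move=> nu0 b0 e10 e20; pose x := Num.min (e1 `^ rho^-1) (e2 `^ nu^-1).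
have x0 : 0 < x by rewrite lt_min !powR_gt0.
exists (b / x); rewrite divr_gt0// invf_div mulrCA mulfV ?gt_eqF// mulr1.
have H (r e : R) : 0 < r -> 0 < e -> x <= e `^ r^-1 -> x `^ r <= e.
  move=> r0 e0 xe; have -> : e = (e `^ r^-1) `^ r.
    by rewrite -powRrM mulVf ?gt_eqF// powRr1// ltW.
  by rewrite ge0_ler_powR ?nnegrE ?powR_ge0// ltW.
by split => //; apply: H; rewrite // /x ge_min lexx ?orbT.
Qed.

Lemma exists_kernel_bound m b N : 0 < b -> 0 <= m ->
  exists2 C, 0 <= C & forall x k s, `|x| <= 2 ^+ (N + k) -> s <= b ->
    `|x * w ^+ k * rl_kernel (rho * k%:R + m) s| <=
      C * power_kernel (kernel_order m) s * 4^-1 ^+ k.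
Proof.
(* The summand 1 allows division by W when w = 0. *)
move=> b0 m0; pose W := 2 * `|w| + 1.
have W0 : 0 < W by rewrite ltr_wpDl ?mulr_ge0.
have e0 : 0 < 4^-1 / W by rewrite divr_gt0 ?invr_gt0.
have [M [M0 Me _]] := exists_scale rho0 b0 e0 e0.
exists (hp_bound b M (kernel_order m) m N) => [|x k s xN sb]; first exact: hp_bound_ge0.
apply: kernel_term_bound => //; last exact: kernel_order_gt0.
apply: (@le_trans _ _ (W * (b / M) `^ rho)).
  by rewrite ler_wpM2r ?powR_ge0// lerDl.
by rewrite mulrC -ler_pdivlMr.
Qed.

Let q42 (C : R) k : 0 <= C -> C * 4^-1 ^+ k <= C * 2^-1 ^+ k.
Proof.
by move=> C0; rewrite ler_wpM2l// lerXn2r ?nnegrE ?invr_ge0// lef_pV2 ?posrE// ler_nat.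
Qed.

Let pos_bound s : exists2 b : R, 0 < b & s <= b.
Proof. by exists (Num.max 1 s); rewrite ?lt_max ?ltr01// le_max lexx orbT. Qed.

Lemma hp_term_half m c b : 0 < b -> 0 <= m ->
  exists2 C, 0 <= C & forall k s, s <= b ->
    `|hp_term m c k s| <= C * power_kernel (kernel_order m) s * 2^-1 ^+ k.
Proof.
move=> b0 m0; have cN := ltW (archi_boundP (normr_ge0 c)).
have [C C0 HC] := exists_kernel_bound (Num.bound `|c|) b0 m0.
exists C => // k s sb; apply: le_trans (HC _ k s (normr_rising_coef_le k cN) sb) _.
by apply: q42; rewrite mulr_ge0// power_kernel_ge0.
Qed.

Lemma is_cvg_hp_kernel m c s : 0 <= m -> cvgn (series (fun k => hp_term m c k s)).
Proof.
move=> m0; have [b b0 sb] := pos_bound s; have [C _ HC] := hp_term_half c b0 m0.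
exact: is_cvg_series_half (fun k => HC k s sb).
Qed.

Lemma measurable_hp_term m c k : measurable_fun setT (hp_term m c k).
Proof. by apply: measurable_funM => //; exact: measurable_rl_kernel. Qed.

Lemma measurable_hp_kernel m c : 0 <= m -> measurable_fun setT (hp_kernel m c).
Proof.
move=> m0; apply: (measurable_fun_cvg (h := fun n s => series (fun k => hp_term m c k s) n)).
  by move=> n; rewrite /series/=; apply: measurable_sum => k; exact: measurable_hp_term.
by move=> s _; exact: is_cvg_hp_kernel.
Qed.

Lemma hp_kernel_eq0 m c s : s <= 0 -> hp_kernel m c s = 0.
Proof.
by move=> s0; rewrite /hp_kernel limn_series1 => [|k _]; rewrite /hp_term rl_kernel_eq0// mulr0.
Qed.

Lemma hp_kernel_bound m c b : 0 < b -> 0 <= m -> exists2 C, 0 <= C &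
  forall s, s <= b -> `|hp_kernel m c s| <= C * power_kernel (kernel_order m) s.
Proof.
move=> b0 m0; have [C C0 HC] := hp_term_half c b0 m0.
exists (C * 2) => [|s sb]; first by rewrite mulr_ge0.
by rewrite mulrAC; exact: normr_limn_series_half (fun k => HC k s sb).
Qed.

Lemma hp_kernel0 m s : hp_kernel m 0 s = rl_kernel m s.
Proof.
rewrite /hp_kernel limn_series1 => [|k k0].
  by rewrite /hp_term rising_coef0 mul1r expr0 mul1r mulr0 add0r.
by rewrite /hp_term rising_coef_zero// !mul0r.
Qed.

Lemma prabhakar_kernelE m c s : 0 <= m -> 0 < s ->
  prabhakar_kernel rho m w c s = hp_kernel m c s.
Proof.
move=> m0 s0; rewrite /prabhakar_kernel /prabhakar_ML /hp_kernel.
have sm : s `^ (m - 1) != 0 by rewrite gt_eqF ?powR_gt0.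
have E : (fun k => hp_term m c k s) =
    (fun k => s `^ (m - 1) * prabhakar_term rho m c (w * s `^ rho) k).
  apply/funext => k; rewrite /hp_term /prabhakar_term /rising_coef /rl_kernel.
  rewrite /power_kernel s0 exprMn -(powR_mulrn k (powR_ge0 s rho)) -powRrM.
  rewrite -[rho * k%:R + m - 1]addrA (@powRD _ s (rho * k%:R) (m - 1)); last by rewrite (gt_eqF s0) implybT.
  ring.
rewrite E limn_seriesZ//.
have <- : (fun k => (s `^ (m - 1))^-1 * hp_term m c k s) =
    prabhakar_term rho m c (w * s `^ rho).
  by apply/funext => k; have /= -> := congr1 (fun h : R ^nat => h k) E; rewrite mulKf.
by apply: is_cvg_seriesZ; exact: is_cvg_hp_kernel.
Qed.

Section ConvolutionWithKernel.
Variables (m c t : R) (g : R -> R).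
Hypotheses (m0 : 0 <= m) (mg : measurable_fun setT g)
  (g0 : forall y, y <= 0 -> g y = 0)
  (ig : mu.-integrable setT
    (fun y : R => (power_kernel (kernel_order m) (t - y) * g y)%:E)).

Let dominated : exists h : R -> R, mu.-integrable setT (EFin \o h) /\
  forall k y, `|hp_term m c k (t - y) * g y| <= h y * 2^-1 ^+ k.
Proof.
have [b b0 tb] := pos_bound t; have [C C0 HC] := hp_term_half c b0 m0.
exists (fun y => C * `|power_kernel (kernel_order m) (t - y) * g y|); split.
  exact: (integrableZl measurableT C (integrable_norm ig)).
move=> k y; have [y0|y0] := ltP 0 y; last by rewrite g0// !mulr0 normr0 mulr0 mul0r.
rewrite [`|hp_term m c k (t - y) * g y|]normrM [`|power_kernel _ _ * _|]normrM.
rewrite (ger0_norm (power_kernel_ge0 _ _)).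
have -> : C * (power_kernel (kernel_order m) (t - y) * `|g y|) * 2^-1 ^+ k =
  C * power_kernel (kernel_order m) (t - y) * 2^-1 ^+ k * `|g y| by ring.
rewrite ler_wpM2r//.
by apply: HC; rewrite (le_trans _ tb)// gerBl ltW.
Qed.

Let mterm k : measurable_fun setT (fun y : R => hp_term m c k (t - y) * g y).
Proof. by apply: measurable_funM => //; apply: measurable_reflect; exact: measurable_hp_term. Qed.

Let seriesE y : hp_kernel m c (t - y) * g y =
  limn (series (fun k => hp_term m c k (t - y) * g y)).
Proof.
rewrite mulrC /hp_kernel -limn_seriesZ; last exact: is_cvg_hp_kernel.
by congr (limn (series _)); apply/funext => k; rewrite mulrC.
Qed.

Lemma integrable_hp_kernel_conv :
  mu.-integrable setT (fun y => (hp_kernel m c (t - y) * g y)%:E).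
Proof.
have [h [ih hb]] := dominated.
have := @integrable_dominated_series _ (measurableTypeR R) R mu _ h mterm hb ih.
by apply: eq_integrable => // y _; rewrite seriesE.
Qed.

(** All terms are at most 2^-k times a multiple of the integrable function in [ig], so the sum
    leaves the integral. *)
Lemma hp_kernel_conv_series : conv (hp_kernel m c) g t =
  limn (series (fun k => rising_coef c k * w ^+ k * conv (rl_kernel (rho * k%:R + m)) g t)).
Proof.
have [h [ih hb]] := dominated.
rewrite /conv; transitivity (\int[mu]_y limn (series (fun k => hp_term m c k (t - y) * g y))).
  by apply: eq_Rintegral => y _; exact: seriesE.
rewrite (@Rintegral_dominated_series _ (measurableTypeR R) R mu _ h mterm hb ih); congr (limn (series _)).
apply/funext => k; have [b b0 tb] := pos_bound t.
rewrite -RintegralZl//.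
  by apply: eq_Rintegral => y _; rewrite /hp_term mulrA.
(* Taking the coefficient out of the integral asks for integrability of the bare Riemann-Liouville
   term; the bound on the full term says nothing where the coefficient is 0. *)
have [p0|p0] := eqVneq (rho * k%:R + m) 0.
  rewrite p0 (_ : _ \o _ = (fun=> 0%:E)); first exact: integrable0.
  by apply/funext => y /=; rewrite rl_kernel0 mul0r.
have mk : (m != 0) || (0 < k)%N.
  apply: contraNT p0; rewrite negb_or negbK -eqn0Ngt => /andP[/eqP -> /eqP ->].
  by rewrite mulr0 addr0.
have qp := order_le m0 (lexx (kernel_order m)) mk.
(* The constant of [rgamma_power_kernel_bound] for M = 1: a single term needs no small ratio. *)
set C := (1 + 1) * expR (1 + 1) * b `^ (- kernel_order m) * (b / 1) `^ (rho * k%:R + m) : R.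
apply: le_integrable (integrableZl measurableT C (integrable_norm ig)) => //.
  apply/measurable_EFinP; apply: measurable_funM => //.
  by apply: measurable_reflect; exact: measurable_rl_kernel.
move=> y _; rewrite /= lee_fin; apply: (@le_trans _ _ (C * `|power_kernel (kernel_order m) (t - y) * g y|)); last exact: ler_norm.
have [y0|y0] := ltP 0 y; last by rewrite g0// !mulr0 normr0 mulr0.
have pk0 := le_trans (ltW (kernel_order_gt0 m0)) qp.
rewrite [`|rl_kernel _ _ * _|]normrM [`|power_kernel _ _ * _|]normrM.
rewrite (ger0_norm (power_kernel_ge0 _ _)) (ger0_norm (rl_kernel_ge0 _ pk0)) mulrA ler_wpM2r//.
apply: rgamma_power_kernel_bound => //; first exact: kernel_order_gt0.
by rewrite (le_trans _ tb)// gerBl ltW.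
Qed.

End ConvolutionWithKernel.

Let limn_series_drop0 (u v : R ^nat) d : cvgn (series v) -> u 0%N = v 0%N - d ->
  (forall k, (0 < k)%N -> u k = v k) -> limn (series u) = limn (series v) - d.
Proof.
move=> cv u0 uv; have E : u = (fun k => v k - (if k == 0%N then d else 0)).
  by apply/funext => -[|k] //=; rewrite uv// subr0.
pose z k : R := if k == 0%N then d else 0.
have cz : cvgn (series z).
  apply: (@is_cvg_series_half _ `|d|) => -[|k] /=; first by rewrite expr0 mulr1.
  by rewrite normr0 mulr_ge0// exprn_ge0// invr_ge0.
by rewrite E (limn_seriesB cv cz); congr (_ - _); rewrite limn_series1// => -[].
Qed.

(** [rl_kernel 0] is the zero function where the kernel of order 0 is a Dirac mass; the subtracted
    term accounts for the missing mass. *)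
Lemma rl_kernel_conv_or0 m q t : 0 <= m -> 0 < q ->
  conv (rl_kernel m) (rl_kernel q) t = rl_kernel (m + q) t - (m == 0)%R%:R * rl_kernel q t.
Proof.
move=> m0 q0; have [->|mn0] := eqVneq m 0.
  rewrite add0r mul1r subrr /conv (_ : (fun y => _) = (fun=> 0)).
    by rewrite /Rintegral integral0.
  by apply/funext => y; rewrite rl_kernel0 mul0r.
by rewrite mul0r subr0 rl_kernel_conv// lt_neqAle eq_sym mn0.
Qed.

Let integrable_rl m q t : 0 <= m -> 0 < q -> mu.-integrable setT
  (fun y : R => (power_kernel (kernel_order m) (t - y) * rl_kernel q y)%:E).
Proof.
move=> m0 q0; have := integrable_power_kernel_conv t (kernel_order_gt0 m0) q0.
move=> /(integrableZl measurableT (rgamma q)); apply: eq_integrable => // y _ /=.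
by rewrite -EFinM; congr EFin; rewrite /rl_kernel mulrCA.
Qed.

(** Termwise beta integrals; the Dirac mass can be missing only in the term k = 0. *)
Lemma hp_kernel_conv_rl m c q t : 0 <= m -> 0 < q ->
  conv (hp_kernel m c) (rl_kernel q) t = hp_kernel (m + q) c t - (m == 0)%R%:R * rl_kernel q t.
Proof.
move=> m0 q0; rewrite hp_kernel_conv_series//; last 3 first.
- exact: measurable_rl_kernel.
- by move=> y; exact: rl_kernel_eq0.
- exact: integrable_rl.
apply: limn_series_drop0.
- by apply: is_cvg_hp_kernel; rewrite addr_ge0// ltW.
- rewrite /hp_term rising_coef0 expr0 !mul1r mulr0 !add0r; exact: rl_kernel_conv_or0.
- move=> k k0; rewrite /hp_term rl_kernel_conv// ?addrA//.
  by rewrite ltr_wpDr// mulr_gt0// ltr0n.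
Qed.

(** Expanding the second kernel and then each of its convolutions with the first gives a double
    series. Its (k, j) term has order rho (k + j) + m1 + m2, so the Cauchy product collects equal
    kernels on the diagonals, where Vandermonde adds up the coefficients. *)
Lemma hp_kernel_conv m1 c1 m2 c2 t : 0 <= m1 -> 0 < m2 ->
  conv (hp_kernel m1 c1) (hp_kernel m2 c2) t =
  hp_kernel (m1 + m2) (c1 + c2) t - (m1 == 0)%R%:R * hp_kernel m2 c2 t.
Proof.
move=> m10 m20; have m2' := ltW m20; have m12 : 0 <= m1 + m2 by rewrite addr_ge0.
have mK1 := measurable_hp_kernel c1 m10; have mK2 := measurable_hp_kernel c2 m2'.
rewrite convC// hp_kernel_conv_series//; last 2 first.
- by move=> y; exact: hp_kernel_eq0.
- apply: integrable_convC => //; first exact: measurable_power_kernel.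
  apply: integrable_hp_kernel_conv => //; first exact: measurable_power_kernel.
    by move=> y; exact: power_kernel_eq0.
  by apply: integrable_power_kernel_conv; exact: kernel_order_gt0.
pose F k j := rising_coef c2 k * w ^+ k * hp_term (m1 + (rho * k%:R + m2)) c1 j t.
have kp k : 0 < rho * k%:R + m2 by rewrite ltr_wpDl// mulr_ge0// ltW.
have FE k j : F k j = rising_coef c2 k * rising_coef c1 j * w ^+ (k + j) *
    rl_kernel (rho * (k + j)%:R + (m1 + m2)) t.
  rewrite /F /hp_term (_ : rho * j%:R + (m1 + (rho * k%:R + m2)) =
    rho * (k + j)%:R + (m1 + m2)); last by rewrite natrD; ring.
  by rewrite exprD; ring.
have [b b0 tb] := pos_bound t.
pose N1 := Num.bound `|c1|; pose N2 := Num.bound `|c2|.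
have c1N : `|c1| <= N1%:R := ltW (archi_boundP (normr_ge0 c1)).
have c2N : `|c2| <= N2%:R := ltW (archi_boundP (normr_ge0 c2)).
have [C C0 HC] := exists_kernel_bound (N2 + N1) b0 m12.
pose D := C * power_kernel (kernel_order (m1 + m2)) t.
have D0 : 0 <= D by rewrite mulr_ge0 ?power_kernel_ge0.
have FD k j : `|F k j| <= D * 4^-1 ^+ (k + j).
  rewrite FE; apply: HC tb; rewrite normrM addnACA exprD.
  by apply: ler_pM => //; exact: normr_rising_coef_le.
pose A k := limn (series (F k)).
have AE k : A k = rising_coef c2 k * w ^+ k * hp_kernel (m1 + (rho * k%:R + m2)) c1 t.
  by rewrite /A limn_seriesZ//; apply: is_cvg_hp_kernel; rewrite addr_ge0// ltW.
have cA : cvgn (series A).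
  apply: (@is_cvg_series_half _ (D * 2)) => k.
  have Fk j : `|F k j| <= D * 4^-1 ^+ k * 2^-1 ^+ j.
    apply: le_trans (FD k j) _; rewrite exprD mulrA; apply: q42.
    by rewrite mulr_ge0// exprn_ge0.
  apply: le_trans (normr_limn_series_half Fk) _.
  by rewrite mulrAC; apply: q42; rewrite mulr_ge0.
transitivity (limn (series (fun k => A k - (m1 == 0)%R%:R * hp_term m2 c2 k t))).
  congr (limn (series _)); apply/funext => k.
  rewrite AE convC//; last exact: measurable_rl_kernel.
  by rewrite hp_kernel_conv_rl// /hp_term; ring.
rewrite limn_seriesB//; last first.
  by apply: is_cvg_seriesZ; exact: is_cvg_hp_kernel.
rewrite limn_seriesZ; last exact: is_cvg_hp_kernel.
congr (_ - _); rewrite (cauchy_series FD) /hp_kernel; congr (limn (series _)).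
apply/funext => n; rewrite /hp_term [c1 + c2]addrC -rising_coef_vandermonde !mulr_suml.
apply: eq_bigr => k _; have kn : (k <= n)%N by rewrite -ltnS.
by rewrite FE subnKC.
Qed.

End PrabhakarKernel.

(** * The series solution *)

Section Existence.
Context {R : realType}.
Notation mu := (@lebesgue_measure R).
Variables (rho w nu gamma : R) (c : R ^nat) (A : R).
Hypotheses (rho0 : 0 < rho) (nu01 : 0 < nu <= 1) (gamma0 : 0 <= gamma) (A0 : 0 < A)
  (cA : forall n, `|c n| <= A ^+ n).
Notation K := (hp_kernel rho w).

Let nu0 : 0 < nu. Proof. by case/andP: nu01. Qed.

(** c is any real sequence with |c n| <= A^n; the real and the imaginary part of a^n will both be
    taken for it. *)
Definition sol_term (n : nat) (t : R) : R := c n * K (n%:R * nu + 1) (n%:R * gamma) t.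

(** The derivative of [sol_term n.+1] for t > 0; the index is shifted since [sol_term 0] is constant
    there. *)
Definition dsol_term (n : nat) (t : R) : R :=
  c n.+1 * K (n.+1%:R * nu) (n.+1%:R * gamma) t.

Definition dsol (t : R) : R := limn (series (dsol_term ^~ t)).

Let Ng := Num.bound gamma.

(** One M makes (b / M)^rho small enough for the series in k and (b / M)^nu small enough for the
    series in n. m0 = 1 serves the solution, m0 = 0 its derivative. *)
Let general_bound (b m0 : R) : 0 < b -> 0 <= m0 -> exists2 C, 0 <= C &
  forall n s, s <= b -> 0 < n%:R * nu + m0 ->
    forall q, 0 < q -> q <= n%:R * nu + m0 ->
    `|c n * K (n%:R * nu + m0) (n%:R * gamma) s| <= C * b `^ (- q) * power_kernel q s * 2^-1 ^+ n.
Proof.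
move=> b0 m00; pose W := 2 * `|w| + 1.
have W0 : 0 < W by rewrite ltr_wpDl ?mulr_ge0.
have e10 : 0 < 4^-1 / W by rewrite divr_gt0 ?invr_gt0.
(* The growth per step in n: A from c n, 2^Ng from the rising factorials of n gamma. *)
pose Q := A * 2 ^+ Ng; have Q0 : 0 < Q by rewrite mulr_gt0// exprn_gt0.
have e20 : 0 < 2^-1 / Q by rewrite divr_gt0 ?invr_gt0.
have [M [M0 M1 M2]] := exists_scale rho0 nu0 b0 e10 e20.
have wM : 2 * `|w| * (b / M) `^ rho <= 4^-1.
  apply: (@le_trans _ _ (W * (b / M) `^ rho)).
    by rewrite ler_wpM2r ?powR_ge0// lerDl.
  by rewrite mulrC -ler_pdivlMr.
have bM : 0 < b / M by rewrite divr_gt0.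
pose C := 2 * ((M + 1) * expR (M + 1) * (b / M) `^ m0).
have C0 : 0 <= C by rewrite !mulr_ge0 ?expR_ge0 ?powR_ge0// addr_ge0// ltW.
exists C => // n s sb p0 q q0 qp.
have gN : `|n%:R * gamma| <= (n * Ng)%:R.
  rewrite normrM normr_nat (ger0_norm gamma0) natrM ler_wpM2l//.
  exact/ltW/archi_boundP.
pose B := hp_bound b M q (n%:R * nu + m0) (n * Ng) * power_kernel q s.
have B0 : 0 <= B by apply: mulr_ge0; [exact: hp_bound_ge0|exact: power_kernel_ge0].
have HK : `|K (n%:R * nu + m0) (n%:R * gamma) s| <= B * 2.
  apply: normr_limn_series_half => k.
  apply: (@le_trans _ _ (B * 4^-1 ^+ k)).
    apply: kernel_term_bound => //; first exact: ltW.
      by rewrite /kernel_order gt_eqF.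
    exact: normr_rising_coef_le.
  by rewrite ler_wpM2l// lerXn2r ?nnegrE ?invr_ge0// lef_pV2 ?posrE// ler_nat.
rewrite normrM; apply: le_trans (ler_pM _ _ (cA n) HK) _ => //.
have E : A ^+ n * (B * 2) = C * b `^ (- q) * power_kernel q s * (Q * (b / M) `^ nu) ^+ n.
  rewrite /B /hp_bound powRD; last by rewrite (gt_eqF bM) implybT.
  rewrite [n%:R * nu]mulrC powRrM powR_mulrn ?powR_ge0// /C /Q !exprMn -exprM [(Ng * n)%N]mulnC.
  ring.
have rhs0 : 0 <= C * b `^ (- q) * power_kernel q s.
  by apply: mulr_ge0; [apply: mulr_ge0; [exact: C0|exact: powR_ge0]|exact: power_kernel_ge0].
rewrite E ler_wpM2l//.
have Qb0 : 0 <= Q * (b / M) `^ nu by rewrite mulr_ge0 ?powR_ge0// ltW.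
by rewrite lerXn2r ?nnegrE ?invr_ge0// mulrC -ler_pdivlMr.
Qed.

Lemma sol_term_half (b : R) : 0 < b -> exists2 C, 0 <= C & forall n t, t <= b ->
  `|sol_term n t| <= C * 2^-1 ^+ n.
Proof.
move=> b0; have [C C0 HC] := general_bound b0 ler01.
exists (C * b `^ (-1)) => [|n t tb]; first by rewrite mulr_ge0 ?powR_ge0.
have np : 0 <= n%:R * nu by rewrite mulr_ge0// ltW.
apply: le_trans (HC n t tb _ 1 _ _) _ => //; first by rewrite ltr_wpDl.
  by rewrite lerDr.
rewrite ler_wpM2r ?exprn_ge0 ?invr_ge0// ler_piMr ?mulr_ge0 ?powR_ge0//.
by rewrite /power_kernel subrr powRr0; case: ifP.
Qed.

Lemma dsol_term_half (b : R) : 0 < b -> exists2 C, 0 <= C & forall n t, t <= b ->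
  `|dsol_term n t| <= C * power_kernel nu t * 2^-1 ^+ n.
Proof.
move=> b0; have [C C0 HC] := general_bound b0 (lexx 0).
exists (C * b `^ (- nu)) => [|n t tb]; first by rewrite mulr_ge0 ?powR_ge0.
have np : 0 < n.+1%:R * nu by rewrite mulr_gt0.
have := HC n.+1 t tb; rewrite addr0 => /(_ np nu nu0).
have nn : nu <= n.+1%:R * nu by rewrite ler_peMl ?ler1n// ltW.
move=> /(_ nn) /le_trans; apply.
rewrite ler_wpM2l ?mulr_ge0 ?powR_ge0 ?power_kernel_ge0//.
by rewrite exprS ler_piMl ?exprn_ge0 ?invr_ge0// invf_le1// ler1n.
Qed.

Lemma is_cvg_sol t : cvgn (series (sol_term ^~ t)).
Proof.
have b0 : 0 < Num.max 1 t by rewrite lt_max ltr01.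
have [C C0 HC] := sol_term_half b0.
by apply: (is_cvg_series_half (C := C)) => n; apply: HC; rewrite le_max lexx orbT.
Qed.

Lemma measurable_dsol_term n : measurable_fun setT (dsol_term n).
Proof. by apply: measurable_funM => //; apply: measurable_hp_kernel => //; rewrite mulr_ge0// ltW. Qed.

Lemma is_cvg_dsol t : cvgn (series (dsol_term ^~ t)).
Proof.
have b0 : 0 < Num.max 1 t by rewrite lt_max ltr01.
have [C C0 HC] := dsol_term_half b0.
by apply: (is_cvg_series_half (C := C * power_kernel nu t)) => n; apply: HC; rewrite le_max lexx orbT.
Qed.

Lemma measurable_dsol : measurable_fun setT dsol.
Proof.
apply: (measurable_fun_cvg (h := fun n t => series (dsol_term ^~ t) n)).
  by move=> n; rewrite /series/=; apply: measurable_sum => k; exact: measurable_dsol_term.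
by move=> t _; exact: is_cvg_dsol.
Qed.

Lemma dsol_eq0 t : t <= 0 -> dsol t = 0.
Proof.
by move=> t0; rewrite /dsol limn_series1 => [|k _]; rewrite /dsol_term hp_kernel_eq0// mulr0.
Qed.

(* m = 1 - nu gives the regularized derivative, m = 1 the primitive. *)
Lemma hp_kernel_conv_dsol m g t : 0 <= m ->
  mu.-integrable setT (fun y : R => (K m g (t - y) * dsol y)%:E) /\
  conv (K m g) dsol t = limn (series (fun n => c n.+1 *
    (K (m + n.+1%:R * nu) (g + n.+1%:R * gamma) t - (m == 0)%R%:R * K (n.+1%:R * nu) (n.+1%:R * gamma) t))).
Proof.
move=> m0; have b0 : 0 < Num.max 1 t by rewrite lt_max ltr01.
have tb : t <= Num.max 1 t by rewrite le_max lexx orbT.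
have [C C0 HC] := dsol_term_half b0; have [D D0 HD] := hp_kernel_bound w rho0 g b0 m0.
pose h y := (D * C) * (power_kernel (kernel_order rho m) (t - y) * power_kernel nu y).
have ih : mu.-integrable setT (EFin \o h).
  have := integrable_power_kernel_conv t (kernel_order_gt0 rho0 m0) nu0.
  exact: (integrableZl measurableT (D * C)).
pose f n y := K m g (t - y) * dsol_term n y.
have mf n : measurable_fun setT (f n).
  apply: measurable_funM; last exact: measurable_dsol_term.
  by apply: measurable_reflect; exact: measurable_hp_kernel.
have fh n y : `|f n y| <= h y * 2^-1 ^+ n.
  have h0 : 0 <= h y by rewrite !mulr_ge0 ?power_kernel_ge0.
  have [y0|y0] := ltP 0 y; last first.
    have d0 : dsol_term n y = 0 by rewrite /dsol_term hp_kernel_eq0// mulr0.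
    by rewrite /f d0 mulr0 normr0 mulr_ge0// exprn_ge0// invr_ge0.
  have [ty|ty] := ltP y t; last first.
    by rewrite /f hp_kernel_eq0 ?subr_le0// mul0r normr0 mulr_ge0// exprn_ge0// invr_ge0.
  have H1 : `|K m g (t - y)| <= D * power_kernel (kernel_order rho m) (t - y).
    by apply: HD; rewrite (le_trans _ tb)// gerBl ltW.
  have H2 : `|dsol_term n y| <= C * power_kernel nu y * 2^-1 ^+ n.
    by apply: HC; rewrite (le_trans (ltW ty)).
  rewrite normrM; apply: le_trans (ler_pM _ _ H1 H2) _ => //.
  by rewrite /h le_eqVlt; apply/orP; left; apply/eqP; ring.
have E y : K m g (t - y) * dsol y = limn (series (f ^~ y)).
  by rewrite /dsol -limn_seriesZ//; exact: is_cvg_dsol.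
split.
  have := @integrable_dominated_series _ (measurableTypeR R) R mu f h mf fh ih.
  by apply: eq_integrable => // y _; rewrite E.
transitivity (\int[mu]_y limn (series (f ^~ y))).
  by apply: eq_Rintegral => y _; exact: E.
rewrite (@Rintegral_dominated_series _ (measurableTypeR R) R mu f h mf fh ih).
congr (limn (series _)); apply/funext => n.
have np : 0 < n.+1%:R * nu by rewrite mulr_gt0.
rewrite -hp_kernel_conv// /conv -RintegralZl//.
  by apply: eq_Rintegral => y _; rewrite /f /dsol_term mulrCA.
apply: integrable_hp_kernel_conv => //.
- by apply: measurable_hp_kernel => //; exact: ltW.
- by move=> y; exact: hp_kernel_eq0.
apply: integrable_convC => //; first by apply: measurable_hp_kernel => //; exact: ltW.
  exact: measurable_power_kernel.
apply: integrable_hp_kernel_conv => //; first exact: ltW.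
- exact: measurable_power_kernel.
- by move=> y; exact: power_kernel_eq0.
- by apply: integrable_power_kernel_conv; apply: kernel_order_gt0 => //; exact: ltW.
Qed.

(** The bounds carry a factor [power_kernel], which may blow up at 0 but is locally bounded at s >
    0, so the convergence is locally uniform there. Continuity makes the derivative of the solution
    exist at every t > 0, not only almost everywhere. *)
Lemma continuous_dsol s : 0 < s -> {for s, continuous dsol}.
Proof.
move=> s0; pose b := 2 * s; have b0 : 0 < b by rewrite mulr_gt0.
have near_s : \forall x \near s, 0 < x /\ x <= b.
  near=> x; split; first by near: x; exact: lt_nbhsr.
  by near: x; apply: lt_le_nbhsl; rewrite ltr_pMl// ltr1n.
have cpk p : {for s, continuous (power_kernel p)}.
  have cp : {for s, continuous (fun x : R => x `^ (p - 1))}.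
    apply: differentiable_continuous; apply/derivable1_diffP.
    by case: (is_derive1_powR (p - 1) s0).
  have ps : power_kernel p s = s `^ (p - 1) by rewrite /power_kernel s0.
  move: cp; rewrite /prop_for /continuous_at -ps; apply: cvg_trans; apply: near_eq_cvg.
  near=> x; have [x0 _] : 0 < x /\ x <= b by near: x.
  by rewrite /power_kernel x0.
have pk_near q : 0 < q -> exists2 B, 0 <= B & \forall x \near s, power_kernel q x <= B.
  move=> q0; exists (power_kernel q s + 1); first by rewrite addr_ge0 ?power_kernel_ge0.
  have /cvgrPdist_lt/(_ 1 ltr01) := cpk q; apply: filterS => x.
  by rewrite ltr_norml => /andP[H _]; rewrite ltW// -ltrBlDl; lra.
have cK m g : 0 <= m -> {for s, continuous (K m g)}.
  move=> m0; have [C C0 HC] := hp_term_half w rho0 g b0 m0.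
  have [B B0 HB] := pk_near _ (kernel_order_gt0 rho0 m0).
  apply: (@continuous_dominated_series R (fun n => hp_term rho w m g n) (C * B)).
    near=> x => n; have [_ xb] : 0 < x /\ x <= b by near: x.
    apply: le_trans (HC n x xb) _; rewrite ler_wpM2r ?exprn_ge0 ?invr_ge0// ler_wpM2l//.
    by near: x.
  move=> n; rewrite /continuous_at /hp_term /rl_kernel; apply: cvgMr; apply: cvgMr; exact: cpk.
have [C C0 HC] := dsol_term_half b0; have [B B0 HB] := pk_near _ nu0.
apply: (@continuous_dominated_series R dsol_term (C * B)).
  near=> x => n; have [_ xb] : 0 < x /\ x <= b by near: x.
  apply: le_trans (HC n x xb) _; rewrite ler_wpM2r ?exprn_ge0 ?invr_ge0// ler_wpM2l//.
  by near: x.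
move=> n; rewrite /continuous_at /dsol_term; apply: cvgMr; apply: cK.
by rewrite mulr_ge0// ltW.
Unshelve. all: by end_near. Qed.

End Existence.

(** * The Volterra equation *)

Section Volterra.
Context {R : realType}.
Notation mu := (@lebesgue_measure R).
Variables (rho w : R).
Hypothesis rho0 : 0 < rho.
Notation K := (hp_kernel rho w).
Implicit Types (t s y : R).

(** The passage from the integral over [0, t] in the definition of the derivative to [conv]. f is
    meant to be a derivative, known almost everywhere, and g a representative measurable on the
    line. *)
Lemma prabhakar_integral_conv (m c t : R) (f g : R -> R) : 0 <= m ->
  measurable_fun setT g -> (forall y, y <= 0 -> g y = 0) ->
  {ae mu, forall y, 0 < y < t -> f y = g y} ->
  measurable_fun `]0, t[ (fun y => prabhakar_kernel rho m w c (t - y) * f y) ->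
  (mu.-integrable `[0, t] (EFin \o (fun y => prabhakar_kernel rho m w c (t - y) * f y)) <->
   mu.-integrable setT (fun y => (K m c (t - y) * g y)%:E)) /\
  \int[mu]_(y in `[0, t]) (prabhakar_kernel rho m w c (t - y) * f y) = conv (K m c) g t.
Proof.
move=> m0 mg g0 fg mF.
set F := fun y => _ in mF *.
pose H y := K m c (t - y) * g y.
have mH : measurable_fun setT H.
  by apply: measurable_funM => //; apply: measurable_reflect; exact: measurable_hp_kernel.
(* Phi is the embedding for the value of the integral, and the absolute value for integrability. *)
have core (Phi : R -> \bar R) : measurable_fun setT Phi -> Phi 0 = 0%E ->
    (\int[mu]_(y in `[0%R, t]) Phi (F y) = \int[mu]_y Phi (H y))%E.
  move=> mPhi Phi0; rewrite (@integral_itv_bndoo R 0 t (fun y => Phi (F y)) true false); last first.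
    exact: measurableT_comp.
  transitivity (\int[mu]_(y in `]0%R, t[) Phi (H y))%E.
    apply: ae_eq_integral => //.
    - exact: measurableT_comp.
    - by apply: measurable_funTS; exact: measurableT_comp.
    move: fg; apply: filterS; first exact: (ae_filter_ringOfSetsType mu).
    move=> y fgy /=; rewrite in_itv/= => yt; rewrite /F /H fgy//.
    by rewrite prabhakar_kernelE// subr_gt0; case/andP: yt.
  rewrite integral_mkcond; apply: eq_integral => y _; rewrite patchE mem_setE in_itv/=.
  case: ifPn => //; rewrite negb_and -!leNgt => /orP[y0|ty].
    by rewrite /H g0// mulr0.
  by rewrite /H hp_kernel_eq0 ?subr_le0// mul0r.
have mF' : measurable_fun `[0, t] F by exact: (@measurable_fun_itv_cc R 0 t false true).
split; last by rewrite /conv /Rintegral (core EFin).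
have E : (\int[mu]_(y in `[0%R, t]) `|(F y)%:E| = \int[mu]_y `|(H y)%:E|)%E.
  apply: (core (fun x => `|x%:E|%E)); last by rewrite /= normr0.
  exact: measurableT_comp.
split => /integrableP[_ i]; apply/integrableP; split; try exact/measurable_EFinP.
- by rewrite -E.
- by rewrite E.
Qed.

Lemma integrable_hp_kernels (m1 c1 m2 c2 t : R) : 0 <= m1 -> 0 <= m2 ->
  mu.-integrable setT (fun y => (K m1 c1 (t - y) * K m2 c2 y)%:E).
Proof.
move=> m10 m20.
have mK1 := measurable_hp_kernel w rho0 c1 m10; have mK2 := measurable_hp_kernel w rho0 c2 m20.
apply: integrable_hp_kernel_conv => //; first by move=> y; exact: hp_kernel_eq0.
apply: integrable_convC => //; first exact: measurable_power_kernel.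
apply: integrable_hp_kernel_conv => //; first exact: measurable_power_kernel.
  by move=> y; exact: power_kernel_eq0.
by apply: integrable_power_kernel_conv; exact: kernel_order_gt0.
Qed.

Lemma integrable_hp_kernel_bounded (m c t B : R) (h : R -> R) : 0 <= m ->
  measurable_fun setT h -> (forall y, y <= 0 -> h y = 0) -> (forall y, `|h y| <= B) ->
  mu.-integrable setT (fun y => (K m c (t - y) * h y)%:E).
Proof.
move=> m0 mh h0 hB; apply: integrable_hp_kernel_conv => //.
have := integrable_power_kernel_conv t (kernel_order_gt0 rho0 m0) ltr01.
move=> /(integrableZl measurableT B); apply: le_integrable => //.
  apply/measurable_EFinP; apply: measurable_funM => //.
  by apply: measurable_reflect; exact: measurable_power_kernel.
move=> y _; rewrite /= lee_fin; have [y0|y0] := ltP 0 y; last by rewrite h0// mulr0 normr0.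
rewrite [power_kernel 1 y]/power_kernel y0 subrr powRr0 mulr1 normrM [leRHS]normrM mulrC.
by rewrite ler_wpM2r// (le_trans (hB y))// ler_norm.
Qed.

Section Uniqueness.
Variables (nu gamma : R).
Hypotheses (nu01 : 0 < nu <= 1) (gamma0 : 0 <= gamma).

Let nu0 : 0 < nu. Proof. by case/andP: nu01. Qed.
Let nu1 : nu <= 1. Proof. by case/andP: nu01. Qed.
Let nu1' : 0 <= 1 - nu. Proof. by rewrite subr_ge0. Qed.

(** Orders and parameters add up to K(1, 0), the Heaviside function, and convolving with it is
    integration from 0. *)
Lemma inverse_kernel_conv s : conv (K nu gamma) (K (1 - nu) (- gamma)) s =
  (0 < s)%R%:R - (1 - nu == 0)%R%:R * K nu gamma s.
Proof.
rewrite convC; [|exact: measurable_hp_kernel (ltW nu0)|exact: measurable_hp_kernel].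
by rewrite hp_kernel_conv// subrK addNr hp_kernel0 rl_kernel1.
Qed.

(** The equation is convolved with K(nu, gamma). By associativity and [inverse_kernel_conv] its
    left-hand side becomes the integral of the derivative of u, that is u t - u 0. *)
Lemma hp_derive_volterra (b B : R) (u h : R -> R) :
  absolutely_continuous 0 b u -> measurable_fun setT h ->
  (forall y, ~~ (0 < y < b) -> h y = 0) -> (forall y, `|h y| <= B) ->
  (forall t, 0 < t < b -> hp_derivable rho w gamma nu u t /\ hp_derive rho w gamma nu u t = h t) ->
  forall t, 0 < t < b -> u t = u 0 + conv (K nu gamma) h t.
Proof.
move=> acu mh h0 hB hu t /andP[t0 tb].
have b0 : 0 < b := lt_trans t0 tb.
have [g1 [ig1 ug1 dug1]] := absolutely_continuous_FTC (ltW b0) acu.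
have mg1 : measurable_fun setT g1 by move/integrableP: ig1 => [/measurable_EFinP].
(* The derivative of u is known to be g1 almost everywhere on ]0, b[ only. *)
pose g y := if (0 < y) && (y < b) then g1 y else 0.
have mg : measurable_fun setT g.
  by apply: measurable_fun_ifT => //; apply: measurable_and; exact: measurable_fun_ltr.
have gabs y : `|g y| <= `|g1 y| by rewrite /g; case: ifP => // _; rewrite normr0.
have ig : mu.-integrable setT (EFin \o g).
  apply: le_integrable ig1 => //; first exact/measurable_EFinP.
  by move=> y _; rewrite /= lee_fin.
have g0 y : y <= 0 -> g y = 0 by rewrite /g ltNge => ->.
have h00 y : y <= 0 -> h y = 0 by move=> y0; apply: h0; rewrite ltNge y0.
have dug : {ae mu, forall y, 0 < y < b -> derive1 u y = g y}.
  move: dug1; apply: filterS; first exact: (ae_filter_ringOfSetsType mu).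
  by move=> y H yb; rewrite H// /g yb.
pose Kg := K (1 - nu) (- gamma); pose f := K nu gamma.
have mKg : measurable_fun setT Kg by exact: measurable_hp_kernel.
have mf : measurable_fun setT f by exact: measurable_hp_kernel (ltW nu0).
pose delta : R := (1 - nu == 0)%R%:R.
have at_s s : 0 < s < b -> mu.-integrable setT (fun y => (Kg (s - y) * g y)%:E) /\
    h s = delta * derive1 u s + conv Kg g s.
  move=> sb; have [[_ du] <-] := hu s sb.
  have [] := @prabhakar_integral_conv (1 - nu) (- gamma) s (derive1 u) g nu1' mg g0.
  - move: dug; apply: filterS; first exact: (ae_filter_ringOfSetsType mu).
    move=> y H /andP[y0 ys]; apply: H; rewrite y0 (lt_trans ys)//.
    by case/andP: sb.
  - move/integrableP: du => [/measurable_EFinP mdu _]; apply: measurable_funS mdu => //.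
    by apply: subset_itv; rewrite bnd_simp.
  move=> [/(_ du) i _] e; split => //.
  by rewrite /hp_derive /prabhakar_int e /delta; case: eqP => _; rewrite ?mul1r ?mul0r.
(* For nu = 1 the local summand of the derivative moves to the right-hand side, which leaves a pure
   convolution, valid almost everywhere. *)
pose phi s := h s - delta * g s.
have mphi : measurable_fun setT phi.
  by apply: measurable_funB => //; exact: measurable_funM.
have lt_t s : f (t - s) != 0 -> s < t.
  by apply: contraNT; rewrite -leNgt => ts; rewrite /f hp_kernel_eq0// subr_le0.
have zero s y : s <= 0 -> Kg (s - y) * g y = 0.
  move=> s0; have [y0|y0] := ltP 0 y; last by rewrite g0// mulr0.
  by rewrite /Kg hp_kernel_eq0 ?mul0r// subr_le0 (le_trans s0)// ltW.
have assoc : conv f phi t = conv (conv f Kg) g t.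
  apply: conv_assoc => //.
  - move: dug; apply: filterS; first exact: (ae_filter_ringOfSetsType mu).
    move=> s ds /lt_t st; have [s0|s0] := ltP 0 s; last first.
      rewrite /phi h00// g0// mulr0 subr0 /conv (_ : (fun y => _) = fun=> 0).
        by rewrite /Rintegral integral0.
      by apply/funext => y; exact: zero.
    have sb : 0 < s < b by rewrite s0 (lt_trans st).
    by have [_] := at_s s sb; rewrite ds// /phi => ->; rewrite addrC addKr.
  - move=> s /lt_t st; have [s0|s0] := ltP 0 s.
      by have [] : 0 < s < b -> _ := at_s s; rewrite ?s0 ?(lt_trans st).
    rewrite (_ : (fun y => _) = fun=> 0%:E); first exact: integrable0.
    by apply/funext => y; rewrite zero.
  - by move=> y _; apply: integrable_hp_kernels => //; exact: ltW.
  have [C C0 HC] := hp_kernel_bound w rho0 gamma b0 (ltW nu0).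
  have [D D0 HD] := hp_kernel_bound w rho0 (- gamma) b0 nu1'.
  set o := kernel_order rho (1 - nu) in HD.
  have o0 : 0 < o by exact: kernel_order_gt0.
  (* The two singular bounds have orders nu and o. As nu + o >= 1, their convolution is bounded on
     ]-oo, b], so the inner integral is at most Q for all y > 0. *)
  have nuo : 1 <= nu + o.
    rewrite /o /kernel_order; case: eqP => [/eqP|_]; last by rewrite addrC subrK.
    by rewrite subr_eq0 => /eqP <-; rewrite lerDl ltW.
  have kn : kernel_order rho nu = nu by rewrite /kernel_order gt_eqF.
  rewrite kn in HC.
  pose Q := C * D * (euler_gamma nu * euler_gamma o) * (rgamma (nu + o) * b `^ (nu + o - 1)).
  have inner y : 0 < y -> (\int[mu]_r `|f (t - y - r) * Kg r|%:E <= Q%:E)%E.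
    move=> y0; have tyb : t - y <= b by rewrite lerBlDr (le_trans (ltW tb))// lerDl ltW.
    apply: (@le_trans _ _ (\int[mu]_r ((C * D)%:E * (power_kernel nu (t - y - r) * power_kernel o r)%:E))%E).
      apply: ge0_le_integral => //=.
      - apply/measurable_EFinP; apply: measurableT_comp => //; apply: measurable_funM => //.
        exact: measurable_reflect.
      - apply/measurable_EFinP; apply: measurable_funM => //.
        exact: measurable_power_kernel_conv.
      - move=> r _; rewrite lee_fin normrM.
        have [r0|r0] := ltP 0 r; last by rewrite /Kg (hp_kernel_eq0 _ _ _ _ r0) normr0 mulr0 !mulr_ge0 ?power_kernel_ge0.
        have [tr|tr] := ltP r (t - y); last first.
          by rewrite /f hp_kernel_eq0 ?subr_le0// normr0 mul0r !mulr_ge0 ?power_kernel_ge0.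
        rewrite mulrACA; apply: ler_pM => //.
          by apply: HC; rewrite (le_trans _ tyb)// gerBl ltW.
        by apply: HD; rewrite (le_trans (ltW tr)).
    have i0 := integrable_power_kernel_conv (t - y) nu0 o0.
    rewrite integralZl// integral_power_kernel_conv// -EFinM lee_fin /Q -[leRHS]mulrA.
    apply: ler_wpM2l; first exact: mulr_ge0.
    apply: ler_wpM2l; first by apply: mulr_ge0; apply: ltW; exact: euler_gamma_gt0.
    apply: ler_wpM2l; first by apply: rgamma_ge0; apply: addr_ge0; exact: ltW.
    apply: le_trans (power_kernel_le nuo b0 tyb) _.
    rewrite ler_piMr ?powR_ge0// /power_kernel subrr powRr0; by case: ifP.
  have Q0 : (0 <= Q%:E)%E.
    by apply: le_trans (inner 1 ltr01); apply: integral_ge0 => r _; rewrite lee_fin.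
  apply: (@le_lt_trans _ _ (\int[mu]_y (Q%:E * `|(g y)%:E|))%E).
    apply: ge0_le_integral => //=.
    - by move=> y _; apply: mule_ge0; rewrite ?lee_fin//; apply: integral_ge0 => r _; rewrite lee_fin.
    - apply: emeasurable_funM; first by apply/measurable_EFinP; exact: measurableT_comp.
      apply: (@measurable_fun_fubini_tonelli_F _ _ _ _ R mu (fun z : R * R => `|f (t - z.1 - z.2) * Kg z.2|%:E)).
        apply/measurable_EFinP; apply: measurableT_comp => //; apply: measurable_funM; last exact: measurableT_comp.
        apply: measurableT_comp => //; apply: measurable_funB => //; exact: measurable_funB.
      by move=> z; rewrite lee_fin.
    - by apply: emeasurable_funM => //; apply/measurable_EFinP; exact: measurableT_comp.
    - move=> y _; rewrite muleC; have [y0|y0] := ltP 0 y; last by rewrite g0// normr0 !mule0.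
      by rewrite lee_wpmul2r ?lee_fin// inner.
  rewrite ge0_integralZl//; last by apply: measurableT_comp => //; exact/measurable_EFinP.
  by apply: lte_mul_pinfty => //; move/integrableP: ig => [].
have igt : mu.-integrable setT (fun y => ((0 < t - y)%R%:R * g y)%:E).
  apply: le_integrable ig => //.
    apply/measurable_EFinP; apply: measurable_funM => //.
    apply: (measurable_reflect (f := fun z : R => (0 < z)%R%:R)).
    rewrite (_ : (fun z => _) = rl_kernel 1); first exact: measurable_rl_kernel.
    by apply/funext => z; rewrite rl_kernel1.
  by move=> y _; rewrite /= lee_fin normrM ler_piMl//; case: (0 < t - y)%R; rewrite ?normr1 ?normr0.
have ugt : u t - u 0 = \int[mu]_y ((0 < t - y)%R%:R * g y).
  rewrite ug1 ?(ltW t0) ?(ltW tb)// /Rintegral; congr fine.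
  rewrite (@integral_itv_bndoo R 0 t (fun y => (g1 y)%:E) true false); last first.
    by apply/measurable_EFinP; exact: measurable_funTS.
  rewrite [LHS]integral_mkcond; apply: eq_integral => y _; rewrite patchE mem_setE in_itv/= subr_gt0.
  rewrite /g; have [yt|yt] := ltP y t; last by rewrite andbF mul0r.
  by rewrite (lt_trans yt tb) andbT mul1r; case: ifP.
(* delta is nonzero only for nu = 1, where f has no singularity at 0. *)
have convg : delta != 0 -> mu.-integrable setT (fun y => (f (t - y) * g y)%:E).
  rewrite /delta; have [/eqP|nz] := eqVneq (1 - nu) 0; last by rewrite eqxx.
  rewrite subr_eq0 => /eqP nuE _.
  apply: integrable_hp_kernel_conv => //; first exact: ltW.
  rewrite /kernel_order gt_eqF// -nuE; apply: le_integrable ig => //.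
    apply/measurable_EFinP; apply: measurable_funM => //.
    by apply: measurable_reflect; exact: measurable_power_kernel.
  move=> y _; rewrite /= lee_fin normrM ler_piMl// /power_kernel subrr powRr0.
  by case: ifP; rewrite ?normr1 ?normr0.
have ifh : mu.-integrable setT (fun y => (f (t - y) * h y)%:E).
  by apply: integrable_hp_kernel_bounded hB => //; exact: ltW.
apply/eqP; rewrite addrC -subr_eq ugt; apply/eqP.
have [d0|d0] := eqVneq delta 0.
  have -> : conv f h t = conv f phi t.
    by apply: eq_Rintegral => y _; rewrite /phi d0 mul0r subr0.
  rewrite assoc; apply: eq_Rintegral => y _.
  by rewrite /f /Kg inverse_kernel_conv -/delta d0 mul0r subr0.
have izg : mu.-integrable setT (fun y => (delta * (f (t - y) * g y))%:E).
  exact: (integrableZl measurableT delta (convg d0)).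
(* The local summand and the missing Dirac mass produce the same term delta times f convolved with
   g, on the two sides of [assoc], where it cancels. *)
have e1 : conv f phi t = conv f h t - delta * conv f g t.
  rewrite /conv -RintegralZl//; last exact: convg.
  rewrite -(RintegralB measurableT ifh izg).
  by apply: eq_Rintegral => y _; rewrite /phi; ring.
have e2 : conv (conv f Kg) g t = \int[mu]_y ((0 < t - y)%R%:R * g y) - delta * conv f g t.
  rewrite /conv -RintegralZl//; last exact: convg.
  rewrite -(RintegralB measurableT igt izg).
  apply: eq_Rintegral => y _; have := inverse_kernel_conv (t - y).
  by rewrite /conv -/delta => ->; rewrite /f; ring.
by have := assoc; rewrite e1 e2 => /addIr.
Qed.

(* Fractional Gronwall: iterating the equation bounds the sum of the absolute
   values by a geometric sequence times Riemann-Liouville kernels. *)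
Lemma volterra_system_eq0 (alpha beta b B : R) (e1 e2 : R -> R) : 0 < b ->
  measurable_fun setT e1 -> measurable_fun setT e2 ->
  (forall y, ~~ (0 < y < b) -> e1 y = 0) -> (forall y, ~~ (0 < y < b) -> e2 y = 0) ->
  (forall y, `|e1 y| <= B) -> (forall y, `|e2 y| <= B) ->
  (forall t, 0 < t < b -> e1 t = conv (K nu gamma) (fun y => alpha * e1 y - beta * e2 y) t) ->
  (forall t, 0 < t < b -> e2 t = conv (K nu gamma) (fun y => alpha * e2 y + beta * e1 y) t) ->
  forall t, 0 < t < b -> e1 t = 0 /\ e2 t = 0.
Proof.
move=> b0 me1 me2 e10 e20 e1B e2B e1E e2E.
have B0 : 0 <= B := le_trans (normr_ge0 _) (e1B 0).
have [C C0 HC] := hp_kernel_bound w rho0 gamma b0 (ltW nu0).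
have kn : kernel_order rho nu = nu by rewrite /kernel_order gt_eqF.
rewrite kn in HC.
pose a := `|alpha| + `|beta|.
have a0 : 0 <= a by rewrite addr_ge0.
pose L := C * a * euler_gamma nu.
have G0 := euler_gamma_gt0 nu0.
have L0 : 0 <= L by apply: mulr_ge0; [exact: mulr_ge0|exact: ltW].
(* Each iteration raises the order by nu at the cost of C Gamma nu from the kernel and of 2 a from
   the two components, together 2 L. *)
pose M n t := B * (2 * L) ^+ n * rl_kernel (n%:R * nu + 1) t.
have M0 n t : 0 <= M n t.
  apply: mulr_ge0; first by apply: mulr_ge0 => //; apply: exprn_ge0; exact: mulr_ge0.
  by apply: rl_kernel_ge0; rewrite addr_ge0// mulr_ge0// ltW.
have step n (h : R -> R) t : measurable_fun setT h ->
    (forall y, ~~ (0 < y < b) -> h y = 0) ->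
    (forall y, `|h y| <= a * 2 * M n y) -> 0 < t < b ->
    `|conv (K nu gamma) h t| <= M n.+1 t.
  move=> mh h0 hM /andP[t0 tb].
  have np : 0 < n%:R * nu + 1 by rewrite ltr_wpDl// mulr_ge0// ltW.
  pose c := C * (a * 2 * (B * (2 * L) ^+ n * rgamma (n%:R * nu + 1))).
  have c0 : 0 <= c.
    have z1 := rgamma_ge0 (ltW np).
    have z2 : 0 <= (2 * L) ^+ n by apply: exprn_ge0; exact: mulr_ge0.
    apply: mulr_ge0 => //; apply: mulr_ge0; first exact: mulr_ge0.
    by apply: mulr_ge0 => //; exact: mulr_ge0.
  have i := integrableZl measurableT c (integrable_power_kernel_conv t nu0 np).
  have bound y : `|K nu gamma (t - y) * h y| <= c * (power_kernel nu (t - y) * power_kernel (n%:R * nu + 1) y).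
    have [y0|y0] := ltP 0 y; last first.
      rewrite h0 ?ltNge ?y0// mulr0 normr0.
      by apply: mulr_ge0 => //; apply: mulr_ge0; exact: power_kernel_ge0.
    rewrite normrM; apply: le_trans (ler_pM _ _ (HC (t - y) _) (hM y)) _ => //.
      by rewrite (le_trans _ (ltW tb))// gerBl ltW.
    by rewrite /c /M /rl_kernel le_eqVlt; apply/orP; left; apply/eqP; ring.
  have mKh : measurable_fun setT (fun y => K nu gamma (t - y) * h y).
    apply: measurable_funM => //; apply: measurable_reflect.
    exact: measurable_hp_kernel (ltW nu0).
  have iKh : mu.-integrable setT (EFin \o (fun y => K nu gamma (t - y) * h y)).
    apply: le_integrable i => //; first exact/measurable_EFinP.
    by move=> y _; rewrite /= lee_fin (le_trans (bound y))// ler_norm.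
  apply: le_trans (le_normr_Rintegral measurableT iKh) _.
  apply: (@le_trans _ _ (\int[mu]_y (c * (power_kernel nu (t - y) * power_kernel (n%:R * nu + 1) y)))).
    by apply: le_Rintegral => //; exact: integrable_norm.
  rewrite RintegralZl//; last exact: integrable_power_kernel_conv.
  rewrite {1}/Rintegral integral_power_kernel_conv//=.
  have g1 : rgamma (n%:R * nu + 1) * euler_gamma (n%:R * nu + 1) = 1.
    have gz : euler_gamma (n%:R * nu + 1) != 0 by rewrite gt_eqF ?euler_gamma_gt0.
    by rewrite (rgammaE np) mulVf.
  rewrite /c /M (_ : nu + (n%:R * nu + 1) = n.+1%:R * nu + 1); last by rewrite -natr1; ring.
  rewrite le_eqVlt; apply/orP; left; apply/eqP.
  transitivity (C * (a * 2 * (B * (2 * L) ^+ n)) * euler_gamma nu * rl_kernel (n.+1%:R * nu + 1) t *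
    (rgamma (n%:R * nu + 1) * euler_gamma (n%:R * nu + 1))); first by ring.
  by rewrite g1 mulr1 exprS /L; ring.
have bound n : forall y, `|e1 y| <= M n y /\ `|e2 y| <= M n y.
  elim: n => [|n ih] y.
    have [yb|yb] := boolP (0 < y < b); last by rewrite e10// e20// normr0.
    by rewrite /M mul0r add0r expr0 mulr1 rl_kernel1; case/andP: yb => -> _; rewrite mulr1.
  have [yb|yb] := boolP (0 < y < b); last by rewrite e10// e20// normr0.
  have le2 (z1 z2 : R) s : `|z1| <= M n s -> `|z2| <= M n s ->
      `|alpha * z1 + beta * z2| <= a * 2 * M n s.
    move=> z1M z2M; apply: le_trans (ler_normD _ _) _; rewrite !normrM.
    have A1 : `|alpha| * `|z1| <= a * M n s by apply: ler_pM => //; rewrite lerDl.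
    have A2 : `|beta| * `|z2| <= a * M n s by apply: ler_pM => //; rewrite lerDr.
    by apply: le_trans (lerD A1 A2) _; rewrite le_eqVlt; apply/orP; left; apply/eqP; ring.
  split.
    rewrite e1E//; apply: step => //.
    - by apply: measurable_funB; exact: measurable_funM.
    - by move=> s sb; rewrite e10// e20// !mulr0 subr0.
    - by move=> s; have [h1 h2] := ih s; rewrite -mulrN; apply: le2; rewrite ?normrN.
  rewrite e2E//; apply: step => //.
  - by apply: measurable_funD; exact: measurable_funM.
  - by move=> s sb; rewrite e10// e20// !mulr0 addr0.
  - by move=> s; have [h1 h2] := ih s; exact: le2.
move=> t /andP[t0 tb].
(* Q is positive even if L = 0; X will make 2 L (b / X)^nu at most 2^-1, so that M n t tends to
   0. *)
pose Q := 2 * L + 1; have Q0 : 0 < Q by rewrite ltr_wpDl// mulr_ge0.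
have q0 : 0 < 2^-1 / Q by rewrite divr_gt0 ?invr_gt0.
have [X [X0 _ HX]] := exists_scale rho0 nu0 b0 q0 q0.
have Mt : exists D, forall n, M n t <= D * 2^-1 ^+ n.
  exists (B * ((X + 1) * expR (X + 1) * b `^ (- 1) * (b / X))) => n.
  have bX : 0 < b / X by rewrite divr_gt0.
  have n1 : 1 <= n%:R * nu + 1 by rewrite lerDr mulr_ge0// ltW.
  have := rgamma_power_kernel_bound ltr01 n1 b0 X0 (ltW tb).
  have pk1 : power_kernel 1 t = 1 by rewrite /power_kernel t0 subrr powRr0.
  rewrite pk1 mulr1 powRD; last by rewrite (gt_eqF bX) implybT.
  rewrite (powRr1 (ltW bX)) [n%:R * nu]mulrC powRrM powR_mulrn ?powR_ge0// => H.
  have E0 : 0 <= (X + 1) * expR (X + 1) * b `^ (- 1) * (b / X).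
    apply: mulr_ge0; last exact: ltW.
    apply: mulr_ge0; last exact: powR_ge0.
    by apply: mulr_ge0; [apply: addr_ge0 => //; exact: ltW|exact: expR_ge0].
  rewrite /M [n%:R * nu]mulrC -[leLHS]mulrA -[leRHS]mulrA ler_wpM2l//.
  apply: le_trans (ler_wpM2l _ H) _; first by rewrite exprn_ge0// mulr_ge0.
  have -> : (2 * L) ^+ n * ((X + 1) * expR (X + 1) * b `^ (- 1) * ((b / X) `^ nu ^+ n * (b / X))) =
      (X + 1) * expR (X + 1) * b `^ (- 1) * (b / X) * (2 * L * (b / X) `^ nu) ^+ n.
    by rewrite [in RHS]exprMn; ring.
  rewrite ler_wpM2l//.
  have q1 : 0 <= 2 * L * (b / X) `^ nu.
    by apply: mulr_ge0; [exact: mulr_ge0|exact: powR_ge0].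
  rewrite lerXn2r ?nnegrE ?invr_ge0//.
  apply: (@le_trans _ _ (Q * (b / X) `^ nu)); first by rewrite ler_wpM2r ?powR_ge0// lerDl.
  by rewrite mulrC -ler_pdivlMr.
have [D HD] := Mt.
have small (z : R) : (forall n, `|z| <= D * 2^-1 ^+ n) -> z = 0.
  move=> zD; apply/eqP; rewrite -normr_eq0; apply: contraT => z0.
  have zp : 0 < `|z| by rewrite lt_neqAle eq_sym z0/=.
  have [N _ /(_ N (leqnn N)) /= HN] := near_half_lt D zp.
  by have := lt_le_trans (le_lt_trans (zD N) HN) (lexx _); rewrite ltxx.
by split; apply: small => n; have [h1 h2] := bound n t; apply: le_trans (HD n).
Qed.

End Uniqueness.
End Volterra.

(** * Continuity, boundedness and primitives *)

Section AbsolutelyContinuousFacts.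
Context {R : realType}.
Notation mu := (@lebesgue_measure R).
Implicit Types (a b x y t : R) (f u g : R -> R).

Lemma absolutely_continuous_dist a b f e : absolutely_continuous a b f -> 0 < e ->
  exists2 d, 0 < d & forall x y, a <= x -> x <= y -> y <= b -> y - x < d ->
    `|f y - f x| < e.
Proof.
move=> /absolutely_continuousW acf e0; have [d d0 Hd] := acf e e0; exists d => // x y ax xy yb xyd.
have := Hd [:: (x, y)]; rewrite /increments /lengths !big_seq1/= /itv_within/= ax xy yb.
exact.
Qed.

Lemma absolutely_continuous_measurable a b f : absolutely_continuous a b f ->
  measurable_fun `]a, b[ f.
Proof.
move=> acf; apply: open_continuous_measurable_fun; first exact: interval_open.
move=> x; rewrite inE/= in_itv/= => /andP[ax xb].
apply/cvgrPdist_lt => e e0; have [d d0 Hd] := absolutely_continuous_dist acf e0.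
near=> y; have ay : a <= y by near: y; exact: lt_le_nbhsr.
have yb : y <= b by near: y; exact: lt_le_nbhsl.
have : `|x - y| < d by near: y; exists d.
have [xy|/ltW yx] := leP x y.
  by rewrite distrC [`|f x - _|]distrC => H; apply: Hd => //; [exact: ltW|rewrite (le_lt_trans _ H)// ler_norm].
by move=> H; apply: Hd => //; [exact: ltW|rewrite (le_lt_trans _ H)// ler_norm].
Unshelve. all: by end_near. Qed.

Lemma absolutely_continuous_bounded a b f : a <= b -> absolutely_continuous a b f ->
  exists B, forall y, a <= y <= b -> `|f y| <= B.
Proof.
move=> ab acf; have [g [ig fg _]] := absolutely_continuous_FTC ab acf.
exists (`|f a| + \int[mu]_y `|g y|) => y yab.
have -> : f y = f a + (f y - f a) by ring.
apply: le_trans (ler_normD _ _) _; rewrite lerD2l fg//.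
have igy : mu.-integrable `[a, y] (EFin \o g).
  by apply: integrableS ig => //; exact: measurable_itv.
have H : `|\int[mu]_(z in `[a, y]) g z| <= \int[mu]_(z in `[a, y]) `|g z|.
  by apply: le_normr_Rintegral => //; exact: measurable_itv.
apply: le_trans H _.
rewrite /Rintegral; apply: fine_le.
- by apply: integrable_fin_num; [exact: measurable_itv|exact: integrable_norm].
- by apply: integrable_fin_num => //; exact: integrable_norm.
apply: ge0_subset_integral => //.
by have /integrableP[] := integrable_norm ig.
Qed.

(** The integral of |g| over a set is small with its measure; this is applied to the union of the
    intervals, whose measure is the sum of their lengths. *)
Lemma absolutely_continuous_primitive (b c : R) g : 0 <= b ->
  mu.-integrable `[0, b] (EFin \o g) ->
  absolutely_continuous 0 b (fun t => c + \int[mu]_(y in `[0, t]) g y).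
Proof.
move=> b0 ig e e0; pose f := g \_ `[0, b].
have if_ : mu.-integrable setT (EFin \o f).
  have := ig; rewrite integrable_mkcond; last exact: measurable_itv.
  by apply: eq_integrable => // y _; rewrite /f /= !patchE; case: ifP.
have [d [d0 Hd]] := integral_normr_continuous if_ e0; exists d => // n x y xy tI len.
pose I (i : 'I_n) : set R := `]x i, y i[%classic.
have mI i : measurable (I i) by exact: measurable_itv.
have mU : measurable (\big[setU/set0]_(i < n) I i) by exact: bigsetU_measurable.
have muU : (mu (\big[setU/set0]_(i < n) I i) < d%:E)%E.
  have -> : mu (\big[setU/set0]_(i < n) I i) = (\sum_(i < n) mu (I i))%E.
    rewrite -[LHS]mul1e -integral_cst// ge0_integral_bigsetU//=.
    - by apply: eq_bigr => i _; have := integral_cst mu (mI i) 1; rewrite mul1e.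
    - exact: index_enum_uniq.
    - exact: sub_trivIset tI.
  apply: (@le_lt_trans _ _ (\sum_(i < n) (y i - x i))%:E); last by rewrite lte_fin.
  rewrite -sumEFin; apply: lee_sum => i _; rewrite lebesgue_measure_itv/= lte_fin.
  have [x0 [xy' yb]] := xy i.
  by case: ifP; rewrite -?EFinB// lee_fin subr_ge0.
apply: le_lt_trans (Hd _ mU muU).
have itI i : mu.-integrable (I i) (EFin \o f).
  by apply: integrableS if_ => //; exact: measurable_itv.
have abs_int i : `|c + \int[mu]_(z in `[0, y i]) g z - (c + \int[mu]_(z in `[0, x i]) g z)| <=
    \int[mu]_(z in I i) `|f z|.
  have [x0 [xy' yb]] := xy i.
  have igi : mu.-integrable `[0, y i] (EFin \o g).
    by apply: integrableS ig => //; apply: subset_itvl; rewrite bnd_simp.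
  rewrite (_ : _ - _ = \int[mu]_(z in `[0, y i]) g z - \int[mu]_(z in `[0, x i]) g z); last by ring.
  rewrite Rintegral_itvB//.
  have -> : \int[mu]_(z in `]x i, y i]) g z = \int[mu]_(z in I i) f z.
    rewrite -Rintegral_itv_bndo_bndc; last first.
      by apply: integrableS igi => //; apply: subset_itv; rewrite bnd_simp.
    apply: eq_Rintegral => z; rewrite inE /I/= in_itv/= => /andP[xz zy].
    rewrite /f patchE mem_set//= in_itv/= (le_trans x0 (ltW xz))/=.
    by rewrite (le_trans (ltW zy)).
  by apply: le_normr_Rintegral => //; exact: mI.
apply: (@le_trans _ _ (\sum_(i < n) \int[mu]_(z in I i) `|f z|)).
  by apply: ler_sum => i _; exact: abs_int.
have fin i : (\int[mu]_(z in I i) `|f z|%:E)%E \is a fin_num.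
  by have /integrable_fin_num := integrable_norm (itI i); apply; exact: mI.
rewrite -lee_fin -sumEFin /Rintegral; under eq_bigr do rewrite fineK//.
rewrite fineK; last first.
  have inorm : mu.-integrable (\big[setU/set0]_(i < n) I i) (EFin \o (fun z => `|f z|)).
    by apply: integrableS (integrable_norm if_) => //; exact: mU.
  by have /integrable_fin_num := inorm; apply; exact: mU.
rewrite ge0_integral_bigsetU//.
- exact: index_enum_uniq.
- exact: sub_trivIset tI.
- apply: measurable_funTS; apply/measurable_EFinP; apply: measurableT_comp => //.
  by move/integrableP: if_ => [/measurable_EFinP].
Qed.

End AbsolutelyContinuousFacts.

(** * The series as a primitive, and its fractional derivative *)

Section RealSolution.
Context {R : realType}.
Notation mu := (@lebesgue_measure R).
Variables (rho w nu gamma : R) (c : R ^nat) (A : R).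
Hypotheses (rho0 : 0 < rho) (nu01 : 0 < nu <= 1) (gamma0 : 0 <= gamma) (A0 : 0 < A)
  (cA : forall n, `|c n| <= A ^+ n).
Notation K := (hp_kernel rho w).
Notation D := (dsol rho w nu gamma c).

Let nu0 : 0 < nu. Proof. by case/andP: nu01. Qed.

(* The sum of the sol_term at t > 0 (see sol_series), written as the primitive
   of dsol. *)
Definition sol (t : R) : R := c 0%N + \int[mu]_(y in `[0, t]) D y.

Let mD : measurable_fun setT D.
Proof. exact: measurable_dsol nu01 gamma0 A0 cA. Qed.

(** K(1, 0) is the Heaviside function, so the convolution results for dsol also cover its
    primitive. *)
Let conv1D t : mu.-integrable setT (fun y : R => ((0 < t - y)%R%:R * D y)%:E) /\
  conv (K 1 0) D t = \int[mu]_y ((0 < t - y)%R%:R * D y).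
Proof.
have KE z : K 1 0 z = (0 < z)%R%:R by rewrite hp_kernel0 rl_kernel1.
have [i _] := hp_kernel_conv_dsol w rho0 nu01 gamma0 A0 cA 0 t ler01.
split; last by apply: eq_Rintegral => y _; rewrite KE.
by apply: eq_integrable i => // y _; rewrite KE.
Qed.

Lemma integrable_dsol (t : R) : mu.-integrable `[0, t] (EFin \o D).
Proof.
(* At t + 1 the Heaviside factor is 1 on all of [0, t], endpoint included. *)
have [i _] := conv1D (t + 1).
have : mu.-integrable `[0, t] (fun y : R => ((0 < t + 1 - y)%R%:R * D y)%:E).
  by apply: integrableS i => //; exact: measurable_itv.
apply: eq_integrable; first exact: measurable_itv.
move=> y; rewrite inE/= in_itv/= => /andP[_ yt].
by rewrite subr_gt0 (le_lt_trans yt) ?ltrDl// mul1r.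
Qed.

Lemma sol0 : sol 0 = c 0%N.
Proof. by rewrite /sol set_itv1 Rintegral_set1 addr0. Qed.

(** The term n = 0 is the constant c 0; the others are the termwise primitives of dsol, by
    convolution with K(1, 0). *)
Lemma sol_series t : 0 < t ->
  limn (series (fun n => sol_term rho w nu gamma c n t)) = sol t.
Proof.
move=> t0; rewrite limn_series_recl; last exact: (is_cvg_sol (A := A)).
rewrite /sol {1}/sol_term mul0r add0r mul0r hp_kernel0 rl_kernel1 t0 mulr1; congr (_ + _).
have [_ e] := conv1D t.
have [_ s] := hp_kernel_conv_dsol w rho0 nu01 gamma0 A0 cA 0 t ler01.
transitivity (conv (K 1 0) D t).
  rewrite s; congr (limn (series _)); apply/funext => n.
  by rewrite /sol_term oner_eq0 mul0r subr0 add0r [1 + _]addrC.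
rewrite e /Rintegral; congr fine.
rewrite (@integral_itv_bndoo R 0 t (fun y => (D y)%:E) true false); last first.
  by apply/measurable_EFinP; exact: measurable_funTS.
rewrite [RHS]integral_mkcond; apply: eq_integral => y _; rewrite patchE mem_setE in_itv/= subr_gt0.
have [yt|yt] := ltP y t; last by rewrite andbF mul0r.
by rewrite andbT mul1r; case: ltP => // y0; rewrite dsol_eq0.
Qed.

Lemma sol_derive t : 0 < t -> derivable sol t 1 /\ derive1 sol t = D t.
Proof.
move=> t0; have cD := continuous_dsol rho0 nu01 gamma0 A0 cA t0 (w := w).
have [dF FE] := continuous_FTC1_closed (ltr_pwDr ltr01 (lexx t)) (integrable_dsol (t + 1)) t0 cD.
split; first by apply: derivableD; [exact: derivable_cst|exact: dF].
rewrite derive1E deriveD; [|exact: derivable_cst|exact: dF].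
by rewrite derive_cst add0r -derive1E.
Qed.

Lemma sol_absolutely_continuous b : 0 <= b -> absolutely_continuous 0 b sol.
Proof. by move=> b0; apply: absolutely_continuous_primitive => //; exact: integrable_dsol. Qed.

(** Convolution with K(1 - nu, - gamma) takes (n + 1) nu to n nu + 1 and (n + 1) gamma to n gamma,
    so that dsol becomes the solution series with shifted coefficients. *)
Lemma sol_hp_derive (u : R -> R) t : (forall y, 0 < y -> u y = sol y) -> 0 < t ->
  hp_derivable rho w gamma nu u t /\ hp_derive rho w gamma nu u t =
    limn (series (fun n => sol_term rho w nu gamma (fun k => c k.+1) n t)).
Proof.
move=> us t0.
have du y : 0 < y -> derivable u y 1 /\ derive1 u y = D y.
  move=> y0; have [d e] := sol_derive y0.
  have near_eq : \near y, sol y = u y.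
    by near=> z; rewrite us//; near: z; exact: lt_nbhsr.
  split; first exact: near_eq_derivable near_eq d.
  by rewrite -e !derive1E; apply/esym/near_eq_derive.
have nu1 : 0 <= 1 - nu by rewrite subr_ge0; case/andP: nu01.
have [] := @prabhakar_integral_conv R rho w rho0 (1 - nu) (- gamma) t (derive1 u) D nu1 mD.
- by move=> y; exact: dsol_eq0.
- by apply: aeW => y /andP[y0 _]; case: (du y y0).
- have : measurable_fun `]0, t[ (fun y : R => K (1 - nu) (- gamma) (t - y) * D y).
    apply: measurable_funTS; apply: measurable_funM => //; apply: measurable_reflect.
    exact: measurable_hp_kernel.
  apply: eq_measurable_fun => y; rewrite inE/= in_itv/= => /andP[y0 yt]; have [_ ->] := du y y0.
  by rewrite prabhakar_kernelE// subr_gt0.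
have [i s] := hp_kernel_conv_dsol w rho0 nu01 gamma0 A0 cA (- gamma) t nu1.
move=> [_ /(_ i) iu] eu; split; first by split => // _; case: (du t t0).
rewrite /hp_derive /prabhakar_int eu s; have [_ ->] := du t t0.
pose c' n := c n.+1.
(* The shifted sequence is bounded by A^(n+1); dividing by A restores the bound under which
   convergence is known. *)
have c'A n : `|A^-1 * c' n| <= A ^+ n.
  by rewrite normrM normfV (gtr0_norm A0) ler_pdivrMl// -exprS; exact: cA.
have cvg1 : cvgn (series (fun n => sol_term rho w nu gamma c' n t)).
  have : cvgn (series (fun n => sol_term rho w nu gamma (fun k => A^-1 * c' k) n t)).
    exact: (is_cvg_sol rho0 nu01 gamma0 A0 c'A).
  move=> /(@is_cvg_seriesZ _ _ A).
  rewrite (_ : _ *: _ = (fun n => sol_term rho w nu gamma c' n t))//.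
  by apply/funext => n; rewrite /sol_term /GRing.scale/= /GRing.scale/= !mulrA mulfV ?mul1r// gt_eqF.
have cvg2 : cvgn (series (fun n => dsol_term rho w nu gamma c n t)).
  exact: (is_cvg_dsol rho0 nu01 gamma0 A0 cA).
have cvg3 : cvgn (series (fun n => (1 - nu == 0)%R%:R * dsol_term rho w nu gamma c n t)).
  exact: is_cvg_seriesZ.
(* For nu = 1 the local summand D t of the derivative restores the mass missing from the
   convolution. *)
transitivity ((1 - nu == 0)%R%:R * D t + limn (series (fun n => sol_term rho w nu gamma c' n t -
    (1 - nu == 0)%R%:R * dsol_term rho w nu gamma c n t))).
  congr (_ + _); first by case: eqP; rewrite ?mul1r ?mul0r.
  congr (limn (series _)); apply/funext => n.
  rewrite /sol_term /dsol_term /c' (_ : 1 - nu + n.+1%:R * nu = n%:R * nu + 1); last by rewrite -natr1; ring.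
  rewrite (_ : - gamma + n.+1%:R * gamma = n%:R * gamma); last by rewrite -natr1; ring.
  by ring.
by rewrite limn_seriesB// limn_seriesZ// addrC subrK.
Unshelve. all: by end_near. Qed.

End RealSolution.

(** * The complex-valued Cauchy problem *)

Section ComplexSeries.
Context {R : realType}.

Lemma cvg_complex (u v : R ^nat) (x y : R) : u @ \oo --> x -> v @ \oo --> y ->
  (fun n => (u n +i* v n)%C : R[i]^o) @ \oo --> ((x +i* y)%C : R[i]^o).
Proof.
(* A positive element of [R[i]] is real. Errors below er / 2 in both components suffice, as 2 (er /
   2)^2 < er^2. *)
move=> ux vy; apply/cvgrPdist_lt => e; case: e => er ei; rewrite ltcE/= => /andP[/eqP ei0 er0].
have e2 : 0 < er / 2 by rewrite divr_gt0.
move: ux vy => /cvgrPdist_lt/(_ _ e2) Hu /cvgrPdist_lt/(_ _ e2) Hv.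
near=> n.
have hu : `|x - u n| < er / 2 by near: n.
have hv : `|y - v n| < er / 2 by near: n.
rewrite normc_def/= ltcE/= ei0 eqxx/=.
have -> : er = Num.sqrt (er ^+ 2) by rewrite sqrtr_sqr gtr0_norm.
rewrite ltr_sqrt ?exprn_gt0//; move: hu hv; rewrite !ltr_norml => /andP[h1 h2] /andP[h3 h4].
nra.
Unshelve. all: by end_near. Qed.

Lemma series_complex (u v : R ^nat) (n : nat) :
  series (fun k => (u k +i* v k)%C : R[i]^o) n = (series u n +i* series v n)%C.
Proof.
elim: n => [|n ih]; first by rewrite !seriesEnat/= !big_geq.
by rewrite seriesSr ih !seriesSr.
Qed.

Lemma cvg_series_complex (u v : R ^nat) (z : R[i] ^nat) :
  (forall n, z n = (u n +i* v n)%C) -> cvgn (series u) -> cvgn (series v) ->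
  series (z : (R[i]^o) ^nat) @ \oo --> ((limn (series u) +i* limn (series v))%C : R[i]^o).
Proof.
move=> zE cu cv; rewrite (_ : series _ = fun n => (series u n +i* series v n)%C : R[i]^o).
  exact: cvg_complex.
by apply/funext => n; rewrite -series_complex; congr (series _ n); apply/funext.
Qed.

Lemma Re_powerS (a : R[i]) n : complex.Re (a ^+ n.+1) =
  complex.Re a * complex.Re (a ^+ n) - complex.Im a * complex.Im (a ^+ n).
Proof. by rewrite exprS; case: a => x y; case: (_ ^+ n). Qed.

Lemma Im_powerS (a : R[i]) n : complex.Im (a ^+ n.+1) =
  complex.Re a * complex.Im (a ^+ n) + complex.Im a * complex.Re (a ^+ n).
Proof. by rewrite exprS; case: a => x y; case: (_ ^+ n). Qed.

(** |Re| + |Im| is submultiplicative, so both parts are bounded at once; the added 1 makes the base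
    positive even for a = 0. *)
Lemma normr_Re_Im_power_le (a : R[i]) n :
  `|complex.Re (a ^+ n)| <= (`|complex.Re a| + `|complex.Im a| + 1) ^+ n /\
  `|complex.Im (a ^+ n)| <= (`|complex.Re a| + `|complex.Im a| + 1) ^+ n.
Proof.
suff : `|complex.Re (a ^+ n)| + `|complex.Im (a ^+ n)| <=
    (`|complex.Re a| + `|complex.Im a| + 1) ^+ n.
  by move=> h; split; apply: le_trans h; rewrite ?lerDl ?lerDr.
elim: n => [|n ih]; first by rewrite !expr0 /= normr1 normr0 addr0.
rewrite Re_powerS Im_powerS exprS.
apply: le_trans (lerD (ler_normB _ _) (ler_normD _ _)) _; rewrite !normrM.
apply: (@le_trans _ _ ((`|complex.Re a| + `|complex.Im a|) *
  (`|complex.Re (a ^+ n)| + `|complex.Im (a ^+ n)|))).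
  by rewrite le_eqVlt; apply/orP; left; apply/eqP; ring.
by apply: ler_pM => //; rewrite ?lerDl// addr_ge0.
Qed.

End ComplexSeries.

(** * Uniqueness for the real system of the two components *)

Section RealSystem.
Context {R : realType}.
Notation mu := (@lebesgue_measure R).

Lemma absolutely_continuous_eq (a b : R) (f g : R -> R) :
  (forall x, a <= x <= b -> f x = g x) -> absolutely_continuous a b g ->
  absolutely_continuous a b f.
Proof.
move=> fg acg e e0; have [d d0 Hd] := acg e e0; exists d => // n x y xy tI len.
rewrite (eq_bigr (fun i => `|g (y i) - g (x i)|)); first exact: Hd.
move=> i _; have [ax [xy' yb]] := xy i.
by rewrite !fg ?ax ?yb ?(le_trans ax xy') ?(le_trans xy' yb).
Qed.

(** Left continuity at b: it carries uniqueness from ]0, b[ to the endpoint, where the equation is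
    not imposed. *)
Lemma absolutely_continuous_eq_right (a b : R) (f g : R -> R) : a < b ->
  absolutely_continuous a b f -> absolutely_continuous a b g ->
  (forall x, a < x < b -> f x = g x) -> f b = g b.
Proof.
move=> ab acf acg fg; apply/eqP; rewrite -subr_eq0 -normr_eq0; apply: contraT => nz.
have e0 : 0 < `|f b - g b| / 2 by rewrite divr_gt0// lt_neqAle eq_sym nz/=.
have [d1 d10 H1] := absolutely_continuous_dist acf e0.
have [d2 d20 H2] := absolutely_continuous_dist acg e0.
have [x [xa xb x1 x2]] : exists x, [/\ a < x, x < b, b - x < d1 & b - x < d2].
  exists (b - Num.min (b - a) (Num.min d1 d2) / 2).
  set m := Num.min _ _; have m0 : 0 < m by rewrite !lt_min subr_gt0 ab d10.
  have : m <= b - a by rewrite ge_min lexx.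
  have : m <= d1 by rewrite !ge_min lexx orbT.
  have : m <= d2 by rewrite !ge_min lexx !orbT.
  by move=> h1 h2 h3; split; lra.
have h1 := H1 x b (ltW xa) (ltW xb) (lexx _) x1.
have h2 := H2 x b (ltW xa) (ltW xb) (lexx _) x2.
have : `|f b - g b| < `|f b - g b|.
  have {1}-> : f b - g b = (f b - f x) - (g b - g x) by rewrite (fg x) ?xa//; ring.
  by apply: le_lt_trans (ler_normB _ _) _; rewrite [ltRHS](splitr _) ltrD.
by rewrite ltxx.
Qed.

Variables (rho w gamma nu alpha beta b : R).
Hypotheses (rho0 : 0 < rho) (nu01 : 0 < nu <= 1) (b0 : 0 < b).
Notation K := (hp_kernel rho w).

Let nu0 : 0 < nu. Proof. by case/andP: nu01. Qed.

(** The components of the equation D u = (alpha + i beta) u, with u = u1 + i u2. *)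
Definition real_system (u1 u2 : R -> R) : Prop :=
  [/\ absolutely_continuous 0 b u1, absolutely_continuous 0 b u2 &
    forall t, 0 < t < b ->
      [/\ hp_derivable rho w gamma nu u1 t, hp_derivable rho w gamma nu u2 t,
          hp_derive rho w gamma nu u1 t = alpha * u1 t - beta * u2 t &
          hp_derive rho w gamma nu u2 t = alpha * u2 t + beta * u1 t]].

(** A solution is arbitrary outside [0, b]; its cut-off is measurable and bounded on the line, as
    convolutions require. *)
Definition cutoff (f : R -> R) : R -> R := f \_ `]0, b[.

Lemma cutoffE f y : cutoff f y = if 0 < y < b then f y else 0.
Proof. by rewrite /cutoff patchE mem_setE in_itv. Qed.

Lemma measurable_cutoff f : absolutely_continuous 0 b f -> measurable_fun setT (cutoff f).
Proof.
move=> acf; apply/(measurable_restrictT _ _).1; first exact: measurable_itv.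
exact: absolutely_continuous_measurable acf.
Qed.

Lemma cutoff_bounded f : absolutely_continuous 0 b f ->
  exists B, forall y, `|cutoff f y| <= B.
Proof.
move=> acf; have [B HB] := absolutely_continuous_bounded (ltW b0) acf.
exists B => y; rewrite cutoffE; case: ifP => [/andP[y0 yb]|_].
  by apply: HB; rewrite !ltW.
by rewrite normr0; apply: le_trans (HB 0 _); rewrite ?lexx ?(ltW b0).
Qed.

Lemma conv_hp_kernelD (x y B1 B2 t : R) (h1 h2 : R -> R) :
  measurable_fun setT h1 -> measurable_fun setT h2 ->
  (forall s, s <= 0 -> h1 s = 0) -> (forall s, s <= 0 -> h2 s = 0) ->
  (forall s, `|h1 s| <= B1) -> (forall s, `|h2 s| <= B2) ->
  conv (K nu gamma) (fun s => x * h1 s + y * h2 s) t =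
    x * conv (K nu gamma) h1 t + y * conv (K nu gamma) h2 t.
Proof.
move=> mh1 mh2 h10 h20 hB1 hB2.
have i1 : mu.-integrable setT (fun s => (K nu gamma (t - s) * h1 s)%:E).
  by apply: integrable_hp_kernel_bounded hB1 => //; exact: ltW.
have i2 : mu.-integrable setT (fun s => (K nu gamma (t - s) * h2 s)%:E).
  by apply: integrable_hp_kernel_bounded hB2 => //; exact: ltW.
have j1 : mu.-integrable setT (fun s => (x * (K nu gamma (t - s) * h1 s))%:E).
  exact: (integrableZl measurableT x i1).
have j2 : mu.-integrable setT (fun s => (y * (K nu gamma (t - s) * h2 s))%:E).
  exact: (integrableZl measurableT y i2).
have -> : x * conv (K nu gamma) h1 t = \int[mu]_s (x * (K nu gamma (t - s) * h1 s)).
  by rewrite /conv -RintegralZl//; exact: i1.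
have -> : y * conv (K nu gamma) h2 t = \int[mu]_s (y * (K nu gamma (t - s) * h2 s)).
  by rewrite /conv -RintegralZl//; exact: i2.
rewrite -(RintegralD measurableT j1 j2).
by apply: eq_Rintegral => s _; ring.
Qed.

Lemma cutoff_le0 f s : s <= 0 -> cutoff f s = 0.
Proof. by rewrite cutoffE ltNge => ->. Qed.

(** [hp_derive_volterra] is applied to each equation with its right-hand side cut off; linearity
    then separates the components. *)
Lemma real_system_volterra u1 u2 : real_system u1 u2 -> forall t, 0 < t < b ->
  cutoff u1 t = u1 0 + (alpha * conv (K nu gamma) (cutoff u1) t -
                        beta * conv (K nu gamma) (cutoff u2) t) /\
  cutoff u2 t = u2 0 + (alpha * conv (K nu gamma) (cutoff u2) t +
                        beta * conv (K nu gamma) (cutoff u1) t).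
Proof.
move=> [ac1 ac2 Hu] t tb.
have m1 := measurable_cutoff ac1; have m2 := measurable_cutoff ac2.
have [B1 HB1] := cutoff_bounded ac1; have [B2 HB2] := cutoff_bounded ac2.
have bnd x y (f g : R -> R) Bf Bg : (forall s, `|cutoff f s| <= Bf) -> (forall s, `|cutoff g s| <= Bg) ->
    forall s, `|x * cutoff f s + y * cutoff g s| <= `|x| * Bf + `|y| * Bg.
  move=> hf hg s; apply: le_trans (ler_normD _ _) _.
  by rewrite !normrM; apply: lerD; apply: ler_wpM2l.
have zero x y (f g : R -> R) s : ~~ (0 < s < b) -> x * cutoff f s + y * cutoff g s = 0.
  by move=> /negPf sb; rewrite !cutoffE sb !mulr0 addr0.
have meas x y (f g : R -> R) : measurable_fun setT (cutoff f) -> measurable_fun setT (cutoff g) ->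
    measurable_fun setT (fun s => x * cutoff f s + y * cutoff g s).
  by move=> mf mg; apply: measurable_funD; exact: measurable_funM.
have V1 := hp_derive_volterra (w := w) (gamma := gamma) rho0 nu01 ac1
  (meas alpha (- beta) u1 u2 m1 m2) (zero alpha (- beta) u1 u2) (bnd alpha (- beta) _ _ _ _ HB1 HB2).
have V2 := hp_derive_volterra (w := w) (gamma := gamma) rho0 nu01 ac2
  (meas alpha beta u2 u1 m2 m1) (zero alpha beta u2 u1) (bnd alpha beta _ _ _ _ HB2 HB1).
rewrite -mulNr -(conv_hp_kernelD alpha (- beta) t m1 m2 (@cutoff_le0 _) (@cutoff_le0 _) HB1 HB2).
rewrite -(conv_hp_kernelD alpha beta t m2 m1 (@cutoff_le0 _) (@cutoff_le0 _) HB2 HB1).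
rewrite ![cutoff _ t]cutoffE tb; split.
  by apply: V1 => // s sb; have [d1 d2 e1 e2] := Hu s sb; rewrite !cutoffE sb mulNr.
by apply: V2 => // s sb; have [d1 d2 e1 e2] := Hu s sb; rewrite !cutoffE sb.
Qed.

Lemma real_system_unique u1 u2 v1 v2 : real_system u1 u2 -> real_system v1 v2 ->
  u1 0 = v1 0 -> u2 0 = v2 0 ->
  forall t, 0 <= t <= b -> u1 t = v1 t /\ u2 t = v2 t.
Proof.
move=> su sv e10 e20.
have [acu1 acu2 _] := su; have [acv1 acv2 _] := sv.
have mu1 := measurable_cutoff acu1; have mu2 := measurable_cutoff acu2.
have mv1 := measurable_cutoff acv1; have mv2 := measurable_cutoff acv2.
have [Bu1 HBu1] := cutoff_bounded acu1; have [Bu2 HBu2] := cutoff_bounded acu2.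
have [Bv1 HBv1] := cutoff_bounded acv1; have [Bv2 HBv2] := cutoff_bounded acv2.
(* The difference is written as a linear combination in order to fit [conv_hp_kernelD]. *)
pose d f g y : R := 1 * cutoff f y + (- 1) * cutoff g y.
pose B := Bu1 + Bu2 + Bv1 + Bv2.
have B0 f Bf : (forall s, `|cutoff f s| <= Bf) -> 0 <= Bf.
  by move=> /(_ 0); apply: le_trans.
have dB f g Bf Bg : (forall s, `|cutoff f s| <= Bf) -> (forall s, `|cutoff g s| <= Bg) ->
    forall s, `|d f g s| <= Bf + Bg.
  move=> hf hg s; rewrite /d mul1r mulN1r; apply: le_trans (ler_normB _ _) _; exact: lerD.
have md f g : measurable_fun setT (cutoff f) -> measurable_fun setT (cutoff g) ->
    measurable_fun setT (d f g).
  by move=> mf mg; apply: measurable_funD; exact: measurable_funM.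
have d0 f g y : ~~ (0 < y < b) -> d f g y = 0.
  by move=> /negPf yb; rewrite /d !cutoffE yb !mulr0 addr0.
have d00 f g y : y <= 0 -> d f g y = 0 by move=> y0; apply: d0; rewrite ltNge y0.
have h1 := dB _ _ _ _ HBu1 HBv1; have h2 := dB _ _ _ _ HBu2 HBv2.
have convd t := conv_hp_kernelD 1 (- 1) t mu1 mv1 (@cutoff_le0 _) (@cutoff_le0 _) HBu1 HBv1.
have convd2 t := conv_hp_kernelD 1 (- 1) t mu2 mv2 (@cutoff_le0 _) (@cutoff_le0 _) HBu2 HBv2.
have E1 t : 0 < t < b ->
    d u1 v1 t = conv (K nu gamma) (fun y => alpha * d u1 v1 y - beta * d u2 v2 y) t.
  move=> tb; have -> : (fun y => alpha * d u1 v1 y - beta * d u2 v2 y) =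
      (fun y => alpha * d u1 v1 y + (- beta) * d u2 v2 y).
    by apply/funext => y; rewrite mulNr.
  rewrite (conv_hp_kernelD alpha (- beta) t (md _ _ mu1 mv1) (md _ _ mu2 mv2) (@d00 _ _) (@d00 _ _) h1 h2).
  rewrite /d convd convd2.
  have [-> _] := real_system_volterra su tb; have [-> _] := real_system_volterra sv tb.
  by rewrite e10; ring.
have E2 t : 0 < t < b ->
    d u2 v2 t = conv (K nu gamma) (fun y => alpha * d u2 v2 y + beta * d u1 v1 y) t.
  move=> tb.
  rewrite (conv_hp_kernelD alpha beta t (md _ _ mu2 mv2) (md _ _ mu1 mv1) (@d00 _ _) (@d00 _ _) h2 h1).
  rewrite /d convd convd2.
  have [_ ->] := real_system_volterra su tb; have [_ ->] := real_system_volterra sv tb.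
  by rewrite e20; ring.
have hB1 y : `|d u1 v1 y| <= B.
  apply: le_trans (h1 y) _; rewrite /B -!addrA lerD2l addrCA lerDl.
  by rewrite addr_ge0 ?(B0 _ _ HBu2) ?(B0 _ _ HBv2).
have hB2 y : `|d u2 v2 y| <= B.
  apply: le_trans (h2 y) _; rewrite /B.
  by have := B0 _ _ HBu1; have := B0 _ _ HBv1; lra.
have Z t : 0 < t < b -> u1 t = v1 t /\ u2 t = v2 t.
  move=> tb.
  have [] := volterra_system_eq0 rho0 nu01 b0 (md _ _ mu1 mv1) (md _ _ mu2 mv2)
    (@d0 _ _) (@d0 _ _) hB1 hB2 E1 E2 tb.
  rewrite /d !cutoffE tb !mul1r !mulN1r => /eqP; rewrite subr_eq0 => /eqP ->.
  by move=> /eqP; rewrite subr_eq0 => /eqP ->.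
(* The initial values settle t = 0, continuity settles t = b. *)
move=> t /andP[]; rewrite le_eqVlt => /orP[/eqP <- //|t0].
rewrite le_eqVlt => /orP[/eqP ->|tb]; last by apply: Z; rewrite t0.
split; [apply: (absolutely_continuous_eq_right b0 acu1 acv1)|
        apply: (absolutely_continuous_eq_right b0 acu2 acv2)] => x /Z[]//.
Qed.

End RealSystem.

(** * Powers of a complex number as coefficients *)

Section PowerSolution.
Context {R : realType}.
Variables (rho w gamma nu : R) (a : R[i]).
Hypotheses (rho0 : 0 < rho) (nu01 : 0 < nu <= 1) (gamma0 : 0 <= gamma).
Notation cRe := (fun n => complex.Re (a ^+ n)).
Notation cIm := (fun n => complex.Im (a ^+ n)).
Notation A := (`|complex.Re a| + `|complex.Im a| + 1).

Let nu0 : 0 < nu. Proof. by case/andP: nu01. Qed.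

Let A0 : 0 < A. Proof. by rewrite ltr_wpDl// addr_ge0. Qed.

Let cReA n : `|cRe n| <= A ^+ n. Proof. by have [] := normr_Re_Im_power_le a n. Qed.

Let cImA n : `|cIm n| <= A ^+ n. Proof. by have [] := normr_Re_Im_power_le a n. Qed.

(** c' is meant to be the shift of c: multiplying a^n by a gives such a recurrence for the real and
    the imaginary parts, and this turns the shifted series into the right-hand side of the
    system. *)
Lemma limn_sol_term_comb (x y t : R) (c d c' : R ^nat) : 0 < t ->
  (forall n, `|c n| <= A ^+ n) -> (forall n, `|d n| <= A ^+ n) ->
  (forall n, c' n = x * c n - y * d n) ->
  limn (series (fun n => sol_term rho w nu gamma c' n t)) =
  x * sol rho w nu gamma c t - y * sol rho w nu gamma d t.
Proof.
move=> t0 cA dA c'E.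
have k1 : cvgn (series (fun n => sol_term rho w nu gamma c n t)).
  exact: (is_cvg_sol rho0 nu01 gamma0 A0 cA).
have k2 : cvgn (series (fun n => sol_term rho w nu gamma d n t)).
  exact: (is_cvg_sol rho0 nu01 gamma0 A0 dA).
rewrite -(sol_series w rho0 nu01 gamma0 A0 cA t0) -(sol_series w rho0 nu01 gamma0 A0 dA t0).
rewrite -limn_seriesZ// -limn_seriesZ// -limn_seriesB; last 2 first.
- exact: is_cvg_seriesZ.
- exact: is_cvg_seriesZ.
congr (limn (series _)); apply/funext => n; rewrite /sol_term c'E; ring.
Qed.

Lemma power_solution_system (b : R) (u1 u2 : R -> R) : 0 < b ->
  (forall t, 0 <= t -> u1 t = sol rho w nu gamma cRe t) ->
  (forall t, 0 <= t -> u2 t = sol rho w nu gamma cIm t) ->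
  real_system rho w gamma nu (complex.Re a) (complex.Im a) b u1 u2.
Proof.
move=> b0 u1E u2E; split.
- apply: absolutely_continuous_eq (sol_absolutely_continuous w rho0 nu01 gamma0 A0 cReA (ltW b0)).
  by move=> x /andP[x0 _]; exact: u1E.
- apply: absolutely_continuous_eq (sol_absolutely_continuous w rho0 nu01 gamma0 A0 cImA (ltW b0)).
  by move=> x /andP[x0 _]; exact: u2E.
move=> t /andP[t0 _].
have [] := sol_hp_derive rho0 nu01 gamma0 A0 cReA (fun y (y0 : 0 < y) => u1E y (ltW y0)) t0.
have [] := sol_hp_derive rho0 nu01 gamma0 A0 cImA (fun y (y0 : 0 < y) => u2E y (ltW y0)) t0.
move=> d2 e2 d1 e1; split => //.
- rewrite e1 u1E ?(ltW t0)// u2E ?(ltW t0)//.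
  by apply: limn_sol_term_comb => // n; exact: Re_powerS.
(* The plus sign of the second equation is obtained with y = - Im a. *)
- rewrite e2 u1E ?(ltW t0)// u2E ?(ltW t0)// -[_ * sol _ _ _ _ cRe t]opprK -mulNr.
  by apply: limn_sol_term_comb => // n; rewrite Im_powerS mulNr opprK.
Qed.

End PowerSolution.

(** * Identification with the Mittag-Leffler series G *)

Section MittagLefflerSeries.
Context {R : realType}.
Variables (omega lambda gamma rho mu : R) (v : R[i]).
Hypotheses (rho0 : 0 < rho) (mu01 : 0 < mu <= 1) (gamma0 : 0 <= gamma).
Let a : R[i] := (- lambda%:C%C * (1 - v)).
Notation cRe := (fun n => complex.Re (a ^+ n)).
Notation cIm := (fun n => complex.Im (a ^+ n)).
Notation A := (`|complex.Re a| + `|complex.Im a| + 1).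

Let mu0 : 0 < mu. Proof. by case/andP: mu01. Qed.

Let A0 : 0 < A. Proof. by rewrite ltr_wpDl// addr_ge0. Qed.

Let cReA n : `|cRe n| <= A ^+ n. Proof. by have [] := normr_Re_Im_power_le a n. Qed.

Let cImA n : `|cIm n| <= A ^+ n. Proof. by have [] := normr_Re_Im_power_le a n. Qed.

(** The Prabhakar kernel of order n mu + 1 carries exactly the power t^(n mu), and the remaining
    factors of the term are a^n. *)
Lemma G_termE t n : 0 < t -> G_term omega lambda gamma rho mu v t n =
  (sol_term rho (- omega) mu gamma cRe n t +i* sol_term rho (- omega) mu gamma cIm n t)%C.
Proof.
move=> t0; have n0 : 0 <= n%:R * mu + 1 by rewrite addr_ge0// mulr_ge0// ltW.
rewrite /G_term /sol_term -(prabhakar_kernelE (- omega) rho0 (n%:R * gamma) n0 t0).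
rewrite /prabhakar_kernel addrK -exprMn -/a.
by case: (a ^+ n) => x y; apply/eqP; rewrite eq_complex /= !mulr0 subr0 add0r !eqxx.
Qed.

(** t = 0 is treated apart because the extended kernels vanish there, whereas the term n = 0 of G is
    1. *)
Lemma G_term0 n : G_term omega lambda gamma rho mu v 0 n = ((n == 0)%N%:R +i* 0)%C.
Proof.
rewrite /G_term; case: n => [|n].
  have z0 : - omega * 0 `^ rho = 0 by rewrite powR0 ?mulr0// gt_eqF.
  rewrite z0 !mul0r !expr0 powRr0 !mul1r add0r /prabhakar_ML limn_series1.
    by rewrite /prabhakar_term big_ord0 mulr0 add0r rgamma1 expr0 fact0 divr1 !mul1r.
  by case=> // k _; rewrite /prabhakar_term big_ord_recl addr0 !mul0r.
by rewrite powR0 ?mul0r ?mulr0// gt_eqF// mulr_gt0.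
Qed.

Lemma cvg_G_series t : 0 <= t -> series (G_term omega lambda gamma rho mu v t) @ \oo -->
  ((sol rho (- omega) mu gamma cRe t +i* sol rho (- omega) mu gamma cIm t)%C : R[i]^o).
Proof.
rewrite le_eqVlt => /orP[/eqP <-|t0].
  rewrite !sol0 expr0 /=; apply: cvg_near_cst; near=> n.
  have n0 : (0 < n)%N by near: n; exact: nbhs_infty_gt.
  rewrite /series/= big_ltn// big1_seq ?addr0 ?G_term0// => k.
  by rewrite mem_index_iota => /andP[_ /andP[k0 _]]; rewrite G_term0 gtn_eqF.
rewrite -(sol_series (- omega) rho0 mu01 gamma0 A0 cReA t0).
rewrite -(sol_series (- omega) rho0 mu01 gamma0 A0 cImA t0).
apply: cvg_series_complex; first by move=> n; exact: G_termE.
- exact: (is_cvg_sol rho0 mu01 gamma0 A0 cReA).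
- exact: (is_cvg_sol rho0 mu01 gamma0 A0 cImA).
Unshelve. all: by end_near. Qed.

Lemma G_sol t : 0 <= t -> G omega lambda gamma rho mu v t =
  (sol rho (- omega) mu gamma cRe t +i* sol rho (- omega) mu gamma cIm t)%C.
Proof. by move=> t0; rewrite /G; exact: (cvg_lim (@norm_hausdorff _ (R[i]^o)) (cvg_G_series t0)). Qed.

(** Multiplication by a, written in components, is the right-hand side of [real_system]. *)
Lemma cauchy_solutionP (b : R) (u : R -> R[i]) :
  cauchy_solution omega lambda gamma rho mu v b u <->
  real_system rho (- omega) gamma mu (complex.Re a) (complex.Im a) b
    (fun t => complex.Re (u t)) (fun t => complex.Im (u t)) /\ u 0 = 1.
Proof.
have aE (z : R[i]) : a * z = ((complex.Re a * complex.Re z - complex.Im a * complex.Im z) +i*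
    (complex.Re a * complex.Im z + complex.Im a * complex.Re z))%C by case: a z => ? ? [].
split=> [[[ac1 ac2] Hu u0]|[[ac1 ac2 Hu] u0]]; split => //.
  by split=> // t tb; have [d1 d2] := Hu t tb; rewrite -/a aE => -[e1 e2].
by move=> t tb; have [d1 d2 e1 e2] := Hu t tb; rewrite -/a aE e1 e2.
Qed.

End MittagLefflerSeries.

Local Open Scope complex_scope.

Theorem theorem4p2 (R : realType) (omega lambda gamma rho mu : R) (v : R[i])
    (homega : 0 < omega) (hlambda : 0 < lambda) (hgamma : 0 <= gamma)
    (hrho : 0 < rho <= 1) (hmu : 0 < mu <= 1) (hv : `|v| <= 1) :
  (forall t : R, 0 <= t ->
     cvgn (series (G_term omega lambda gamma rho mu v t))) /\
  (forall b : R, 0 < b ->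
     cauchy_solution omega lambda gamma rho mu v b
       (G omega lambda gamma rho mu v) /\
     (forall u : R -> R[i],
        cauchy_solution omega lambda gamma rho mu v b u ->
        forall t : R, 0 <= t <= b -> u t = G omega lambda gamma rho mu v t)).
Proof.
have rho0 : 0 < rho by case/andP: hrho.
have Gs := G_sol omega lambda v rho0 hmu hgamma.
split=> [t t0|b b0]; first by apply/cvg_ex; eexists; exact: cvg_G_series.
have sysG := power_solution_system (w := - omega) rho0 hmu hgamma b0
  (fun t t0 => congr1 (@complex.Re R) (Gs t t0)) (fun t t0 => congr1 (@complex.Im R) (Gs t t0)).
have G0 : G omega lambda gamma rho mu v 0 = 1 by rewrite Gs// !sol0.
split; first exact/cauchy_solutionP.
move=> u /cauchy_solutionP[sysu u0] t tb.
have [] := real_system_unique rho0 hmu b0 sysu sysG _ _ tb; rewrite ?u0 ?G0//.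
by case: (u t) (G _ _ _ _ _ _ _) => [x y] [x' y'] /= -> ->.
Qed.
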